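(* Let $A\in\mathbb{R}^{n\times d}$, $b\in\mathbb{R}^n$, let $g:\mathbb{R}^d\to\mathbb{R}$ be convex and twice differentiable with constant psd Hessian $H^g$, and let $h:\mathbb{R}^d\to\mathbb{R}\cup\{+\infty\}$ be a closed proper convex function. Consider the problem \[ \text{minimize}_{x\in\mathbb{R}^d}\ \tfrac12\|Ax-b\|_2^2+g(x)+h(x), \] and assume it has a solution. Fix initial iterates $\tilde x^0,\tilde z^0,\tilde u^0\in\mathbb{R}^d$, a stepsize $\rho>0$, a summable sequence of tolerances $\{\varepsilon^k\}_{k\ge0}\subset(0,\infty)$, and $\delta\in(0,1)$. Let $H=A^{T}A+H^{g}$ and construct the randomized Nyström preconditioner $P$ of $H$ (with regularization $\rho$) from a $d\times s$ standard Gaussian test matrix with \[ s\geq 8\left(\sqrt{d_{\mathrm{eff}}(\rho)}+\sqrt{8\log(16/\delta)}\right)^{2}. \] Run NysADMM: for $k=0,1,2,\dots$, (i) let $r^k=\rho\tilde z^k-\rho\tilde u^k+A^{T}A\tilde x^k+H^{g}\tilde x^k-A^{T}(A\tilde x^k-b)-\nabla g(\tilde x^k)$, and let $\tilde x^{k+1}$ be the output of $T^k=4+\big\lceil 2\log\big(R/(\varepsilon^k\rho)\big)\big\rceil$ iterations of preconditioned conjugate gradients with preconditioner $P$ (started from $0$) on the system $(H+\rho I)x=r^k$; (ii) $\tilde z^{k+1}=\mathrm{argmin}_z\{h(z)+\frac{\rho}{2}\|\tilde x^{k+1}-z+\tilde u^k\|_2^2\}$; (iii) $\tilde u^{k+1}=\tilde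 u^k+\tilde x^{k+1}-\tilde z^{k+1}$. Assume $\|r^k\|_2\le R$ for all $k$, for some constant $R$. Then with probability at least $1-\delta$: 1. for all $k\ge0$, $\|\tilde x^{k+1}-x^{k+1}\|_2\le\varepsilon^k$, where $x^{k+1}$ is the exact solution of $(H+\rho I)x=r^k$; 2. as $k\to\infty$, $\tilde x^k$ converges to a solution of the primal problem above and $\rho\tilde u^k$ converges to a solution of its dual problem $\text{maximize}_{y}\ -\big(f^*(-y)+h^*(y)\big)$, where $f(x)=\tfrac12\|Ax-b\|_2^2+g(x)$ and $^*$ denotes the convex conjugate.
   Context: For symmetric psd $H$ and $\rho>0$, $d_{\mathrm{eff}}(\rho)=\mathrm{tr}\big(H(H+\rho I)^{-1}\big)$. Given $\Omega\in\mathbb{R}^{d\times s}$ with i.i.d. $N(0,1)$ entries, the Nyström approximation is $H\langle\Omega\rangle=(H\Omega)(\Omega^{T}H\Omega)^{\dagger}(H\Omega)^{T}=U\hat\Lambda U^{T}$ with $U\in\mathbb{R}^{d\times s}$ having orthonormal columns and $\hat\Lambda=\mathrm{diag}(\hat\lambda_1\ge\dots\ge\hat\lambda_s)$; the randomized Nyström preconditioner is $P=\frac{1}{\hat\lambda_s+\rho}U(\hat\Lambda+\rho I)U^{T}+(I-UU^{T})$. The preconditioner is built once and reused in every iteration. $\log$ is the natural logarithm. A sequence $\{\varepsilon^k\}$ of positive numbers is summable if $\sum_k\varepsilon^k<\infty$. *)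

(* Defs.v *)
From HB Require Import structures.
From mathcomp Require Import all_boot all_order all_algebra.
From mathcomp Require Import all_classical all_reals all_analysis.
Set Implicit Arguments.
Unset Strict Implicit.
Unset Printing Implicit Defensive.
Import Order.TTheory GRing.Theory Num.Theory.
Import numFieldNormedType.Exports.
Local Open Scope classical_set_scope.
Local Open Scope ring_scope.

Definition norm2 {R : realType} {d : nat} (v : 'cV[R]_d) : R :=
  Num.sqrt (\sum_(i < d) v i 0 ^+ 2).

Definition dotv {R : realType} {d : nat} (u v : 'cV[R]_d) : R :=
  (u^T *m v) 0 0.

Definition is_mp_pinv {R : realType} {m n : nat}
    (M : 'M[R]_(m, n)) (X : 'M[R]_(n, m)) : Prop :=
  [/\ M *m X *m M = M, X *m M *m X = X,
      (M *m X)^T = M *m X & (X *m M)^T = X *m M].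

Definition mp_pinv {R : realType} {m n : nat} (M : 'M[R]_(m, n)) : 'M[R]_(n, m) :=
  xget 0 [set X | is_mp_pinv M X].

Definition deff {R : realType} {d : nat} (H : 'M[R]_d) (rho : R) : R :=
  \tr (H *m invmx (H + rho%:M)).

Definition nystrom {R : realType} {d s : nat} (H : 'M[R]_d) (Om : 'M[R]_(d, s))
  : 'M[R]_d :=
  (H *m Om) *m mp_pinv (Om^T *m H *m Om) *m (H *m Om)^T.

Definition nystrom_eig {R : realType} {d s : nat} (H : 'M[R]_d)
    (Om : 'M[R]_(d, s)) (U : 'M[R]_(d, s)) (lam : 'rV[R]_s) : Prop :=
  [/\ U^T *m U = 1%:M,
      nystrom H Om = U *m diag_mx lam *m U^T
    & forall i j : 'I_s, (i <= j)%N -> lam 0 j <= lam 0 i].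

Definition lam_last {R : realType} {s : nat} (lam : 'rV[R]_s) : R :=
  nth 0 [seq lam 0 i | i <- enum 'I_s] s.-1.

Definition nys_precond {R : realType} {d s : nat} (rho : R)
    (U : 'M[R]_(d, s)) (lam : 'rV[R]_s) : 'M[R]_d :=
  (lam_last lam + rho)^-1 *: (U *m (diag_mx lam + rho%:M) *m U^T)
  + (1%:M - U *m U^T).

Definition pcg_step {R : realType} {d : nat} (M Pinv : 'M[R]_d)
    (st : 'cV[R]_d * 'cV[R]_d * 'cV[R]_d * 'cV[R]_d) :=
  let: (x, r, z, p) := st in
  let Mp := M *m p in
  let alpha := dotv r z / dotv p Mp in
  let x' := x + alpha *: p in
  let r' := r - alpha *: Mp in
  let z' := Pinv *m r' in
  let beta := dotv r' z' / dotv r z in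
  (x', r', z', z' + beta *: p).

Definition pcg {R : realType} {d : nat} (M P : 'M[R]_d) (c : 'cV[R]_d)
    (T : nat) : 'cV[R]_d :=
  (iter T (pcg_step M (invmx P)) (0, c, invmx P *m c, invmx P *m c)).1.1.1.

Definition pcg_iters {R : realType} (Rb eps rho : R) : nat :=
  Num.truncn ((4 + Num.ceil (2 * ln (Rb / (eps * rho))))%:~R : R).

Definition grad {R : realType} {d : nat} (g : 'cV[R]_d -> R) (x : 'cV[R]_d)
  : 'cV[R]_d :=
  \col_i ('d g x (delta_mx i 0 : 'cV[R]_d)).

Definition twice_diff_const_hessian {R : realType} {d : nat}
    (g : 'cV[R]_d -> R) (Hg : 'M[R]_d) : Prop :=
  forall x, [/\ differentiable g x, differentiable (grad g) x
             & forall v, 'd (grad g) x v = Hg *m v].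

Definition psd {R : realType} {d : nat} (M : 'M[R]_d) : Prop :=
  M^T = M /\ forall v : 'cV[R]_d, 0 <= dotv v (M *m v).

Definition econvex {R : realType} {d : nat} (h : 'cV[R]_d -> \bar R) : Prop :=
  forall (x y : 'cV[R]_d) (t : R), 0 <= t <= 1 ->
    (h (t *: x + (1 - t) *: y)%R <= t%:E * h x + (1 - t)%R%:E * h y)%E.

Definition proper_fun {R : realType} {d : nat} (h : 'cV[R]_d -> \bar R) : Prop :=
  (forall x, h x != -oo%E) /\ exists x, h x \is a fin_num.

(* closed = lower semicontinuous (closed epigraph) *)
Definition closed_proper_convex {R : realType} {d : nat}
    (h : 'cV[R]_d -> \bar R) : Prop :=
  [/\ lower_semicontinuous h, proper_fun h & econvex h].

Definition conjugate {R : realType} {d : nat} (phi : 'cV[R]_d -> \bar R)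
    (y : 'cV[R]_d) : \bar R :=
  ereal_sup [set ((dotv y x)%:E - phi x)%E | x in [set: 'cV[R]_d]].

Definition fsmooth {R : realType} {n d : nat} (A : 'M[R]_(n, d)) (b : 'cV[R]_n)
    (g : 'cV[R]_d -> R) (x : 'cV[R]_d) : R :=
  2^-1 * norm2 (A *m x - b) ^+ 2 + g x.

Definition primal_obj {R : realType} {n d : nat} (A : 'M[R]_(n, d))
    (b : 'cV[R]_n) (g : 'cV[R]_d -> R) (h : 'cV[R]_d -> \bar R)
    (x : 'cV[R]_d) : \bar R :=
  ((fsmooth A b g x)%:E + h x)%E.

Definition primal_solution {R : realType} {n d : nat} (A : 'M[R]_(n, d))
    (b : 'cV[R]_n) (g : 'cV[R]_d -> R) (h : 'cV[R]_d -> \bar R)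
    (x : 'cV[R]_d) : Prop :=
  forall x', (primal_obj A b g h x <= primal_obj A b g h x')%E.

Definition dual_obj {R : realType} {n d : nat} (A : 'M[R]_(n, d))
    (b : 'cV[R]_n) (g : 'cV[R]_d -> R) (h : 'cV[R]_d -> \bar R)
    (y : 'cV[R]_d) : \bar R :=
  (- (conjugate (fun x => (fsmooth A b g x)%:E) (- y) + conjugate h y))%E.

Definition dual_solution {R : realType} {n d : nat} (A : 'M[R]_(n, d))
    (b : 'cV[R]_n) (g : 'cV[R]_d -> R) (h : 'cV[R]_d -> \bar R)
    (y : 'cV[R]_d) : Prop :=
  forall y', (dual_obj A b g h y' <= dual_obj A b g h y)%E.

Definition admm_rhs {R : realType} {n d : nat} (A : 'M[R]_(n, d))
    (b : 'cV[R]_n) (g : 'cV[R]_d -> R) (Hg : 'M[R]_d) (rho : R)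
    (x z u : 'cV[R]_d) : 'cV[R]_d :=
  rho *: z - rho *: u + A^T *m A *m x + Hg *m x - A^T *m (A *m x - b)
  - grad g x.

Definition std_gaussian_matrix {R : realType} {dT : measure_display}
    {T : measurableType dT} (P : probability T R) {d s : nat}
    (Om : T -> 'M[R]_(d, s)) : Prop :=
  [/\ forall i j, measurable_fun [set: T] (fun w => Om w i j),
      forall i j (B : set R), measurable B ->
        P ((fun w => Om w i j) @^-1` B) = normal_prob 0 1 B
    & forall B : 'I_d -> 'I_s -> set R, (forall i j, measurable (B i j)) ->
        P (\big[setI/setT]_(k : 'I_d * 'I_s)
              ((fun w => Om w k.1 k.2) @^-1` B k.1 k.2))
        = (\prod_(k : 'I_d * 'I_s)
              P ((fun w => Om w k.1 k.2) @^-1` B k.1 k.2))%E].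

(* Main.v *)
Require Import Defs.
From HB Require Import structures.
From mathcomp Require Import all_boot all_order all_algebra.
From mathcomp Require Import all_classical all_reals all_analysis.
From mathcomp Require Import measurable_realfun ring lra.
Set Implicit Arguments.
Unset Strict Implicit.
Unset Printing Implicit Defensive.
Import Order.TTheory GRing.Theory Num.Theory.
Import numFieldNormedType.Exports.
Local Open Scope classical_set_scope.
Local Open Scope ring_scope.

(** Write [H (H + rho I)^-1 = F F^T].  The Gaussian sketch is handled by a
    PAC-Bayes argument: suitably normalised exponential moments of [Om^T F e],
    averaged over random sign vectors [e], and of the columns of [Om^T F], have
    expectation one, so by Markov their sum is at most [2 / delta] with
    probability [1 - delta].  If [Om^T F v = 0], biasing the signs towards [v]
    contradicts that bound unless [|F v|^2 <= 11/12 |v|^2].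

    Lifted through the Nystrom residual this gives [H - H<Om> <= 11 rho I],
    so the preconditioned matrix has condition number at most 16, and the
    Chebyshev bound for conjugate gradients contracts by [3/5 <= e^(-1/2)] per
    step: the prescribed number of iterations reaches accuracy [eps k].

    Inexact ADMM with summable errors is a quasi-Fejer perturbation of
    Douglas-Rachford splitting in the variable [z + u]: the distance to any
    KKT point decreases up to [eps k], the residuals vanish, cluster points are
    KKT points, hence the whole sequence converges; KKT points solve the primal
    and, by weak duality, the dual problem. *)

(** The residual of a Nystrom approximation is annihilated by [Om^T], so only vectors v with
    [Om^T F v = 0] matter. For such v, biased signs make the sign sum long while its sketch keeps
    only the energy of the fluctuations; the exponential moment then outweighs the relative entropy,
    about half of |v|^2, that the bias costs. The constants form a chain. An eigenvalue t of the
    residual with t / (t + rho) <= 11/12 satisfies t <= 11 rho. The sketch size also gives 8 deff <=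
    s, which forces the last Nystrom eigenvalue below rho / 7. Together these place H + rho I
    between 7/8 and 14 times (lam_s + rho) P, a ratio of 16, and (sqrt 16 - 1) / (sqrt 16 + 1) =
    3/5. The 4 extra iterations contribute e^(-2), which absorbs the factor 2 of the Chebyshev
    bound. Conjugate gradients are analysed through quadratic forms: the Chebyshev bound comes from
    an operator version of the Pell identity instead of a spectral decomposition. *)

(** * Euclidean inner product, norm and Cauchy-Schwarz inequalities *)

Section dotv.
Context (R : realType).
Implicit Types (d : nat).

Lemma dotvE d (u v : 'cV[R]_d) : dotv u v = \sum_i u i 0 * v i 0.
Proof. by rewrite /dotv mxE; apply: eq_bigr => i _; rewrite mxE. Qed.

Lemma dotvC d (u v : 'cV[R]_d) : dotv u v = dotv v u.
Proof. by rewrite !dotvE; apply: eq_bigr => i _; rewrite mulrC. Qed.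

Lemma dotvDr d (u v w : 'cV[R]_d) : dotv u (v + w) = dotv u v + dotv u w.
Proof. by rewrite /dotv mulmxDr mxE. Qed.

Lemma dotvDl d (u v w : 'cV[R]_d) : dotv (u + v) w = dotv u w + dotv v w.
Proof. by rewrite ![dotv _ w]dotvC dotvDr. Qed.

Lemma dotvNr d (u v : 'cV[R]_d) : dotv u (- v) = - dotv u v.
Proof. by rewrite /dotv mulmxN mxE. Qed.

Lemma dotvNl d (u v : 'cV[R]_d) : dotv (- u) v = - dotv u v.
Proof. by rewrite dotvC dotvNr dotvC. Qed.

Lemma dotvBr d (u v w : 'cV[R]_d) : dotv u (v - w) = dotv u v - dotv u w.
Proof. by rewrite dotvDr dotvNr. Qed.

Lemma dotvBl d (u v w : 'cV[R]_d) : dotv (u - v) w = dotv u w - dotv v w.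
Proof. by rewrite dotvDl dotvNl. Qed.

Lemma dotvZr d (a : R) (u v : 'cV[R]_d) : dotv u (a *: v) = a * dotv u v.
Proof. by rewrite /dotv -scalemxAr mxE. Qed.

Lemma dotvZl d (a : R) (u v : 'cV[R]_d) : dotv (a *: u) v = a * dotv u v.
Proof. by rewrite dotvC dotvZr dotvC. Qed.

Lemma dotv0r d (u : 'cV[R]_d) : dotv u 0 = 0.
Proof. by rewrite /dotv mulmx0 mxE. Qed.

Lemma dotv0l d (u : 'cV[R]_d) : dotv 0 u = 0.
Proof. by rewrite dotvC dotv0r. Qed.

Lemma dotv_sumr d (I : Type) (r : seq I) (Q : pred I) (u : 'cV[R]_d) (F : I -> 'cV[R]_d) :
  dotv u (\sum_(i <- r | Q i) F i) = \sum_(i <- r | Q i) dotv u (F i).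
Proof. by rewrite /dotv mulmx_sumr summxE. Qed.

Lemma dotv_suml d (I : Type) (r : seq I) (Q : pred I) (u : 'cV[R]_d) (F : I -> 'cV[R]_d) :
  dotv (\sum_(i <- r | Q i) F i) u = \sum_(i <- r | Q i) dotv (F i) u.
Proof. by rewrite dotvC dotv_sumr; apply: eq_bigr => i _; rewrite dotvC. Qed.

Lemma dotv_mulmx d e (M : 'M[R]_(d, e)) u v : dotv u (M *m v) = dotv (M^T *m u) v.
Proof. by rewrite /dotv trmx_mul trmxK mulmxA. Qed.

Lemma dotvv_ge0 d (u : 'cV[R]_d) : 0 <= dotv u u.
Proof. by rewrite dotvE sumr_ge0// => i _; rewrite -expr2 sqr_ge0. Qed.

Lemma dotvv_eq0 d (u : 'cV[R]_d) : dotv u u = 0 -> u = 0.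
Proof.
rewrite dotvE => /eqP; rewrite psumr_eq0 => [/allP u0|i _]; last by rewrite -expr2 sqr_ge0.
apply/matrixP => i j; rewrite ord1 mxE.
have := u0 i; rewrite mem_index_enum => /(_ isT); rewrite implyTb.
by rewrite mulf_eq0 orbb => /eqP.
Qed.

Lemma norm2_sqr d (v : 'cV[R]_d) : norm2 v ^+ 2 = dotv v v.
Proof.
rewrite sqr_sqrtr ?sumr_ge0// => [|i _]; last exact: sqr_ge0.
by rewrite dotvE; apply: eq_bigr => i _; rewrite expr2.
Qed.

Lemma norm2_ge0 d (v : 'cV[R]_d) : 0 <= norm2 v.
Proof. exact: sqrtr_ge0. Qed.

Lemma norm2E d (v : 'cV[R]_d) : norm2 v = Num.sqrt (dotv v v).
Proof. by rewrite -norm2_sqr sqrtr_sqr ger0_norm// norm2_ge0. Qed.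

Lemma norm2_le_cst d (v : 'cV[R]_d) (c : R) : 0 <= c ->
  (norm2 v <= c) = (dotv v v <= c ^+ 2).
Proof. by move=> c0; rewrite -norm2_sqr ler_pXn2r ?nnegrE ?norm2_ge0. Qed.

Lemma psd_CS d (M : 'M[R]_d) u v : psd M ->
  dotv u (M *m v) ^+ 2 <= dotv u (M *m u) * dotv v (M *m v).
Proof.
move=> [Msym M0].
have MC a b : dotv a (M *m b) = dotv b (M *m a) by rewrite dotv_mulmx Msym dotvC.
set a := dotv u (M *m u); set b := dotv u (M *m v); set c := dotv v (M *m v).
have q t s : 0 <= t ^+ 2 * a + 2 * (t * s) * b + s ^+ 2 * c.
  have := M0 (t *: u + s *: v).
  rewrite mulmxDr !dotvDl !dotvDr -!scalemxAr !dotvZl !dotvZr (MC v u) -/a -/b -/c.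
  by congr (0 <= _); ring.
have a0 : 0 <= a by exact: M0.
have c0 : 0 <= c by exact: M0.
(* When c = 0 the form [q 1] is affine in its second argument, so a nonzero b would make it
   negative. *)
have [c00|c00] := eqVneq c 0.
  have := q 1 (- (a + 1) * b); rewrite c00.
  have -> : 1 ^+ 2 * a + 2 * (1 * (- (a + 1) * b)) * b + (- (a + 1) * b) ^+ 2 * 0
    = a - 2 * (a + 1) * b ^+ 2 by ring.
  rewrite mulr0 => h.
  have : 0 <= b ^+ 2 by exact: sqr_ge0.
  rewrite le_eqVlt => /predU1P[<-//|b2].
  have [a00|a00] := eqVneq a 0; last first.
    have := q 1 (- (a / b)); rewrite c00.
    have b0 : b != 0 by apply: contraTneq b2 => ->; rewrite expr0n ltxx.
    have -> : 1 ^+ 2 * a + 2 * (1 * (- (a / b))) * b + (- (a / b)) ^+ 2 * 0 = - a by field.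
    by rewrite oppr_ge0 => a1; move: a00; rewrite eq_le a1 a0.
  by move: h; rewrite a00; nra.
have cp : 0 < c by rewrite lt_def c00.
have := q c (- b).
have -> : c ^+ 2 * a + 2 * (c * (- b)) * b + (- b) ^+ 2 * c = c * (a * c - b ^+ 2) by ring.
by rewrite pmulr_rge0// subr_ge0.
Qed.

Lemma psd1 d : psd (1%:M : 'M[R]_d).
Proof. by split=> [|v]; rewrite ?trmx1 ?mul1mx ?dotvv_ge0. Qed.

Lemma dotv_CS d (u v : 'cV[R]_d) : dotv u v ^+ 2 <= dotv u u * dotv v v.
Proof. by have := psd_CS u v (psd1 d); rewrite !mul1mx. Qed.

Lemma dotv_le_norm2 d (u v : 'cV[R]_d) : `|dotv u v| <= norm2 u * norm2 v.
Proof.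
rewrite -(ler_pXn2r (n := 2))// ?nnegrE ?mulr_ge0 ?norm2_ge0//.
by rewrite real_normK ?num_real// exprMn !norm2_sqr dotv_CS.
Qed.

Lemma norm2D d (u v : 'cV[R]_d) : norm2 (u + v) <= norm2 u + norm2 v.
Proof.
rewrite norm2_le_cst ?addr_ge0 ?norm2_ge0// dotvDl !dotvDr (dotvC v u).
have := dotv_le_norm2 u v; move/(le_trans (ler_norm _)).
by rewrite -!norm2_sqr; nra.
Qed.

Lemma norm2N d (u : 'cV[R]_d) : norm2 (- u) = norm2 u.
Proof. by rewrite !norm2E dotvNl dotvNr opprK. Qed.

Lemma norm2Z d (a : R) (u : 'cV[R]_d) : norm2 (a *: u) = `|a| * norm2 u.
Proof.
by rewrite !norm2E dotvZl dotvZr mulrA -expr2 sqrtrM ?sqr_ge0// sqrtr_sqr.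
Qed.

Lemma norm2_eq0 d (u : 'cV[R]_d) : norm2 u = 0 -> u = 0.
Proof. by move=> u0; apply: dotvv_eq0; rewrite -norm2_sqr u0 expr0n. Qed.

Lemma norm20 d : norm2 (0 : 'cV[R]_d) = 0.
Proof. by rewrite norm2E dotv0r sqrtr0. Qed.
End dotv.

(** * Gaussian integrals and the law of a Gaussian sketch *)

Lemma ge0_integral_normal_prob (R : realType) (m sigma : R) (f : R -> \bar R) :
  (forall x, 0 <= f x)%E -> measurable_fun setT f ->
  (\int[normal_prob m sigma]_x f x =
   \int[lebesgue_measure]_x (f x * (normal_pdf m sigma x)%:E))%E.
Proof.
move=> f0 mf; have dom := normal_prob_dominates m sigma.
rewrite -(Radon_Nikodym_SigmaFinite.change_of_variables dom)//.
have mpdf := @measurable_normal_pdf R m sigma.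
apply: ae_eq_integral => //.
- apply: emeasurable_funM => //.
  exact: measurable_int (Radon_Nikodym_SigmaFinite.f_integrable _).
- by apply: emeasurable_funM => //; exact/measurable_EFinP.
- apply: ae_eqe_mul2l => /=; apply: integral_ae_eq => //=.
  + exact: Radon_Nikodym_SigmaFinite.f_integrable.
  + exact/measurable_EFinP.
  + by move=> E E01 mE; rewrite -Radon_Nikodym_SigmaFinite.f_integral.
Qed.

(** Completing the square turns the integrand times the standard density into a multiple of the
    normal density of mean [mm] and variance [1 / q]. The parameter t may be negative as long as q >
    0; the trace estimate uses this range. *)
Lemma integral_normal_prob_expR_sqr (R : realType) (t f y : R) :
  0 < 1 + t * f ^+ 2 ->
  (\int[normal_prob (0:R) (1:R)]_x (expR (- (t * (y + f * x) ^+ 2 / 2)))%:E =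
  ((Num.sqrt (1 + t * f ^+ 2))^-1 *
   expR (- (t / (1 + t * f ^+ 2) * y ^+ 2 / 2)))%:E)%E.
Proof.
set q := 1 + t * f ^+ 2 => q0.
have mg : measurable_fun setT (fun x : R => expR (- (t * (y + f * x) ^+ 2 / 2))).
  apply: measurableT_comp => //; apply: measurableT_comp => //.
  apply: measurable_funM => //; apply: measurable_funM => //.
  apply: measurable_funX; apply: measurable_funD => //.
rewrite ge0_integral_normal_prob => [|x|]; last 2 first.
- by rewrite lee_fin expR_ge0.
- exact/measurable_EFinP.
pose si := (Num.sqrt q)^-1.
have sq0 : 0 < Num.sqrt q by rewrite sqrtr_gt0.
have si0 : si != 0 by rewrite invr_neq0 ?gt_eqF.
have si2 : si ^+ 2 = q^-1 by rewrite exprVn sqr_sqrtr ?ltW.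
pose mm := - (t * f * y / q).
transitivity (\int[lebesgue_measure]_x
  ((si * expR (- (t / q * y ^+ 2 / 2)))%:E * (normal_pdf mm si x)%:E))%E.
  apply: eq_integral => x _; rewrite -!EFinM; congr EFin.
  rewrite !normal_pdfE ?oner_eq0// /normal_peak /normal_fun.
  rewrite expr1n mul1r si2 -[q^-1 * pi *+ 2]mulrnAr.
  rewrite sqrtrM ?invr_ge0 1?ltW// sqrtrV 1?ltW// invfM invrK.
  set B := expR (- (x - 0) ^+ 2 / _); set D := expR (- (x - mm) ^+ 2 / _).
  have BD : expR (- (t * (y + f * x) ^+ 2 / 2)) * B =
            expR (- (t / q * y ^+ 2 / 2)) * D.
    rewrite -!expRD; congr expR; rewrite /mm /q; field.
    by move: q0; rewrite /q => q0; rewrite gt_eqF.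
  rewrite mulrCA BD -/si; set C := expR _; set pk := (Num.sqrt _)^-1.
  suff -> : si * C * (Num.sqrt q * pk * D) = (si * Num.sqrt q) * (pk * (C * D)).
    by rewrite mulVf ?gt_eqF// mul1r.
  by ring.
rewrite ge0_integralZl//.
- by rewrite integral_normal_pdf mule1.
- by apply/measurable_EFinP; exact: measurable_normal_pdf.
- by move=> x _; rewrite lee_fin normal_pdf_ge0.
- by rewrite lee_fin mulr_ge0// ?expR_ge0// invr_ge0 ltW.
Qed.

Section gaussian_sketch.
Context (R : realType) (dT : measure_display) (T : measurableType dT).
Context (d s : nat) (X : 'I_d * 'I_s -> T -> R).
Hypothesis mX : forall k, measurable_fun setT (X k).
Variable f : 'I_d -> R.

(** With all index pairs in [l] this is [Om^T f]; partial lists allow the entries to be adjoined one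
    at a time. *)
Let sketch (l : seq ('I_d * 'I_s)) (w : T) : s.-tuple R :=
  [tuple \sum_(k <- l | k.2 == t) f k.1 * X k w | t < s].

Let mass (l : seq ('I_d * 'I_s)) (t : 'I_s) : R :=
  \sum_(k <- l | k.2 == t) f k.1 ^+ 2.

(* The expectation of [prod_t expR (- th (y_t + N(0, m t))^2 / 2)]; this family
   is stable under integrating out one more Gaussian entry. *)
Let gauss_prod (th : R) (m : 'I_s -> R) (y : s.-tuple R) : R :=
  \prod_(t < s) ((Num.sqrt (1 + th * m t))^-1 *
                 expR (- (th / (1 + th * m t) * tnth y t ^+ 2 / 2))).

(* [mu] need not be a probability: the induction restricts it to events of
   the entry that is split off. *)
Let product_rule (mu : set T -> \bar R) (l : seq ('I_d * 'I_s)) :=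
  forall B : 'I_d * 'I_s -> set R, (forall k, measurable (B k)) ->
  (mu (\big[setI/setT]_(k <- l) (X k @^-1` B k)) =
   mu setT * \prod_(k <- l) normal_prob 0 1 (B k))%E.

Let measurable_gauss_prod th m : measurable_fun setT (gauss_prod th m).
Proof.
apply: measurable_prod => t _.
apply: measurable_funM => //; apply: measurableT_comp => //.
apply: measurableT_comp => //; apply: measurable_funM => //.
apply: measurable_funM => //; apply: measurable_funX.
exact: measurable_tnth.
Qed.

Let gauss_prod_ge0 th m y : 0 <= gauss_prod th m y.
Proof. by apply: prodr_ge0 => t _; rewrite mulr_ge0 ?expR_ge0 ?invr_ge0. Qed.

Let measurable_sketch l : measurable_fun setT (sketch l).
Proof.
apply/measurable_fun_tnthP => t.
rewrite (_ : _ \o _ = fun w => \sum_(k <- l | k.2 == t) f k.1 * X k w); last first.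
  by apply/funext => w /=; rewrite tnth_mktuple.
elim: l => [|k l IH].
  rewrite (_ : (fun _ => _) = cst 0)//; apply/funext => w; exact: big_nil.
rewrite (_ : (fun _ => _) = fun w =>
    if k.2 == t then f k.1 * X k w + \sum_(k <- l | k.2 == t) f k.1 * X k w
    else \sum_(k <- l | k.2 == t) f k.1 * X k w).
  by case: (k.2 == t) => //; apply: measurable_funD => //; apply: measurable_funM.
by apply/funext => w; rewrite big_cons.
Qed.

Let upd (k : 'I_d * 'I_s) (z : s.-tuple R * measurableTypeR R) : s.-tuple R :=
  [tuple (if k.2 == t then f k.1 * z.2 + tnth z.1 t else tnth z.1 t) | t < s].

Let measurable_upd k : measurable_fun setT (upd k).
Proof.
apply/measurable_fun_tnthP => t.
rewrite (_ : _ \o _ = fun z : s.-tuple R * measurableTypeR R =>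
    if k.2 == t then f k.1 * z.2 + tnth z.1 t else tnth z.1 t); last first.
  by apply/funext => w /=; rewrite tnth_mktuple.
have mt : measurable_fun setT (fun z : s.-tuple R * measurableTypeR R => tnth z.1 t).
  by apply: (measurableT_comp (measurable_tnth t)).
by case: (k.2 == t) => //; apply: measurable_funD => //; apply: measurable_funM.
Qed.

(** Independence is available only on rectangles, so the law is built by induction on the entries.
    The new entry is independent of the old sketch because the induction hypothesis also applies to
    [mu] restricted to an event of that entry; the integral then follows by Tonelli, integrating the
    new Gaussian first. *)
Lemma sketch_law (l : seq ('I_d * 'I_s)) : uniq l ->
  exists la : probability (s.-tuple R) R,
  (forall mu : {finite_measure set T -> \bar R}, product_rule mu l ->
     forall A, measurable A -> (mu (sketch l @^-1` A) = mu setT * la A)%E) /\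
  (forall th m, (forall t, 0 < 1 + th * m t) ->
     (forall t, 0 < 1 + th * (m t + mass l t)) ->
     (\int[la]_y (gauss_prod th m y)%:E =
      (\prod_(t < s) (Num.sqrt (1 + th * (m t + mass l t)))^-1)%:E)%E).
Proof.
elim: l => [_|k l IH /= /andP[kl /IH[la [IH1 IH2]]]].
  exists (dirac [tuple (0:R) | t < s]); split.
    move=> mu _ A mA; rewrite /= diracE.
    have -> : sketch [::] = cst [tuple (0:R) | t < s].
      apply/funext => w; apply: eq_from_tnth => t.
      by rewrite !tnth_mktuple big_nil.
    rewrite preimage_cst; case: ifP => _; first by rewrite mule1.
    by rewrite measure0 mule0.
  move=> th m m0 m1; rewrite integral_dirac//.
    rewrite diracT mul1e; congr EFin; apply: eq_bigr => t _.
    by rewrite tnth_mktuple expr0n /= mulr0 mul0r oppr0 expR0 mulr1 /mass big_nil addr0.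
  exact/measurable_EFinP.
pose nu := normal_prob (0:R) (1:R).
pose updm : {mfun (s.-tuple R * measurableTypeR R)%type >-> (s.-tuple R)} :=
  mfun_Sub (mem_set (measurable_upd k)).
exists (distribution (la \x nu)%E updm); split.
  move=> mu rule.
  have rect A B : measurable A -> measurable B ->
      (mu (sketch l @^-1` A `&` X k @^-1` B) = mu setT * la A * nu B)%E.
    move=> mA mB.
    have mXB : measurable (X k @^-1` B).
      by rewrite -[X in measurable X]setTI; exact: mX.
    have rB B0 : (forall k', measurable (B0 k')) -> measurable B ->
      (mu (\big[setI/setT]_(k <- l) (X k @^-1` B0 k) `&` X k @^-1` B) =
       mu setT * (nu B * \prod_(k <- l) nu (B0 k)))%E.
      move=> mB0 _.
      have := rule (fun k' => if k' == k then B else B0 k').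
      have out k' : k' \in l -> (if k' == k then B else B0 k') = B0 k'.
        by move=> k'l; rewrite ifN//; apply: contraNneq kl => <-.
      rewrite !big_cons eqxx (eq_big_seq (fun k' => X k' @^-1` B0 k')); last first.
        by move=> k' /out ->.
      rewrite [X in (_ * (_ * X))%E](eq_big_seq (fun k' => nu (B0 k'))); last first.
        by move=> k' /out ->.
      by rewrite setIC; apply => k'; case: ifP.
    have -> : mu (sketch l @^-1` A `&` X k @^-1` B) = mrestr mu mXB (sketch l @^-1` A) by [].
    have mT : (mrestr mu mXB setT = mu setT * nu B)%E.
      have := rB (fun=> setT) (fun=> measurableT) mB.
      rewrite /mrestr big1 => [->|]; last by move=> *; rewrite preimage_setT.
      by rewrite big1 ?mule1// => *; exact: probability_setT.
    rewrite (IH1 [the {finite_measure set T -> \bar R} of mrestr mu mXB]) //.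
      by rewrite [X in (X * _)%E]mT muleAC.
    by move=> B0 mB0; rewrite [X in _ = (X * _)%E]mT -[LHS]/(mu (_ `&` _)) rB// muleA.
  have finT : mu setT \is a fin_num by exact: fin_num_measure.
  have c0 : 0 <= fine (mu setT) by rewrite fine_ge0.
  pose c := NngNum c0.
  have cE : (c%:num%:E = mu setT)%E by rewrite fineK.
  have mpair : measurable_fun setT (fun w => (sketch l w, X k w : measurableTypeR R)).
    by apply: measurable_fun_pair; [exact: measurable_sketch|exact: mX].
  have joint C : measurable C ->
      (mu ((fun w => (sketch l w, X k w : measurableTypeR R)) @^-1` C) = mu setT * (la \x nu) C)%E.
    move=> mC.
    (* The image of [mu] and the rescaled [la \x nu] both agree on rectangles with the product of
       [m1] and [nu], so uniqueness of product measures, used twice, identifies them. *)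
    pose m1 := [the {finite_measure set _ -> \bar R} of mscale c la].
    have e1 := @product_measure_unique _ _ _ _ R m1 nu
      [the measure _ _ of pushforward mu (mfun_Sub (mem_set mpair))] _ C mC.
    rewrite -[LHS]e1; last first.
      by move=> A B mA mB; rewrite /m1 /= /mscale /= fineK// -rect.
    have -> := @product_measure_unique _ _ _ _ R m1 nu
      [the measure _ _ of mscale c (la \x nu)%E] _ C mC.
      by rewrite /= /mscale /= fineK.
    by move=> A B mA mB; rewrite /m1 /= /mscale /= product_measure1E// muleA.
  move=> A mA.
  have -> : sketch (k :: l) @^-1` A =
      (fun w => (sketch l w, X k w : measurableTypeR R)) @^-1` (upd k @^-1` A).
    have E w : sketch (k :: l) w = upd k (sketch l w, X k w).
      by apply: eq_from_tnth => t; rewrite !tnth_mktuple big_cons.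
    by apply/seteqP; split => w /=; rewrite E.
  rewrite joint//.
  by rewrite -[X in measurable X]setTI; exact: measurable_upd.
move=> th m m0 m1.
(* Integrating out the entry [k] moves its variance from [mass] into [m]. *)
pose m' t := m t + (if k.2 == t then f k.1 ^+ 2 else 0).
have mass0 t : 0 <= mass l t by apply: sumr_ge0 => *; exact: sqr_ge0.
have massE t : m t + mass (k :: l) t = m' t + mass l t.
  by rewrite /mass big_cons /m'; case: ifP => _; rewrite ?addr0// addrA.
(* For th >= 0 this comes from [m0]; for th < 0 it comes from [m1], since the remaining mass is
   nonnegative. *)
have m'0 t : 0 < 1 + th * m' t.
  have := m0 t; have := m1 t; rewrite massE /m'; case: ifP => _; last by rewrite addr0.
  have := sqr_ge0 (f k.1); have := mass0 t; move: (f k.1 ^+ 2) (mass l t) (m t).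
  by move=> a b c; have [th0|th0] := leP 0 th; nra.
have msq : measurable_fun setT (fun z => (gauss_prod th m (upd k z))%:E).
  apply/measurable_EFinP; exact: (measurableT_comp (measurable_gauss_prod _ _)).
rewrite /distribution ge0_integral_pushforward//; last 2 first.
- exact/measurable_EFinP.
- by move=> y _; rewrite lee_fin.
rewrite preimage_setT.
rewrite (fubini_tonelli1 (fun z => (gauss_prod th m (upd k z))%:E))//; last first.
  by move=> z; rewrite lee_fin.
rewrite [RHS](_ : _ = (\prod_(t < s) (Num.sqrt (1 + th * (m' t + mass l t)))^-1)%:E)%E; last first.
  by congr EFin; apply: eq_bigr => t _; rewrite massE.
rewrite -IH2//; last by move=> t; rewrite -massE.
apply: eq_integral => y _; rewrite /fubini_F /=.
pose a := (Num.sqrt (1 + th * m k.2))^-1.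
pose C := \prod_(t < s | t != k.2) ((Num.sqrt (1 + th * m t))^-1 *
                 expR (- (th / (1 + th * m t) * tnth y t ^+ 2 / 2))).
have C0 : 0 <= C by apply: prodr_ge0 => t _; rewrite mulr_ge0 ?expR_ge0 ?invr_ge0.
pose tt := th / (1 + th * m k.2).
have E x : gauss_prod th m (upd k (y, x)) =
    (a * C) * expR (- (tt * (tnth y k.2 + f k.1 * x) ^+ 2 / 2)).
  rewrite /gauss_prod (bigD1 k.2)//= tnth_mktuple eqxx /=.
  rewrite [X in _ * X = _](_ : _ = C); last first.
    by apply: eq_bigr => t tk; rewrite tnth_mktuple eq_sym (negbTE tk).
  by rewrite -/a -/tt [f k.1 * x + _]addrC; ring.
under eq_integral do rewrite E EFinM.
have q0 : 0 < 1 + tt * f k.1 ^+ 2.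
  have := m'0 k.2; rewrite /m' eqxx /tt => h.
  have -> : 1 + th / (1 + th * m k.2) * f k.1 ^+ 2 =
            (1 + th * (m k.2 + f k.1 ^+ 2)) / (1 + th * m k.2).
    by field; rewrite gt_eqF// m0.
  by rewrite divr_gt0.
rewrite ge0_integralZl//; last 2 first.
- apply/measurable_EFinP; apply: measurableT_comp => //; apply: measurableT_comp => //.
  apply: measurable_funM => //; apply: measurable_funM => //.
  by apply: measurable_funX; apply: measurable_funD => //; apply: measurable_funM.
- by rewrite lee_fin mulr_ge0// invr_ge0.
rewrite integral_normal_prob_expR_sqr// -EFinM; congr EFin.
rewrite /gauss_prod (bigD1 k.2)//= {1 2}/m' eqxx.
rewrite [X in _ = _ * X](_ : _ = C); last first.
  by apply: eq_bigr => t tk; rewrite /m' eq_sym (negbTE tk) addr0.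
have mk0 : 1 + th * m k.2 != 0 by rewrite gt_eqF.
have m2 : 1 + th * (m k.2 + f k.1 ^+ 2) != 0.
  by have := m'0 k.2; rewrite /m' eqxx => h; rewrite gt_eqF.
have -> : tt / (1 + tt * f k.1 ^+ 2) = th / (1 + th * (m k.2 + f k.1 ^+ 2)).
  by rewrite /tt; field; rewrite mk0 m2.
have sqE : Num.sqrt (1 + th * (m k.2 + f k.1 ^+ 2)) =
    Num.sqrt (1 + th * m k.2) * Num.sqrt (1 + tt * f k.1 ^+ 2).
  by rewrite -sqrtrM ?ltW//; congr Num.sqrt; rewrite /tt; field.
rewrite sqE invfM -/a.
set e1 := expR _; set e2 := (Num.sqrt (1 + tt * _))^-1.
by ring.
Qed.
End gaussian_sketch.

Lemma norm2_sqr_sum (R : realType) (d : nat) (v : 'cV[R]_d) :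
  norm2 v ^+ 2 = \sum_(i < d) v i 0 ^+ 2.
Proof. by rewrite sqr_sqrtr// sumr_ge0// => i _; exact: sqr_ge0. Qed.

Section gaussian_matrix.
Context (R : realType) (dT : measure_display) (T : measurableType dT).
Context (P : probability T R) (d s : nat) (Om : T -> 'M[R]_(d, s)).
Hypothesis Om_std : std_gaussian_matrix P Om.

Lemma measurable_norm2_sketch (f : 'cV[R]_d) :
  measurable_fun setT (fun w => norm2 ((Om w)^T *m f) ^+ 2).
Proof.
case: Om_std => mOm _ _.
rewrite (_ : (fun _ => _) = fun w => \sum_(j < s) (\sum_(i < d) Om w i j * f i 0) ^+ 2).
  apply: measurable_sum => j; apply: measurable_funX; apply: measurable_sum => i.
  by apply: measurable_funM => //; exact: mOm.
apply/funext => w; rewrite norm2_sqr_sum; apply: eq_bigr => j _; rewrite !mxE.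
by congr (_ ^+ 2); apply: eq_bigr => i _; rewrite !mxE.
Qed.

(** The coordinates of [Om^T f] are independent N(0, |f|^2), so this is the Laplace transform of a
    scaled chi-square variable with s degrees of freedom. *)
Lemma expectation_expR_sketch (f : 'cV[R]_d) (th : R) :
  0 < 1 + th * norm2 f ^+ 2 ->
  (\int[P]_w (expR (- (th * norm2 ((Om w)^T *m f) ^+ 2 / 2)))%:E =
   ((Num.sqrt (1 + th * norm2 f ^+ 2))^-1 ^+ s)%:E)%E.
Proof.
move=> th0; case: (Om_std) => mOm lawOm indOm.
pose X (k : 'I_d * 'I_s) w := Om w k.1 k.2.
have mX k : measurable_fun setT (X k) by exact: mOm.
pose l := index_enum ('I_d * 'I_s)%type.
have [la [law int]] := sketch_law mX (fun i => f i 0) (index_enum_uniq _ : uniq l).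
have massE t : \sum_(k <- l | k.2 == t) f k.1 0 ^+ 2 = norm2 f ^+ 2.
  rewrite norm2_sqr_sum.
  rewrite (eq_bigl (fun k : 'I_d * 'I_s => true && (k.2 == t)))//.
  rewrite -(pair_big_dep xpredT (fun i j => j == t) (fun i _ => f i 0 ^+ 2))/=.
  by apply: eq_bigr => i _; rewrite big_pred1_eq.
have := int th (fun=> 0) (fun=> _).
rewrite (_ : \prod_(t < s) _ = (Num.sqrt (1 + th * norm2 f ^+ 2))^-1 ^+ s); last first.
  rewrite (eq_bigr (fun=> (Num.sqrt (1 + th * norm2 f ^+ 2))^-1)).
    by rewrite prodr_const card_ord.
  by move=> t _; rewrite massE add0r.
move=> <-; last 2 first.
- by move=> t; rewrite mulr0 addr0 ltr01.
- by move=> t; rewrite massE add0r.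
have msk : measurable_fun setT
    (fun w => [tuple \sum_(k <- l | k.2 == t) f k.1 0 * X k w | t < s]).
  apply/measurable_fun_tnthP => t.
  rewrite (_ : _ \o _ = fun w => \sum_(k <- l) (if k.2 == t then f k.1 0 * X k w else 0)).
    apply: measurable_sum => k; case: (k.2 == t) => //.
    by apply: measurable_funM.
  by apply/funext => w /=; rewrite tnth_mktuple big_mkcond.
pose skm : {mfun T >-> (s.-tuple R)} := mfun_Sub (mem_set msk).
rewrite (eq_measure_integral [the measure _ _ of distribution P skm]); last first.
  move=> A mA _.
  transitivity ((P : set T -> \bar R) setT * la A)%E; first by rewrite probability_setT mul1e.
  apply/esym; rewrite [LHS](law P)//.
  move=> B mB; rewrite /= probability_setT mul1e.
  transitivity (P (\big[setI/setT]_(k : 'I_d * 'I_s)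
      ((fun w => Om w k.1 k.2) @^-1` B (k.1, k.2)))).
    by congr (P _); apply: eq_bigr => -[i j].
  apply: eq_trans (indOm (fun i j => B (i, j)) (fun i j => mB (i, j))) _.
  by apply: eq_bigr => -[i j] _ /=; exact: lawOm.
rewrite /distribution ge0_integral_pushforward//; last 2 first.
- apply/measurable_EFinP; apply: measurable_prod => t _.
  apply: measurable_funM => //; apply: measurableT_comp => //.
  apply: measurableT_comp => //; apply: measurable_funM => //.
  apply: measurable_funM => //; apply: measurable_funX.
  exact: measurable_tnth.
- by move=> y _; rewrite lee_fin; apply: prodr_ge0 => t _; rewrite mulr_ge0 ?expR_ge0 ?invr_ge0.
rewrite preimage_setT; apply: eq_integral => w _ /=; congr EFin.
rewrite norm2_sqr_sum mulr_sumr mulr_suml -sumrN expR_sum.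
apply: eq_bigr => t _; rewrite mulr0 addr0 sqrtr1 invr1 mul1r mulr1 tnth_mktuple.
suff -> : ((Om w)^T *m f) t 0 = \sum_(k <- l | k.2 == t) f k.1 0 * X k w by [].
rewrite mxE (eq_bigl (fun k : 'I_d * 'I_s => true && (k.2 == t)))//.
rewrite -(pair_big_dep xpredT (fun i j => j == t) (fun i j => f i 0 * X (i, j) w))/=.
by apply: eq_bigr => i _; rewrite big_pred1_eq mxE mulrC.
Qed.

End gaussian_matrix.

(** * The high-probability event *)

Lemma markov_event (R : realType) (dT : measure_display) (T : measurableType dT)
    (P : probability T R) (f : T -> R) (c delta : R) :
  0 < delta -> 0 < c -> measurable_fun setT f -> (forall w, 0 <= f w) ->
  (\int[P]_w (f w)%:E <= c%:E)%E ->
  measurable [set w | f w <= c / delta] /\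
  ((1 - delta)%:E <= P [set w | (f w <= c / delta)%R])%E.
Proof.
move=> de0 c0 mf f0 intf.
pose E := [set w | f w <= c / delta].
have mE : measurable E.
  rewrite (_ : E = f @^-1` [set` `]-oo, c / delta]]).
    by rewrite -[X in measurable X]setTI; apply: mf => //; exact: measurable_itv.
  by apply/seteqP; split => w; rewrite /E /= in_itv.
split => //.
have PC : (P (~` E) <= delta%:E)%E.
  have cd0 : 0 < c / delta by rewrite divr_gt0.
  have : ((c / delta)%:E * P (~` E) <= c%:E)%E.
    apply: le_trans intf.
    rewrite -integral_cst//; last exact: measurableC.
    apply: le_trans (_ : (\int[P]_(w in ~` E) (f w)%:E <= _)%E).
      apply: ge0_le_integral => //.
      - exact: measurableC.
      - by move=> w _; rewrite lee_fin ltW.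
      - by apply/measurable_EFinP; apply: measurable_funTS.
      - by move=> w /= /negP; rewrite -ltNge lee_fin => /ltW.
    apply: ge0_subset_integral => //; first exact: measurableC.
      exact/measurable_EFinP.
    by move=> w _; rewrite lee_fin.
  have finC : P (~` E) \is a fin_num by apply: fin_num_measure; exact: measurableC.
  move: finC; case: (P (~` E)) => // p _.
  rewrite -EFinM !lee_fin mulrC -ler_pdivlMr//.
  by rewrite invf_div mulrCA divff ?mulr1// gt_eqF.
have := probability_setC P mE; move: PC => /[swap] ->.
have finE : P E \is a fin_num by exact: fin_num_measure.
rewrite -/E -(fineK finE).
by rewrite -EFinB !lee_fin lerBlDr lerBlDl [delta + _]addrC.
Qed.

(** Each exponential is divided by its expectation, so the mean of [Z] is the total weight whatever
    the directions and parameters; Markov applies once to the whole family. *)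
Lemma gaussian_exponential_event (R : realType) (dT : measure_display)
    (T : measurableType dT) (P : probability T R) (d s : nat)
    (Om : T -> 'M[R]_(d, s)) (I : finType) (c th : I -> R) (f : I -> 'cV[R]_d)
    (delta : R) :
  std_gaussian_matrix P Om -> 0 < delta -> (forall i, 0 <= c i) ->
  0 < \sum_i c i -> (forall i, 0 < 1 + th i * norm2 (f i) ^+ 2) ->
  let Z w := \sum_i c i * (Num.sqrt (1 + th i * norm2 (f i) ^+ 2) ^+ s *
               expR (- (th i * norm2 ((Om w)^T *m f i) ^+ 2 / 2))) in
  measurable [set w | Z w <= (\sum_i c i) / delta] /\
  ((1 - delta)%:E <= P [set w | (Z w <= (\sum_i c i) / delta)%R])%E.
Proof.
move=> Om_std de0 c0 cs0 th0 Z.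
have mexp i : measurable_fun setT
    (fun w => expR (- (th i * norm2 ((Om w)^T *m f i) ^+ 2 / 2))).
  apply: measurableT_comp => //; apply: measurableT_comp => //.
  apply: measurable_funM => //; apply: measurable_funM => //.
  exact: (measurable_norm2_sketch Om_std).
have sq0 i : 0 <= Num.sqrt (1 + th i * norm2 (f i) ^+ 2) ^+ s by rewrite exprn_ge0.
have mt i : measurable_fun setT (fun w => c i * (Num.sqrt (1 + th i * norm2 (f i) ^+ 2) ^+ s *
               expR (- (th i * norm2 ((Om w)^T *m f i) ^+ 2 / 2)))).
  by apply: measurable_funM => //; apply: measurable_funM => //; exact: mexp.
have t0 i w : 0 <= c i * (Num.sqrt (1 + th i * norm2 (f i) ^+ 2) ^+ s *
               expR (- (th i * norm2 ((Om w)^T *m f i) ^+ 2 / 2))).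
  by rewrite mulr_ge0// mulr_ge0// expR_ge0.
apply: markov_event => //.
- exact: measurable_sum.
- by move=> w; rewrite sumr_ge0.
- rewrite (_ : (fun w => _) = (fun w =>
    \sum_(i <- index_enum I) (c i * (Num.sqrt (1 + th i * norm2 (f i) ^+ 2) ^+ s *
               expR (- (th i * norm2 ((Om w)^T *m f i) ^+ 2 / 2))))%:E)%E); last first.
    by apply/funext => w; rewrite sumEFin.
  rewrite ge0_integral_sum//; last 2 first.
  - by move=> i; apply/measurable_EFinP; exact: mt.
  - by move=> i w _; rewrite lee_fin.
  rewrite -sumEFin; apply: lee_sum => i _.
  under eq_integral do rewrite EFinM EFinM.
  rewrite ge0_integralZl//; last 2 first.
  - apply/measurable_EFinP; rewrite -[X in measurable_fun _ X]/(fun w => _ * _).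
    by apply: measurable_funM => //; exact: mexp.
  - by rewrite lee_fin.
  rewrite ge0_integralZl//; last by apply/measurable_EFinP; exact: mexp.
  rewrite (expectation_expR_sketch Om_std)// -!EFinM lee_fin -exprMn mulfV.
    by rewrite expr1n mulr1.
  by rewrite gt_eqF// sqrtr_gt0.
Qed.

(** * Explicit bounds on logarithms and exponentials *)

Lemma ln_ge1BV (R : realType) (x : R) : 0 < x -> 1 - x^-1 <= ln x.
Proof.
move=> x0; rewrite -[x in ln x]invrK lnV ?posrE ?invr_gt0//.
rewrite -opprB lerN2.
have := @le_ln1Dx R (x^-1 - 1); rewrite subrKC; apply.
by rewrite ltrBrDl addrN invr_gt0.
Qed.

(** A parabola below the logarithm, tangent at x = y: it bounds the mean of a logarithm using only a
    mean and a variance. It comes from ln r >= 1 - 1 / r at r = (1 + x) / (1 + y). *)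
Lemma ln1D_ge_parabola (R : realType) (x y : R) : 0 <= x -> 0 <= y ->
  ln (1 + y) + (x - y) / (1 + y) - (x - y) ^+ 2 / (1 + y) <= ln (1 + x).
Proof.
move=> x0 y0.
have x1 : 0 < 1 + x by rewrite ltr_wpDr.
have y1 : 0 < 1 + y by rewrite ltr_wpDr.
have : 1 - (1 + y) / (1 + x) <= ln (1 + x) - ln (1 + y).
  rewrite -ln_div ?posrE//; apply: le_trans (ln_ge1BV _); last by rewrite divr_gt0.
  by rewrite invf_div.
apply: contra_le => h; rewrite ltrBlDl (lt_le_trans h)//.
rewrite -!addrA lerD2l.
have -> : 1 - (1 + y) / (1 + x) = (x - y) / (1 + y) - (x - y) ^+ 2 / ((1 + y) * (1 + x)).
  by field; rewrite !gt_eqF.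
rewrite lerD2l lerN2 ler_wpM2l ?sqr_ge0// lef_pV2 ?posrE ?mulr_gt0//.
by rewrite ler_pMr// lerDl.
Qed.

(** The difference of the two sides vanishes at 0 and has derivative t^3 / (1 + t), which has the
    sign of t. *)
Lemma ln1D_le_cubic (R : realType) (x : R) : -1 < x ->
  ln (1 + x) <= x - x ^+ 2 / 2 + x ^+ 3 / 3.
Proof.
move=> x1.
pose g (t : R) : R := t - t ^+ 2 / 2 + t ^+ 3 / 3 - ln (1 + t).
have dg (t : R) : -1 < t -> is_derive t 1 g (t ^+ 3 / (1 + t)).
  move=> t1; have t0 : 0 < 1 + t by rewrite -ltrBlDl sub0r.
  have dl : is_derive t 1 (fun t : R => ln (1 + t)) (1 + t)^-1.
    rewrite -[X in is_derive _ _ _ X]mulr1.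
    have d1 : is_derive t 1 (fun t : R => 1 + t) 1.
      by apply: is_derive_eq; rewrite add0r mulr1.
    have d2 : is_derive (1 + t) 1 (@ln R) (1 + t)^-1 by exact: is_derive1_ln.
    exact: (@is_derive1_comp _ _ (fun t => 1 + t) _ _ _ d2 d1).
  rewrite /g; apply: is_derive_eq.
  rewrite /GRing.scale /=; field; rewrite gt_eqF//.
have g0 : g 0 = 0 by rewrite /g addr0 ln1 !expr0n /= !mul0r !(subr0, addr0).
suff : 0 <= g x by rewrite /g subr_ge0.
have cg a b : -1 < a -> {within `[a, b], continuous g}.
  move=> a1; apply: derivable_within_continuous => t; rewrite in_itv /= => /andP[at_ _].
  by have [] := dg t (lt_le_trans a1 at_).
have [x0|x0] := leP 0 x.
  have [||c] := @MVT_segment R g (fun t => t ^+ 3 / (1 + t)) 0 x x0.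
  - by move=> t; rewrite in_itv /= => /andP[t0 _]; apply: dg; rewrite (lt_trans _ t0).
  - exact: cg.
  rewrite in_itv /= => /andP[c0 _]; rewrite g0 !subr0 => ->.
  by rewrite mulr_ge0// divr_ge0// ?exprn_ge0// addr_ge0.
have [||c] := @MVT_segment R g (fun t => t ^+ 3 / (1 + t)) x 0 (ltW x0).
- by move=> t; rewrite in_itv /= => /andP[t0 _]; apply: dg; rewrite (lt_trans _ t0).
- exact: cg.
rewrite in_itv /= => /andP[xc c0]; rewrite g0 !sub0r => /eqP; rewrite eqr_oppLR => /eqP ->.
have c1 : 0 < 1 + c by rewrite -ltrBlDl sub0r (lt_le_trans x1).
rewrite -mulrN opprK mulr_le0//; last exact: ltW.
rewrite pmulr_lle0 ?invr_gt0//.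
by rewrite exprS mulr_le0_ge0// sqr_ge0.
Qed.

Lemma expRN_ge_exprn (R : realType) (x : R) (n : nat) : 0 <= x <= n%:R -> (0 < n)%N ->
  (1 - x / n%:R) ^+ n <= expR (- x).
Proof.
move=> /andP[x0 xn] n0; have n0' : (0:R) < n%:R by rewrite ltr0n.
rewrite -[x in expR (- x)](divfK (lt0r_neq0 n0')) -[- (_ * n%:R)]mulNr expRM_natr.
apply: lerXn2r; rewrite ?nnegrE ?expR_ge0//; last exact: expR_ge1Dx.
by rewrite subr_ge0 ler_pdivrMr// mul1r.
Qed.

Lemma expRN1_ge (R : realType) : (8 / 23 : R) <= expR (- 1).
Proof.
apply: le_trans (@expRN_ge_exprn R 1 16 _ _) => //; last by rewrite ler01 ler1n.
by rewrite !exprS expr0; lra.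
Qed.

Lemma ln_ge_expRN (R : realType) (x y : R) : 0 < y -> y^-1 <= expR (- x) -> x <= ln y.
Proof.
move=> y0; rewrite -[y^-1]lnK ?posrE ?invr_gt0// ler_expR lnV ?posrE//.
by rewrite lerN2.
Qed.

(** The number 23/8 is 1 + 15/8, where 15/8 is the tangency point used in [sketch_numeric]. *)
Lemma ln_23_8_ge1 (R : realType) : 1 <= ln (23 / 8 : R).
Proof. by apply: ln_ge_expRN; rewrite ?divr_gt0 ?invf_div// expRN1_ge. Qed.

(** This yields 8 ln (16 / delta) >= 20 for every admissible delta. *)
Lemma ln16_ge (R : realType) : 5 / 2 <= ln (16 : R).
Proof.
apply: ln_ge_expRN => //.
apply: le_trans (@expRN_ge_exprn R (5 / 2) 32 _ _) => //; last by lra.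
by rewrite !exprS expr0; lra.
Qed.

Lemma expRN_half_ge (R : realType) : (3 / 5 : R) <= expR (- 2^-1).
Proof.
apply: le_trans (@expRN_ge_exprn R 2^-1 16 _ _) => //; last by lra.
by rewrite !exprS expr0; lra.
Qed.

(** * Moments of independent biased signs *)

Section biased_signs.
Context (R : realType) (J : finType) (v : J -> R).

Definition sgb (b : bool) : R := if b then 1 else -1.

(** The probability of the pattern [e] for independent signs of means [v x]. Being a plain
    polynomial in [v], it gives the moment identities for every [v]; bounds on [v] enter only with
    inequalities. *)
Definition bias (e : {ffun J -> bool}) : R :=
  \prod_x ((1 + sgb (e x) * v x) / 2).

Definition Ebias (g : {ffun J -> bool} -> R) : R := \sum_e bias e * g e.

Lemma EbiasD g h : Ebias (fun e => g e + h e) = Ebias g + Ebias h.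
Proof. by rewrite -big_split; apply: eq_bigr => e _; rewrite mulrDr. Qed.

Lemma EbiasZ c g : Ebias (fun e => c * g e) = c * Ebias g.
Proof. by rewrite mulr_sumr; apply: eq_bigr => e _; rewrite mulrCA. Qed.

Lemma Ebias_sum (I : Type) (r : seq I) (Q : pred I) (g : I -> {ffun J -> bool} -> R) :
  Ebias (fun e => \sum_(i <- r | Q i) g i e) = \sum_(i <- r | Q i) Ebias (g i).
Proof.
by rewrite exchange_big; apply: eq_bigr => e _; rewrite mulr_sumr.
Qed.

Lemma Ebias_prod (g : J -> bool -> R) :
  Ebias (fun e => \prod_x g x (e x)) =
  \prod_x \sum_b (1 + sgb b * v x) / 2 * g x b.
Proof.
rewrite bigA_distr_bigA; apply: eq_bigr => e _.
by rewrite big_split.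
Qed.

Definition dev (x : J) (e : {ffun J -> bool}) : R := sgb (e x) - v x.

(** A sign has only two values, so its squared deviation is affine in the deviation; squares can
    thus be folded into constant and linear terms. *)
Lemma dev_sqr x e : dev x e ^+ 2 = 1 - v x ^+ 2 - 2 * v x * dev x e.
Proof. by rewrite /dev /sgb; case: (e x); ring. Qed.

Let moment (x : J) (n : nat) : R :=
  \sum_b (1 + sgb b * v x) / 2 * (sgb b - v x) ^+ n.

Let moment0 x : moment x 0 = 1.
Proof. by rewrite /moment big_bool /sgb /= !expr0; field. Qed.

Let moment1 x : moment x 1 = 0.
Proof. by rewrite /moment big_bool /sgb /=; field. Qed.

Let moment2 x : moment x 2 = 1 - v x ^+ 2.
Proof. by rewrite /moment big_bool /sgb /=; field. Qed.

Let prod_count (l : seq J) (F : J -> R) :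
  \prod_(x <- l) F x = \prod_x F x ^+ count_mem x l.
Proof.
elim: l => [|y l IH].
  by rewrite big_nil big1.
rewrite big_cons IH.
rewrite [RHS](eq_bigr (fun x => F x ^+ (y == x) * F x ^+ count_mem x l)).
  rewrite big_split; congr (_ * _); rewrite (bigD1 y)//= eqxx big1 ?mulr1//.
  by move=> x /negbTE; rewrite eq_sym => ->.
by move=> x _; rewrite /= exprD.
Qed.

Let Ebias_monomial (l : seq J) :
  Ebias (fun e => \prod_(x <- l) dev x e) = \prod_x moment x (count_mem x l).
Proof.
rewrite -Ebias_prod; apply: eq_bigr => e _; congr (_ * _).
by rewrite prod_count.
Qed.

Let Ebias_monomial0 (l : seq J) x : count_mem x l = 1%N ->
  Ebias (fun e => \prod_(x <- l) dev x e) = 0.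
Proof. by move=> c1; rewrite Ebias_monomial (bigD1 x)//= c1 moment1 mul0r. Qed.

Lemma Ebias1 : Ebias (fun=> 1) = 1.
Proof.
transitivity (Ebias (fun e => \prod_(x <- [::]) dev x e)).
  by apply: eq_bigr => e _; rewrite big_nil.
by rewrite Ebias_monomial big1// => x _; exact: moment0.
Qed.

Lemma Ebias_cst c : Ebias (fun=> c) = c.
Proof.
by rewrite -[RHS]mulr1 -Ebias1 -EbiasZ; apply: eq_bigr => e _; rewrite mulr1.
Qed.

Lemma Ebias_dev x : Ebias (dev x) = 0.
Proof.
have := @Ebias_monomial0 [:: x] x; rewrite /= eqxx => <- //.
by apply: eq_bigr => e _; rewrite big_seq1.
Qed.

Lemma Ebias_sgb x : Ebias (fun e => sgb (e x)) = v x.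
Proof.
rewrite -[RHS]add0r -(Ebias_dev x) -[X in _ = _ + X]Ebias_cst -EbiasD.
by apply: eq_bigr => e _; rewrite /dev subrK.
Qed.

Lemma Ebias_dev2 x y : Ebias (fun e => dev x e * dev y e) =
  if x == y then 1 - v x ^+ 2 else 0.
Proof.
case: eqVneq => [<-|xy].
  have -> : Ebias (fun e => dev x e * dev x e) =
      Ebias (fun e => (1 - v x ^+ 2) + (- (2 * v x)) * dev x e).
    by apply: eq_bigr => e _; rewrite -expr2 dev_sqr mulNr.
  by rewrite EbiasD Ebias_cst EbiasZ Ebias_dev mulr0 addr0.
have := @Ebias_monomial0 [:: x; y] x; rewrite /= eqxx (negbTE (_ : y != x)) 1?eq_sym//.
move=> <- //; apply: eq_bigr => e _.
by rewrite !big_cons big_nil mulr1.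
Qed.

(** Some index among x, y, z occurs exactly once, and its centred independent factor kills the
    expectation. *)
Lemma Ebias_dev3 x y z : y != z ->
  Ebias (fun e => dev x e * (dev y e * dev z e)) = 0.
Proof.
move=> yz; have [xy|xy] := eqVneq x y.
  rewrite -(@Ebias_monomial0 [:: x; y; z] z).
    by apply: eq_bigr => e _; rewrite !big_cons big_nil mulr1.
  by rewrite /= xy (negbTE yz) eqxx.
rewrite -(@Ebias_monomial0 [:: x; y; z] y).
  by apply: eq_bigr => e _; rewrite !big_cons big_nil mulr1.
by rewrite /= (negbTE xy) eqxx eq_sym (negbTE yz).
Qed.

Hypothesis v1 : forall x, `|v x| <= 1.

Let moment_le1 x n : n \in [:: 0; 2]%N -> 0 <= moment x n <= 1.
Proof.
have v2 : v x ^+ 2 <= 1 by rewrite -real_normK ?num_real ?expr_le1.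
rewrite !inE => /orP[|] /eqP ->; rewrite ?moment0 ?moment2 ?ler01 ?lexx//.
by rewrite subr_ge0 v2 lerBlDr lerDl sqr_ge0.
Qed.

(** Unless the two pairs coincide as sets, some index occurs once and the moment vanishes; otherwise
    it is a product of two variances, each at most 1. *)
Lemma Ebias_dev4 x y z t : x != y -> z != t ->
  `|Ebias (fun e => (dev x e * dev y e) * (dev z e * dev t e))| <=
  ((x == z) && (y == t))%:R + ((x == t) && (y == z))%:R.
Proof.
move=> xy zt.
have -> : Ebias (fun e => (dev x e * dev y e) * (dev z e * dev t e)) =
    Ebias (fun e => \prod_(u <- [:: x; y; z; t]) dev u e).
  by apply: eq_bigr => e _; rewrite !big_cons big_nil mulr1 !mulrA.
have le1 : (forall u, count_mem u [:: x; y; z; t] \in [:: 0; 2]%N) ->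
    `|Ebias (fun e => \prod_(u <- [:: x; y; z; t]) dev u e)| <= 1.
  move=> c02; rewrite Ebias_monomial normr_prod.
  apply: prodr_ile1 => u _; rewrite normr_ge0 /=.
  by have /andP[m0 m1] := moment_le1 u (c02 u); rewrite ger0_norm.
have [xz|xz] := eqVneq x z; last have [xt|xt] := eqVneq x t.
- have [yt|yt] := eqVneq y t.
    rewrite (le_trans (le1 _)) ?lerDl// => u.
    rewrite -xz -yt /= !inE; case: (eqVneq x u) => [xu|] ; case: (eqVneq y u) => //= yu.
    by move: xy; rewrite xu yu eqxx.
  rewrite (@Ebias_monomial0 _ y) ?normr0 ?addr_ge0//.
  by rewrite /= (negbTE xy) eqxx -xz (negbTE xy) eq_sym (negbTE yt).
- have [yz|yz] := eqVneq y z.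
    rewrite (le_trans (le1 _)) ?lerDr// => u.
    rewrite -xt -yz /= !inE; case: (eqVneq x u) => [xu|] ; case: (eqVneq y u) => //= yu.
    by move: xy; rewrite xu yu eqxx.
  rewrite (@Ebias_monomial0 _ y) ?normr0 ?addr_ge0//.
  by rewrite /= (negbTE xy) eqxx -xt (negbTE xy) eq_sym (negbTE yz).
- rewrite (@Ebias_monomial0 _ x) ?normr0 ?addr_ge0//.
  by rewrite /= eqxx ![_ == x]eq_sym (negbTE xy) (negbTE xz) (negbTE xt).
Qed.
End biased_signs.

(** * Mean and variance of the squared length of a sign sum *)

Section sign_sums.
Context (R : realType) (J : finType) (v : J -> R) (n : nat) (f : J -> 'cV[R]_n).

Definition sign_sum (e : {ffun J -> bool}) : 'cV[R]_n := \sum_x sgb R (e x) *: f x.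

Let Fv : 'cV[R]_n := \sum_x v x *: f x.

Let a x := dotv (f x) Fv - v x * dotv (f x) (f x).

Let Xbar := dotv Fv Fv + \sum_x (1 - v x ^+ 2) * dotv (f x) (f x).

Let quad e := \sum_x \sum_(y | y != x) (dev v x e * dev v y e) * dotv (f x) (f y).

(** Decomposition into mean, linear part and off-diagonal quadratic part. The subtracted term in [a]
    comes from applying [dev_sqr] to the diagonal. *)
Let sign_sum_sqr e : dotv (sign_sum e) (sign_sum e) =
  Xbar + (2 * (\sum_x a x * dev v x e) + quad e).
Proof.
have -> : sign_sum e = Fv + \sum_x dev v x e *: f x.
  by rewrite /Fv -big_split; apply: eq_bigr => x _ /=; rewrite -scalerDl /dev subrKC.
rewrite dotvDl !dotvDr (dotvC _ Fv) /Xbar -!addrA; congr (_ + _).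
rewrite addrA -mulr2n dotv_sumr dotv_suml /quad.
have -> : \sum_i dotv (dev v i e *: f i) (\sum_x dev v x e *: f x) =
  \sum_x dev v x e ^+ 2 * dotv (f x) (f x) +
  \sum_x \sum_(y | y != x) dev v x e * dev v y e * dotv (f x) (f y).
  rewrite -big_split; apply: eq_bigr => x _.
  rewrite dotv_sumr (bigD1 x)//= dotvZl dotvZr mulrA -expr2; congr (_ + _).
  by apply: eq_bigr => y _; rewrite dotvZl dotvZr mulrA.
rewrite [RHS]addrA [LHS]addrA; congr (_ + _).
rewrite -sumrMnl mulr_sumr -!big_split; apply: eq_bigr => x _ /=.
rewrite dotvZr (dotvC Fv) dev_sqr /a; ring.
Qed.

Let Ebias_quad : Ebias v quad = 0.
Proof.
rewrite /quad Ebias_sum big1// => x _; rewrite Ebias_sum big1// => y yx.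
transitivity (Ebias v (fun e => dotv (f x) (f y) * (dev v x e * dev v y e))).
  by apply: eq_bigr => e _; rewrite [dotv _ _ * _]mulrC.
by rewrite EbiasZ Ebias_dev2 eq_sym (negbTE yx) mulr0.
Qed.

Let Ebias_lin : Ebias v (fun e => \sum_x a x * dev v x e) = 0.
Proof. by rewrite Ebias_sum big1// => x _; rewrite EbiasZ Ebias_dev mulr0. Qed.

Lemma Ebias_sign_sum_sqr :
  Ebias v (fun e => dotv (sign_sum e) (sign_sum e)) = Xbar.
Proof.
rewrite /Ebias; under eq_bigr do rewrite sign_sum_sqr.
by rewrite -/(Ebias v _) EbiasD Ebias_cst EbiasD EbiasZ Ebias_lin Ebias_quad mulr0 !addr0.
Qed.

Hypothesis v1 : forall x, `|v x| <= 1.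

Let v2 x : v x ^+ 2 <= 1.
Proof. by rewrite -real_normK ?num_real ?expr_le1. Qed.

Let Ebias_lin_sqr :
  Ebias v (fun e => (\sum_x a x * dev v x e) ^+ 2) <= \sum_x a x ^+ 2.
Proof.
have -> : Ebias v (fun e => (\sum_x a x * dev v x e) ^+ 2) =
    \sum_x \sum_y (a x * a y) * Ebias v (fun e => dev v x e * dev v y e).
  transitivity (Ebias v (fun e => \sum_x \sum_y (a x * a y) * (dev v x e * dev v y e))).
    apply: eq_bigr => e _; congr (_ * _); rewrite expr2 mulr_suml.
    apply: eq_bigr => x _; rewrite mulr_sumr; apply: eq_bigr => y _.
    by rewrite mulrACA.
  rewrite Ebias_sum; apply: eq_bigr => x _; rewrite Ebias_sum.
  by apply: eq_bigr => y _; rewrite EbiasZ.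
apply: ler_sum => x _; rewrite (bigD1 x)//= Ebias_dev2 eqxx big1 ?addr0.
  by rewrite -expr2 ler_piMr ?sqr_ge0// lerBlDr lerDl sqr_ge0.
by move=> y yx; rewrite Ebias_dev2 eq_sym (negbTE yx) mulr0.
Qed.

Let Ebias_cross : Ebias v (fun e => (\sum_x a x * dev v x e) * quad e) = 0.
Proof.
transitivity (Ebias v (fun e => \sum_z \sum_x \sum_(y | y != x)
    (a z * dotv (f x) (f y)) * (dev v z e * (dev v x e * dev v y e)))).
  apply: eq_bigr => e _; congr (_ * _); rewrite mulr_suml; apply: eq_bigr => z _.
  rewrite mulr_sumr; apply: eq_bigr => x _; rewrite mulr_sumr; apply: eq_bigr => y _.
  by ring.
rewrite Ebias_sum big1// => z _; rewrite Ebias_sum big1// => x _.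
rewrite Ebias_sum big1// => y yx.
by rewrite EbiasZ Ebias_dev3 ?mulr0// eq_sym.
Qed.

Let B x y := dotv (f x) (f y).

Let Ebias_quad_sqr : Ebias v (fun e => quad e ^+ 2) <=
  2 * \sum_x \sum_y B x y ^+ 2.
Proof.
have -> : Ebias v (fun e => quad e ^+ 2) =
  \sum_x \sum_(y | y != x) \sum_z \sum_(t | t != z) (B x y * B z t) *
    Ebias v (fun e => (dev v x e * dev v y e) * (dev v z e * dev v t e)).
  transitivity (Ebias v (fun e => \sum_x \sum_(y | y != x) \sum_z \sum_(t | t != z)
     (B x y * B z t) * ((dev v x e * dev v y e) * (dev v z e * dev v t e)))).
    apply: eq_bigr => e _; congr (_ * _); rewrite expr2 /quad mulr_suml.
    apply: eq_bigr => x _; rewrite mulr_suml; apply: eq_bigr => y _.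
    rewrite mulr_sumr; apply: eq_bigr => z _; rewrite mulr_sumr.
    by apply: eq_bigr => t _; rewrite /B; ring.
  rewrite Ebias_sum; apply: eq_bigr => x _; rewrite Ebias_sum; apply: eq_bigr => y _.
  rewrite Ebias_sum; apply: eq_bigr => z _; rewrite Ebias_sum; apply: eq_bigr => t _.
  by rewrite EbiasZ.
rewrite mulr_sumr; apply: ler_sum => x _.
rewrite mulr_sumr big_mkcond; apply: ler_sum => y _.
case: ifP => yx; last by rewrite mulr_ge0// sqr_ge0.
have step z t : t != z -> (B x y * B z t) *
    Ebias v (fun e => (dev v x e * dev v y e) * (dev v z e * dev v t e)) <=
    `|B x y * B z t| * (((x == z) && (y == t))%:R + ((x == t) && (y == z))%:R).
  move=> tz; apply: le_trans (ler_norm _) _; rewrite normrM ler_wpM2l//.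
  by apply: Ebias_dev4 => //; rewrite eq_sym ?yx.
have BC z t : B z t = B t z by exact: dotvC.
have -> : 2 * B x y ^+ 2 = \sum_z \sum_t `|B x y * B z t| *
    (((x == z) && (y == t))%:R + ((x == t) && (y == z))%:R).
  have e1 z t : `|B x y * B z t| * (((x == z) && (y == t))%:R + ((x == t) && (y == z))%:R)
    = B x y ^+ 2 * ((x == z)%:R * (y == t)%:R) + B x y ^+ 2 * ((y == z)%:R * (x == t)%:R).
    have n2 : `|B x y * B x y| = B x y ^+ 2 by rewrite -expr2 ger0_norm ?sqr_ge0.
    rewrite mulrDr -!natrM !mulnb; congr (_ + _).
      by case: (eqVneq x z) => [<-|]; case: (eqVneq y t) => [<-|]; rewrite /= ?mulr0 ?mulr1.
    rewrite andbC; case: (eqVneq y z) => [<-|]; case: (eqVneq x t) => [<-|];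
      rewrite /= ?mulr0 ?mulr1//.
    by rewrite (BC y x).
  have sum1 (w : J) : \sum_t (w == t)%:R = 1 :> R.
    by rewrite (bigD1 w)//= eqxx big1 ?addr0// => t; rewrite eq_sym => /negbTE ->.
  under eq_bigr do under eq_bigr do rewrite e1.
  have e2 (w u : J) : \sum_z \sum_t B x y ^+ 2 * ((w == z)%:R * (u == t)%:R) = B x y ^+ 2.
    under eq_bigr do rewrite -mulr_sumr -mulr_sumr sum1 mulr1.
    by rewrite -mulr_sumr sum1 mulr1.
  under eq_bigr do rewrite big_split /=.
  by rewrite big_split /= !e2 mulr_natl mulr2n.
apply: ler_sum => z _; rewrite big_mkcond; apply: ler_sum => t _.
case: ifP => tz; first exact: step.
by rewrite mulr_ge0// addr_ge0.
Qed.

(** The linear and quadratic parts are uncorrelated by the vanishing third moments, so their second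
    moments simply add. *)
Lemma Ebias_sign_sum_var :
  Ebias v (fun e => (dotv (sign_sum e) (sign_sum e) - Xbar) ^+ 2) <=
  4 * \sum_x a x ^+ 2 + 2 * \sum_x \sum_y B x y ^+ 2.
Proof.
have -> : Ebias v (fun e => (dotv (sign_sum e) (sign_sum e) - Xbar) ^+ 2) =
  Ebias v (fun e => 4 * (\sum_x a x * dev v x e) ^+ 2 +
    (4 * ((\sum_x a x * dev v x e) * quad e) + quad e ^+ 2)).
  apply: eq_bigr => e _; congr (_ * _); rewrite sign_sum_sqr.
  by move: (\sum_x _) => l; ring.
rewrite EbiasD EbiasZ EbiasD EbiasZ Ebias_cross mulr0 add0r.
by apply: lerD => //; rewrite ler_wpM2l.
Qed.
End sign_sums.

(** * The PAC-Bayes inequality and the numerical estimate drawn from it *)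

Lemma expR_jensen (R : realType) (I : finType) (p z : I -> R) :
  (forall i, 0 <= p i) -> \sum_i p i = 1 ->
  expR (\sum_i p i * z i) <= \sum_i p i * expR (z i).
Proof.
move=> p0 p1; set m := \sum_i p i * z i.
have -> : expR m = \sum_i p i * (expR m * (1 + (z i - m))).
  rewrite (eq_bigr (fun i => expR m * (p i + p i * z i - m * p i))); last first.
    by move=> i _; ring.
  by rewrite -mulr_sumr big_split big_split /= sumrN -mulr_sumr p1 -/m; ring.
apply: ler_sum => i _; rewrite ler_wpM2l//.
by rewrite -[z i in leRHS](subrKC m) expRD ler_wpM2l ?expR_ge0// expR_ge1Dx.
Qed.

Section pac_bayes.
Context (R : realType) (J : finType) (v : J -> R).
Hypothesis v1 : forall x, `|v x| < 1.

Let sgv x b : 0 < 1 + sgb R b * v x.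
Proof.
have := v1 x; rewrite ltr_norml /sgb => /andP[? ?]; case: b; rewrite ?mul1r ?mulN1r; lra.
Qed.

Let bias_ge0 e : 0 <= bias v e.
Proof. by apply: prodr_ge0 => x _; rewrite divr_ge0// ltW. Qed.

Lemma Ebias_le g h : (forall e, g e <= h e) -> Ebias v g <= Ebias v h.
Proof. by move=> gh; apply: ler_sum => e _; rewrite ler_wpM2l. Qed.

(* Change of measure from uniform to biased signs; the relative entropy is
   bounded by the sum of the [v x ^+ 2 / 2 + v x ^+ 4 / 3]. *)
Lemma pac_bayes (h : {ffun J -> bool} -> R) :
  expR (Ebias v h - \sum_x (v x ^+ 2 / 2 + v x ^+ 4 / 3)) <=
  2^-1 ^+ #|J| * \sum_e expR (h e).
Proof.
have biasE e : bias v e = 2^-1 ^+ #|J| * \prod_x (1 + sgb R (e x) * v x).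
  by rewrite /bias big_split /= prodr_const mulrC.
(* The subtracted sum is the log-density of the biased law relative to the uniform one, so Jensen
   under the biased law produces a uniform average of [expR (h e)]. *)
pose z e := h e - \sum_x ln (1 + sgb R (e x) * v x).
have := @expR_jensen R _ (bias v) z bias_ge0.
have b1 : \sum_e bias v e = 1.
  by rewrite -[RHS](Ebias1 v); apply: eq_bigr => e _; rewrite mulr1.
move=> /(_ b1) J1; apply: (le_trans (le_trans _ J1)); last first.
  rewrite mulr_sumr; apply: ler_sum => e _; rewrite biasE /z expRB -mulrA.
  rewrite ler_wpM2l ?exprn_ge0 ?invr_ge0//.
  rewrite expR_sum.
  have -> : \prod_x expR (ln (1 + sgb R (e x) * v x)) = \prod_x (1 + sgb R (e x) * v x).
    by apply: eq_bigr => x _; rewrite lnK// posrE.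
  by rewrite mulrCA mulfV ?mulr1// prodf_seq_neq0; apply/allP => x _; rewrite gt_eqF.
rewrite ler_expR -/(Ebias v z).
(* Since a sign squares to 1, the cubic bound on the logarithm is affine in the sign; its mean (v +
   v^3 / 3) v - v^2 / 2 is the announced entropy term. *)
have -> : Ebias v h - \sum_x (v x ^+ 2 / 2 + v x ^+ 4 / 3) =
  Ebias v (fun e => h e + - 1 * \sum_x ((v x + v x ^+ 3 / 3) * sgb R (e x) + - (v x ^+ 2 / 2))).
  rewrite EbiasD EbiasZ Ebias_sum mulN1r; congr (_ - _); apply: eq_bigr => x _.
  by rewrite EbiasD EbiasZ Ebias_sgb Ebias_cst; field.
apply: (Ebias_le (g := fun e => h e + _)) => e; rewrite mulN1r lerD2l lerN2; apply: ler_sum => x _.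
apply: le_trans (@ln1D_le_cubic R _ _) _.
  by rewrite -subr_gt0 opprK addrC sgv.
rewrite le_eqVlt; apply/orP; left; apply/eqP.
by rewrite /sgb; case: (e x); field.
Qed.

End pac_bayes.

Section sketch_bound.
Context (R : realType) (J : finType) (v : J -> R) (d s : nat).
Context (f : J -> 'cV[R]_d) (Om : 'M[R]_(d, s)) (th : R).
Hypothesis v1 : forall x, `|v x| < 1.
Hypothesis th0 : 0 <= th.

Let Fv : 'cV[R]_d := \sum_x v x *: f x.
Let a x := dotv (f x) Fv - v x * dotv (f x) (f x).
Let Xbar := dotv Fv Fv + \sum_x (1 - v x ^+ 2) * dotv (f x) (f x).
Let Var := 4 * \sum_x a x ^+ 2 + 2 * \sum_x \sum_y dotv (f x) (f y) ^+ 2.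

(** PAC-Bayes is applied to the logarithm of the normalised exponential. Because [Om] does not see
    [Fv], the sketch term costs at most the energies of the individual vectors, whereas [Xbar]
    contains the full |Fv|^2. *)
Lemma sketch_bound (G y : R) : 0 < G -> 0 <= y -> Om^T *m Fv = 0 ->
  2^-1 ^+ #|J| * \sum_e (Num.sqrt (1 + th * norm2 (sign_sum f e) ^+ 2) ^+ s *
    expR (- (th * norm2 (Om^T *m sign_sum f e) ^+ 2 / 2))) <= G ->
  s%:R / 2 * (ln (1 + y) + (th * Xbar - y) / (1 + y)
    - (th ^+ 2 * Var + (th * Xbar - y) ^+ 2) / (1 + y))
  - th * (\sum_x norm2 (Om^T *m f x) ^+ 2) / 2
  - \sum_x (v x ^+ 2 / 2 + v x ^+ 4 / 3) <= ln G.
Proof.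
move=> G0 y0 OmF.
have v1' x : `|v x| <= 1 by exact: ltW.
pose X e := dotv (sign_sum f e) (sign_sum f e).
have X0 e : 0 <= th * X e by rewrite mulr_ge0// dotvv_ge0.
have y1 : 0 < 1 + y by rewrite ltr_wpDr.
pose h e := s%:R / 2 * ln (1 + th * X e) - th * norm2 (Om^T *m sign_sum f e) ^+ 2 / 2.
rewrite (eq_bigr (fun e => expR (h e))); last first.
  move=> e _; rewrite norm2_sqr /h expRD; congr (_ * _).
  have p0 : 0 < 1 + th * X e by rewrite ltr_wpDr.
  rewrite -/(X e) -{1}[1 + th * X e]lnK ?posrE//.
  have -> : expR (ln (1 + th * X e)) = expR (ln (1 + th * X e) / 2) ^+ 2.
    by rewrite -expRM_natr divfK.
  by rewrite sqrtr_sqr ger0_norm ?expR_ge0// -expRM_natl; congr expR; ring.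
move=> /(le_trans (pac_bayes v1 h)); rewrite -[G in X in X -> _]lnK ?posrE// ler_expR.
apply: le_trans; rewrite lerD2r.
have -> : Ebias v h = s%:R / 2 * Ebias v (fun e => ln (1 + th * X e)) +
   - (th / 2) * Ebias v (fun e => norm2 (Om^T *m sign_sum f e) ^+ 2).
  rewrite -!EbiasZ -EbiasD; apply: eq_bigr => e _; rewrite /h; congr (_ * _); ring.
apply: lerD.
  rewrite ler_wpM2l ?divr_ge0//.
  have le1 e : (ln (1 + y) - y / (1 + y) - y ^+ 2 / (1 + y)) +
      ((1 + 2 * y) / (1 + y) * th * X e + - (th ^+ 2 / (1 + y)) * X e ^+ 2) <= ln (1 + th * X e).
    apply: le_trans (ln1D_ge_parabola (X0 e) y0); rewrite le_eqVlt; apply/orP; left.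
    by apply/eqP; field; rewrite gt_eqF.
  apply: le_trans (Ebias_le v1 le1).
  rewrite EbiasD Ebias_cst EbiasD !EbiasZ.
  have EX : Ebias v X = Xbar by exact: Ebias_sign_sum_sqr.
  have EV : Ebias v (fun e => X e ^+ 2) <= Var + Xbar ^+ 2.
    have := Ebias_sign_sum_var f v1'; rewrite -/Var -/Xbar => V.
    have <- : Ebias v (fun e => (X e - Xbar) ^+ 2) + Xbar ^+ 2 = Ebias v (fun e => X e ^+ 2).
      have -> : Ebias v (fun e => (X e - Xbar) ^+ 2) =
          Ebias v (fun e => X e ^+ 2 + (- (2 * Xbar) * X e + Xbar ^+ 2)).
        by apply: eq_bigr => e _; congr (_ * _); ring.
      by rewrite !EbiasD EbiasZ Ebias_cst EX; ring.
    by rewrite lerD2r.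
  rewrite EX.
  have -> : ln (1 + y) + (th * Xbar - y) / (1 + y)
    - (th ^+ 2 * Var + (th * Xbar - y) ^+ 2) / (1 + y) =
    ln (1 + y) - y / (1 + y) - y ^+ 2 / (1 + y) +
    ((1 + 2 * y) / (1 + y) * th * Xbar + - (th ^+ 2 / (1 + y)) * (Var + Xbar ^+ 2)).
    by field; rewrite gt_eqF.
  rewrite lerD2l lerD2l !mulNr lerN2 ler_wpM2l// divr_ge0 ?sqr_ge0//; exact: ltW.
have EY : Ebias v (fun e => norm2 (Om^T *m sign_sum f e) ^+ 2) <=
    \sum_x norm2 (Om^T *m f x) ^+ 2.
  have -> : Ebias v (fun e => norm2 (Om^T *m sign_sum f e) ^+ 2) =
     Ebias v (fun e => dotv (sign_sum (fun x => Om^T *m f x) e)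
                            (sign_sum (fun x => Om^T *m f x) e)).
    apply: eq_bigr => e _; rewrite norm2_sqr /sign_sum mulmx_sumr.
    by under eq_bigr do rewrite -scalemxAr.
  rewrite Ebias_sign_sum_sqr.
  have -> : \sum_x v x *: (Om^T *m f x) = 0.
    transitivity (Om^T *m Fv) => //; rewrite /Fv mulmx_sumr.
    by apply: eq_bigr => x _; rewrite scalemxAr.
  rewrite dotv0r add0r; apply: ler_sum => x _; rewrite norm2_sqr.
  by rewrite ler_piMl ?dotvv_ge0// lerBlDr lerDl sqr_ge0.
rewrite mulNr lerN2.
have -> : th * (\sum_x norm2 (Om^T *m f x) ^+ 2) / 2 =
    th / 2 * (\sum_x norm2 (Om^T *m f x) ^+ 2) by ring.
by rewrite ler_wpM2l// divr_ge0.
Qed.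
End sketch_bound.

(** In use, [b i] and [t i] are the squared lengths of a column of [F] and of its sketch. The
    exponential parameter is negative, so Jensen with weights proportional to [b] bounds the
    sketched energy from above. *)
Lemma trace_bound (R : realType) (I : finType) (b t : I -> R) (s : nat) (y G : R) :
  (forall i, 0 <= b i) -> (forall i, b i = 0 -> t i = 0) -> 0 < \sum_i b i ->
  0 < y <= 1 -> 0 < G ->
  \sum_i b i / (\sum_i b i) * (Num.sqrt (1 + - (y / 4 / b i) * b i) ^+ s *
     expR (- (- (y / 4 / b i) * t i / 2))) <= G ->
  \sum_i t i <= (\sum_i b i) * (8 / y * ln G + s%:R / (1 - y / 4)).
Proof.
set k := \sum_i b i => b0 bt k0 /andP[y0 y1] G0 hG.
have q0 : 0 < 1 - y / 4 by lra.
pose p i := b i / k.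
have p0 i : 0 <= p i by rewrite divr_ge0// ltW.
have p1 : \sum_i p i = 1 by rewrite -mulr_suml mulfV// gt_eqF.
have Jn := expR_jensen (fun i => y / 8 * (t i / b i)) p0 p1.
have E1 : \sum_i p i * (y / 8 * (t i / b i)) = y / 8 * (\sum_i t i) / k.
  rewrite mulr_sumr mulr_suml; apply: eq_bigr => i _; rewrite /p.
  (* For [b i = 0] the quotient is 0 by convention, consistent with [t i = 0]. *)
  have [bi|bi] := eqVneq (b i) 0; first by rewrite (bt _ bi) bi !(mul0r, mulr0).
  by field; rewrite bi gt_eqF.
move: hG.
have -> : \sum_i b i / k * (Num.sqrt (1 + - (y / 4 / b i) * b i) ^+ s *
     expR (- (- (y / 4 / b i) * t i / 2))) =
   Num.sqrt (1 - y / 4) ^+ s * \sum_i p i * expR (y / 8 * (t i / b i)).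
  rewrite mulr_sumr; apply: eq_bigr => i _; rewrite /p.
  have [bi|bi] := eqVneq (b i) 0; first by rewrite bi !(mul0r, mulr0).
  rewrite mulNr divfK// [in RHS]mulrCA; congr (_ * (_ * expR _)).
  by field.
move=> hG; have sq0 : 0 < Num.sqrt (1 - y / 4) ^+ s by rewrite exprn_gt0// sqrtr_gt0.
have := le_trans (ler_wpM2l (ltW sq0) Jn) hG.
rewrite -ler_ln ?posrE ?mulr_gt0 ?expR_gt0// lnM ?posrE ?expR_gt0//.
rewrite expRK E1 lnXn ?sqrtr_gt0//.
have lsq : ln (Num.sqrt (1 - y / 4)) = ln (1 - y / 4) / 2.
  have -> : ln (1 - y / 4) = ln (Num.sqrt (1 - y / 4)) *+ 2.
    by rewrite -lnXn ?sqrtr_gt0// sqr_sqrtr// ltW.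
  by rewrite -[ln _ *+ 2]mulr_natr mulfK.
rewrite lsq => h.
have l2 := ln_ge1BV q0.
have -> : \sum_i t i = k * (8 / y * (y / 8 * (\sum_i t i) / k)).
  by field; rewrite !gt_eqF.
apply: ler_wpM2l; first exact: ltW.
have -> : 8 / y * ln G + s%:R / (1 - y / 4) =
   8 / y * (ln G + s%:R / 2 * ((1 - y / 4)^-1 - 1)).
  by field; rewrite (_ : 4 - y != 0) ?gt_eqF//; lra.
apply: ler_wpM2l; first by rewrite divr_ge0// ltW.
move: h; rewrite -[_ *+ s]mulr_natr => h.
have s0 : (0:R) <= s%:R by [].
by nra.
Qed.

(** In use, p and q are the two square roots in the sketch size. After division by K only y = q / (p
    + q) and xi = Xbar / K, close to (1 - y)^2 + 11/4, remain. The tangency point 15/8 is the value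
    that th * Xbar approaches as y tends to 0. *)
Lemma sketch_numeric (R : realType) (p q s lnG tA KL Xbar Var : R) :
  let K := (p + q) ^+ 2 in let th := (2 * K)^-1 in
  0 <= p -> 0 < q -> 20 <= q ^+ 2 -> 8 * K <= s -> lnG <= q ^+ 2 / 8 ->
  tA <= p ^+ 2 * (s * (1 + q / (p + q) / 2)) ->
  KL <= (3 / 2 + 1 / 400) * K ->
  p ^+ 2 + 11 / 4 * K - K / 400 <= Xbar <= p ^+ 2 + 11 / 4 * K ->
  Var <= 14 * K ->
  lnG < s / 2 * (ln (1 + 15 / 8) + (th * Xbar - 15 / 8) / (1 + 15 / 8)
    - (th ^+ 2 * Var + (th * Xbar - 15 / 8) ^+ 2) / (1 + 15 / 8))
    - th * tA / 2 - KL.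
Proof.
move=> K th p0 q0 q20 sK lG tAle KLle /andP[X1 X2] Vle.
have r0 : 0 < p + q by rewrite ltr_wpDl.
have K0 : 0 < K by rewrite exprn_gt0.
set y := q / (p + q) in tAle.
have y0 : 0 < y by rewrite divr_gt0.
have y1 : y <= 1 by rewrite ler_pdivrMr// mul1r lerDr.
have pE : p ^+ 2 = (1 - y) ^+ 2 * K by rewrite /y /K; field; rewrite gt_eqF.
have qE : q ^+ 2 = y ^+ 2 * K by rewrite /y /K; field; rewrite gt_eqF.
have thE : th = (2 * K)^-1 by [].
clearbody th K y; rewrite pE in tAle X1 X2; rewrite qE in q20 lG.
pose xi := Xbar / K.
have xiE : th * Xbar = xi / 2 by rewrite thE /xi; field; rewrite gt_eqF.
have xi1 : (1 - y) ^+ 2 + 11 / 4 - 1 / 400 <= xi by rewrite ler_pdivlMr//; lra.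
have xi2 : xi <= (1 - y) ^+ 2 + 11 / 4 by rewrite ler_pdivrMr//; lra.
have y2 : y ^+ 2 <= 1 by rewrite expr_le1// ltW.
have K20 : 20 <= K by rewrite (le_trans q20)// ler_piMl// ltW.
have thV : th ^+ 2 * Var <= 7 / 40.
  have -> : th ^+ 2 * Var = Var / K / K / 4 by rewrite thE; field; rewrite gt_eqF.
  have : Var / K <= 14 by rewrite ler_pdivrMr.
  move=> h; have : Var / K / K <= 14 / 20.
    rewrite ler_pdivrMr//; apply: (le_trans h).
    by rewrite -ler_pdivrMl; lra.
  by lra.
have thtA : th * tA / 2 <= s / 2 * ((1 - y) ^+ 2 * (1 + y / 2) / 2).
  have -> : th * tA / 2 = tA / K / 4 by rewrite thE; field; rewrite gt_eqF.
  have : tA / K <= (1 - y) ^+ 2 * (s * (1 + y / 2)).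
    by rewrite ler_pdivrMr// mulrAC.
  by lra.
have s0 : 0 < s by rewrite (lt_le_trans _ sK)// mulr_gt0.
have l1 := ln_23_8_ge1 R.
have e1 : 1 + 15 / 8 = 23 / 8 :> R by lra.
rewrite e1 xiE.
(* The margin is thin: s / 2 times 41/100 is at least 1.64 K, against K / 8 for [lnG] and (3/2 +
   1/400) K for the entropy, 1.6275 K in all. *)
suff B : 41 / 100 <= ln (23 / 8) + (xi / 2 - 15 / 8) / (23 / 8)
    - (th ^+ 2 * Var + (xi / 2 - 15 / 8) ^+ 2) / (23 / 8) - (1 - y) ^+ 2 * (1 + y / 2) / 2.
  have : s / 2 * (41 / 100) <= s / 2 * (ln (23 / 8) + (xi / 2 - 15 / 8) / (23 / 8)
    - (th ^+ 2 * Var + (xi / 2 - 15 / 8) ^+ 2) / (23 / 8) - (1 - y) ^+ 2 * (1 + y / 2) / 2).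
    by rewrite ler_wpM2l// divr_ge0// ltW.
  rewrite [X in _ <= X -> _]mulrBr => h1.
  have h2 : s / 2 * (41 / 100) >= 164 / 100 * K by lra.
  have h3 : lnG <= K / 8.
    by apply: (le_trans lG); rewrite ler_wpM2r// ler_piMl// ltW.
  by lra.
pose c := (1 - y) ^+ 2 + 11 / 4 - xi.
have c0 : 0 <= c by rewrite /c; lra.
have c1 : c <= 1 / 400 by rewrite /c; lra.
have xic : xi = (1 - y) ^+ 2 + 11 / 4 - c by rewrite /c; lra.
rewrite xic.
have g0 : 0 <= y * (1 - y) by rewrite mulr_ge0 ?subr_ge0// ltW.
have g1 : 0 <= y ^+ 2 * (1 - y) by rewrite mulr_ge0 ?subr_ge0 ?sqr_ge0.
have g2 : 0 <= (1 - y) ^+ 2 by rewrite sqr_ge0.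
have g3 : (1 - y) ^+ 2 <= 1 by rewrite expr_le1//; lra.
have sqb : (((1 - y) ^+ 2 + 11 / 4 - c) / 2 - 15 / 8) ^+ 2 <= (1 - (1 - y) ^+ 2) / 4 + 1 / 300.
  have -> : (((1 - y) ^+ 2 + 11 / 4 - c) / 2 - 15 / 8) ^+ 2 =
     (1 - (1 - y) ^+ 2 + c) ^+ 2 / 4 by field.
  by nra.
by nra.
Qed.

(** * Directions annihilated by the sketch *)

Lemma mulmx_sum_col_scale (R : realType) (d m : nat) (F : 'M[R]_(d, m)) (v : 'cV[R]_m) :
  F *m v = \sum_j v j 0 *: col j F.
Proof.
apply/matrixP => i j; rewrite ord1 mxE summxE; apply: eq_bigr => l _.
by rewrite !mxE mulrC.
Qed.

Lemma trmx_mulmx_entry (R : realType) (d m : nat) (F : 'M[R]_(d, m)) (u : 'cV[R]_d) j :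
  (F^T *m u) j 0 = dotv (col j F) u.
Proof. by rewrite mxE dotvE; apply: eq_bigr => i _; rewrite !mxE. Qed.

Lemma dotv_tr_contraction (R : realType) (d m : nat) (F : 'M[R]_(d, m)) :
  (forall u : 'cV[R]_d, dotv (F^T *m u) (F^T *m u) <= dotv u u) ->
  forall v, dotv (F *m v) (F *m v) <= dotv v v.
Proof.
move=> Fle v.
have h1 : dotv (F *m v) (F *m v) ^+ 2 <= dotv v v * dotv (F *m v) (F *m v).
  have := dotv_CS v (F^T *m (F *m v)); rewrite dotv_mulmx trmxK.
  move=> h; apply: (le_trans h); rewrite ler_wpM2l ?dotvv_ge0//; exact: Fle.
have := dotvv_ge0 (F *m v); rewrite le_eqVlt => /predU1P[<-|Fv0]; first exact: dotvv_ge0.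
by move: h1; rewrite expr2 ler_pM2r.
Qed.

(* Splitting each column into [N] copies scaled by [1 / sqrt N] preserves the
   quadratic quantities and makes every bias small, so that the signs behave
   like the entries of a Gaussian vector. *)
Section column_copies.
Context (R : realType) (d m N : nat) (F : 'M[R]_(d, m)).
Hypothesis N0 : (0 < N)%N.

Let r : R := (Num.sqrt N%:R)^-1.

Definition column_copy (x : 'I_m * 'I_N) : 'cV[R]_d := r *: col x.1 F.

Let r2 : r ^+ 2 = N%:R^-1.
Proof. by rewrite exprVn sqr_sqrtr. Qed.

Let NR : N%:R != 0 :> R.
Proof. by rewrite pnatr_eq0 -lt0n. Qed.

Let sum_copies (V : lmodType R) (g : 'I_m -> V) :
  \sum_(x : 'I_m * 'I_N) r ^+ 2 *: g x.1 = \sum_j g j.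
Proof.
rewrite -(pair_bigA _ (fun j _ => r ^+ 2 *: g j))/=; apply: eq_bigr => j _.
by rewrite sumr_const card_ord r2 -scaler_nat scalerA mulfV// scale1r.
Qed.

Let sum_copiesM (g : 'I_m -> R) :
  \sum_(x : 'I_m * 'I_N) r ^+ 2 * g x.1 = \sum_j g j.
Proof. exact: (@sum_copies R^o g). Qed.

Lemma sum_sqr_copies (v : 'cV[R]_m) :
  \sum_(x : 'I_m * 'I_N) (r * v x.1 0) ^+ 2 = dotv v v.
Proof.
under eq_bigr do rewrite exprMn.
by rewrite (sum_copiesM (fun j => v j 0 ^+ 2)) dotvE; apply: eq_bigr => j _; rewrite expr2.
Qed.

Lemma sqr_copy_le (v : 'cV[R]_m) (x : 'I_m * 'I_N) :
  (r * v x.1 0) ^+ 2 <= dotv v v / N%:R.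
Proof.
rewrite exprMn r2 mulrC ler_wpM2r ?invr_ge0// dotvE (bigD1 x.1)//= -expr2 lerDl.
by apply: sumr_ge0 => j _; rewrite -expr2 sqr_ge0.
Qed.

Lemma sum_column_copies (v : 'cV[R]_m) :
  \sum_x (r * v x.1 0) *: column_copy x = F *m v.
Proof.
have e1 x : (r * v x.1 0) *: column_copy x = r ^+ 2 *: (v x.1 0 *: col x.1 F).
  by rewrite /column_copy !scalerA; congr (_ *: _); ring.
under eq_bigr do rewrite e1.
by rewrite (sum_copies (fun j => v j 0 *: col j F)) mulmx_sum_col_scale.
Qed.

Lemma sum_norm2_column_copies (s : nat) (W : 'M[R]_(s, d)) :
  \sum_x norm2 (W *m column_copy x) ^+ 2 = \sum_j norm2 (W *m col j F) ^+ 2.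
Proof.
have e1 x : norm2 (W *m column_copy x) ^+ 2 = r ^+ 2 * norm2 (W *m col x.1 F) ^+ 2.
  by rewrite -scalemxAr !norm2_sqr dotvZl dotvZr mulrA -expr2.
under eq_bigr do rewrite e1.
by rewrite (sum_copiesM (fun j => norm2 (W *m col j F) ^+ 2)).
Qed.

Lemma sum_dotv_column_copies :
  \sum_x dotv (column_copy x) (column_copy x) = \sum_j dotv (col j F) (col j F).
Proof.
have e1 x : dotv (column_copy x) (column_copy x) = r ^+ 2 * dotv (col x.1 F) (col x.1 F).
  by rewrite dotvZl dotvZr mulrA -expr2.
under eq_bigr do rewrite e1.
by rewrite (sum_copiesM (fun j => dotv (col j F) (col j F))).
Qed.

Hypothesis Fle : forall u : 'cV[R]_d, dotv (F^T *m u) (F^T *m u) <= dotv u u.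

Lemma column_copy_le (x : 'I_m * 'I_N) :
  dotv (column_copy x) (column_copy x) <= N%:R^-1.
Proof.
have bj : dotv (col x.1 F) (col x.1 F) <= 1.
  have := dotv_tr_contraction Fle (delta_mx x.1 0); rewrite -colE => h; apply: (le_trans h).
  rewrite dotvE (bigD1 x.1)//= big1 => [|j jx]; first by rewrite !mxE !eqxx mulr1 addr0.
  by rewrite !mxE (negbTE jx) mul0r.
by rewrite dotvZl dotvZr mulrA -expr2 r2 ler_piMr ?invr_ge0.
Qed.

Lemma sum_sqr_dotv_column_copies (u : 'cV[R]_d) :
  \sum_x dotv (column_copy x) u ^+ 2 <= dotv u u.
Proof.
have e1 x : dotv (column_copy x) u ^+ 2 = r ^+ 2 * dotv (col x.1 F) u ^+ 2.
  by rewrite dotvZl exprMn.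
under eq_bigr do rewrite e1.
rewrite (sum_copiesM (fun j => dotv (col j F) u ^+ 2)).
apply: le_trans (Fle u); rewrite dotvE le_eqVlt; apply/orP; left; apply/eqP.
by apply: eq_bigr => j _; rewrite trmx_mulmx_entry expr2.
Qed.

End column_copies.

(** Young's inequality, weighted so that the main term grows by only 5%: with a = 11/4 K and b = K /
    400 the result stays below 3 K. *)
Lemma sum_sqr_sub_le (R : realType) (J : finType) (g h : J -> R) (a b : R) :
  \sum_x g x ^+ 2 <= a -> \sum_x h x ^+ 2 <= b ->
  \sum_x (g x - h x) ^+ 2 <= 21 / 20 * a + 21 * b.
Proof.
move=> ga hb.
have : \sum_x (g x - h x) ^+ 2 <= \sum_x (21 / 20 * g x ^+ 2 + 21 * h x ^+ 2).
  apply: ler_sum => x _; move: (g x) (h x) => g' h'.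
  have -> : 21 / 20 * g' ^+ 2 + 21 * h' ^+ 2 =
      (g' - h') ^+ 2 + 20 * (g' / 20 + h') ^+ 2 by field.
  by rewrite lerDl mulr_ge0// sqr_ge0.
rewrite big_split /= -!mulr_sumr => /le_trans; apply.
by apply: lerD; rewrite ler_wpM2l.
Qed.

Lemma sum_entropy_le (R : realType) (J : finType) (v : J -> R) (K : R) :
  (forall x, v x ^+ 2 <= 1 / 400) -> \sum_x v x ^+ 2 <= 3 * K ->
  \sum_x (v x ^+ 2 / 2 + v x ^+ 4 / 3) <= (3 / 2 + 1 / 400) * K.
Proof.
move=> v2 vK.
have : \sum_x (v x ^+ 2 / 2 + v x ^+ 4 / 3) <= \sum_x (1 / 2 + 1 / 1200) * v x ^+ 2.
  apply: ler_sum => x _; have := v2 x; have := sqr_ge0 (v x).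
  rewrite (_ : v x ^+ 4 = v x ^+ 2 * v x ^+ 2); last by ring.
  by move: (v x ^+ 2) => z; nra.
by rewrite -mulr_sumr; lra.
Qed.

(** The lengths 11/4 K and 3 K normalise a direction violating the ratio 11/12. An entropy of about
    3/2 K raises the mean squared length of the sign sum by about 11/4 K, none of which the sketch
    sees. The small [e] controls the diagonal corrections. *)
Lemma sketch_null_direction_absurd (R : realType) (J : finType) (d s : nat)
    (Om : 'M[R]_(d, s)) (f : J -> 'cV[R]_d) (v : J -> R) (p q G e : R) :
  let K := (p + q) ^+ 2 in let Fv := \sum_x v x *: f x in
  0 <= p -> 0 < q -> 20 <= q ^+ 2 -> 8 * K <= s%:R -> 0 < G -> ln G <= q ^+ 2 / 8 ->
  0 < e <= 1 / 400 -> (forall x, dotv (f x) (f x) <= e) -> (forall x, v x ^+ 2 <= e) ->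
  \sum_x dotv (f x) (f x) = p ^+ 2 ->
  (forall u, \sum_x dotv (f x) u ^+ 2 <= dotv u u) ->
  \sum_x v x ^+ 2 <= 3 * K -> dotv Fv Fv = 11 / 4 * K ->
  Om^T *m Fv = 0 ->
  \sum_x norm2 (Om^T *m f x) ^+ 2 <= p ^+ 2 * (s%:R * (1 + q / (p + q) / 2)) ->
  2^-1 ^+ #|J| * \sum_e (Num.sqrt (1 + (2 * K)^-1 * norm2 (sign_sum f e) ^+ 2) ^+ s *
    expR (- ((2 * K)^-1 * norm2 (Om^T *m sign_sum f e) ^+ 2 / 2))) <= G -> False.
Proof.
move=> K Fv p0 q0 q20 sK G0 lnG /andP[e0 e400] bf v2 sum_bf f_le sum_v2 FvK OmFv tA S1E.
have e1 : e < 1 by move: e400; clear; lra.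
have K0 : 0 < K by rewrite exprn_gt0// ltr_wpDl.
have v1 x : `|v x| < 1.
  rewrite -(ltr_pXn2r (n := 2))// ?nnegrE// expr1n real_normK ?num_real//.
  exact: le_lt_trans (v2 x) e1.
have p2K : p ^+ 2 <= K.
  by rewrite /K sqrrD -addrA lerDl addr_ge0 ?sqr_ge0// mulrn_wge0// mulr_ge0// ltW.
have th0 : 0 <= (2 * K)^-1 by rewrite invr_ge0 mulr_ge0// ltW.
have y0 : 0 <= 15 / 8 :> R by rewrite divr_ge0.
pose W := \sum_x v x ^+ 2 * dotv (f x) (f x).
have W0 : 0 <= W by apply: sumr_ge0 => x _; rewrite mulr_ge0 ?sqr_ge0 ?dotvv_ge0.
have eK : e * K <= K / 400.
  by move: e400; rewrite -(ler_pM2r K0); clear; lra.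
have W1 : W <= K / 400.
  apply: (@le_trans _ _ (e * p ^+ 2)); last first.
    by apply: le_trans eK; rewrite ler_wpM2l// ltW.
  by rewrite -sum_bf mulr_sumr; apply: ler_sum => x _; rewrite ler_wpM2r ?dotvv_ge0.
have a_le : \sum_x (dotv (f x) Fv - v x * dotv (f x) (f x)) ^+ 2 <= 3 * K.
  have g_le : \sum_x dotv (f x) Fv ^+ 2 <= 11 / 4 * K by rewrite -FvK; exact: f_le.
  have h_le : \sum_x (v x * dotv (f x) (f x)) ^+ 2 <= K / 400.
    apply: le_trans W1; apply: ler_sum => x _; rewrite exprMn ler_wpM2l ?sqr_ge0//.
    by rewrite expr2 ler_piMl ?dotvv_ge0// (le_trans (bf x))// ltW.
  apply: (le_trans (sum_sqr_sub_le g_le h_le)).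
  by move: K0; clear; move: K => K K0; lra.
(* Taking [u = f x] in [f_le] bounds each row of squared Gram entries by |f x|^2, and these add up
   to p^2. *)
have BB : \sum_x \sum_y dotv (f x) (f y) ^+ 2 <= p ^+ 2.
  rewrite -sum_bf; apply: ler_sum => x _; apply: le_trans (f_le _).
  by apply: ler_sum => y _; rewrite dotvC.
have := sketch_bound v1 th0 G0 y0 OmFv S1E.
rewrite leNgt => /negP; apply.
apply: sketch_numeric => //.
- by apply: sum_entropy_le => // x; exact: le_trans (v2 x) e400.
- have -> : \sum_x (1 - v x ^+ 2) * dotv (f x) (f x) = p ^+ 2 - W.
    by rewrite -sum_bf /W -sumrB; apply: eq_bigr => x _; rewrite mulrBl mul1r.
  rewrite -/Fv FvK -/K -sum_bf; move: (\sum_x dotv _ _) W0 W1 => k; clear.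
  by move: K W => K W W0 W1; apply/andP; split; lra.
- rewrite -/Fv -/K; move: BB a_le p2K; move: (\sum_x _ ^+ 2) (\sum_x \sum_y _) => a B.
  by clear; move: K => K; lra.
Qed.

(** The two terms exceed s by at most y s / 8 and y s / 3, and 1/8 + 1/3 <= 1/2. *)
Lemma trace_bound_simplified (R : realType) (p q s lnG : R) :
  let y := q / (p + q) in
  0 <= p -> 0 < q -> 8 * (p + q) ^+ 2 <= s -> lnG <= q ^+ 2 / 8 ->
  8 / y * lnG + s / (1 - y / 4) <= s * (1 + y / 2).
Proof.
move=> y p0 q0 sK lG.
have r0 : 0 < p + q by rewrite ltr_wpDl.
have y0 : 0 < y by rewrite divr_gt0.
have y1 : y <= 1 by rewrite ler_pdivrMr// mul1r lerDr.
have yK : q ^+ 2 = y ^+ 2 * (p + q) ^+ 2 by rewrite /y; field; rewrite gt_eqF.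
have s0 : 0 <= s by rewrite (le_trans _ sK)// mulr_ge0// sqr_ge0.
have h1 : 8 / y * lnG <= y * (s / 8).
  apply: (le_trans (y := 8 / y * (q ^+ 2 / 8))).
    by rewrite ler_wpM2l// divr_ge0// ltW.
  rewrite yK (_ : 8 / y * _ = y * (p + q) ^+ 2); last by field; rewrite gt_eqF.
  by apply: ler_wpM2l; [exact: ltW | rewrite ler_pdivlMr// mulrC].
have h2 : s / (1 - y / 4) <= s * (1 + y / 3).
  apply: ler_wpM2l => //; rewrite -[leLHS]mul1r ler_pdivrMr; last by lra.
  by nra.
move: s0 y0 h1 h2; move: (8 / y * lnG) (s / (1 - _)) => a b; clear; move: y => y.
by nra.
Qed.

Lemma sketch_event (R : realType) (dT : measure_display) (T : measurableType dT)
    (P : probability T R) (d s m : nat) (Om : T -> 'M[R]_(d, s))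
    (F : 'M[R]_(d, m)) (delta : R) :
  std_gaussian_matrix P Om -> 0 < delta < 1 ->
  (forall u : 'cV[R]_d, dotv (F^T *m u) (F^T *m u) <= dotv u u) ->
  8 * (Num.sqrt (\sum_j dotv (col j F) (col j F))
       + Num.sqrt (8 * ln (16 / delta))) ^+ 2 <= s%:R ->
  exists E : set T, [/\ measurable E, ((1 - delta)%:E <= P E)%E &
    forall w, E w -> forall v : 'cV[R]_m, (Om w)^T *m (F *m v) = 0 ->
      12 * dotv (F *m v) (F *m v) <= 11 * dotv v v].
Proof.
move=> Om_std /andP[de0 de1] Fle.
pose b j := dotv (col j F) (col j F).
rewrite -/(\sum_j b j); set k := \sum_j b j.
have b0 j : 0 <= b j by exact: dotvv_ge0.
have k0 : 0 <= k by rewrite sumr_ge0.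
set p := Num.sqrt k; set q := Num.sqrt _.
have de16 : 0 < 16 / delta by rewrite divr_gt0.
have tau20 : 20 <= 8 * ln (16 / delta).
  have : ln 16 <= ln (16 / delta).
    by rewrite ler_ln ?posrE// ler_pdivlMr// ler_piMr// ltW.
  have := ln16_ge R; lra.
have p0 : 0 <= p by exact: sqrtr_ge0.
have q0 : 0 < q by rewrite sqrtr_gt0 (lt_le_trans _ tau20).
have p2 : p ^+ 2 = k by rewrite sqr_sqrtr.
have q2 : q ^+ 2 = 8 * ln (16 / delta) by rewrite sqr_sqrtr// (le_trans _ tau20).
have lnG : ln (2 / delta) <= q ^+ 2 / 8.
  rewrite q2 mulrAC mulfV// mul1r.
  by rewrite ler_ln ?posrE ?divr_gt0// ler_wpM2r ?invr_ge0 ?ler_nat// ltW.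
have q20 : 20 <= q ^+ 2 by rewrite q2.
clear tau20 q2; set K := (p + q) ^+ 2 => sK.
have [k00|k00] := eqVneq k 0.
  exists setT; split => //; first by rewrite probability_setT lee_fin gerBl ltW.
  move=> w _ v _.
  have -> : F *m v = 0.
    rewrite mulmx_sum_col_scale big1// => j _.
    have /eqP := k00; rewrite psumr_eq0// => /allP /(_ j (mem_index_enum _)) /eqP bj.
    by rewrite (dotvv_eq0 bj) scaler0.
  by rewrite dotv0r mulr0 mulr_ge0// dotvv_ge0.
have kp : 0 < k by rewrite lt_def k00.
have r0 : 0 < p + q by rewrite ltr_wpDl.
have K0 : 0 < K by rewrite exprn_gt0.
have [e e0 e400] : exists2 e : R, 0 < e & e <= 1 / 400 by exists (1 / 400); clear; lra.
(* With N copies the squared lengths are at most 1 / N and the squared biases at most 3 K / N; both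
   are below [e]. *)
pose N := (Num.truncn ((3 * K + 1) / e)).+1.
have N1 : (3 * K + 1) / e <= N%:R.
  by apply: ltW; apply: truncnS_gt; rewrite divr_ge0 ?addr_ge0 ?mulr_ge0 ?(ltW K0) ?(ltW e0).
pose J : finType := ('I_m * 'I_N)%type.
pose f : J -> 'cV[R]_d := column_copy F.
pose y := q / (p + q).
have y0 : 0 < y by rewrite divr_gt0.
have y1 : y <= 1 by rewrite ler_pdivrMr// mul1r lerDr.
pose th := (2 * K)^-1.
have th0 : 0 < th by rewrite invr_gt0 mulr_gt0.
(* Sign patterns and columns form one family of total weight 2, so a single event bounds both sums
   by 2 / delta. The columns carry the negative parameters required by [trace_bound]. *)
pose I : finType := ({ffun J -> bool} + 'I_m)%type.
pose cI (i : I) : R := match i with inl _ => 2^-1 ^+ #|J| | inr j => b j / k end.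
pose thI (i : I) : R := match i with inl _ => th | inr j => - (y / 4 / b j) end.
pose fI (i : I) : 'cV[R]_d := match i with inl e => sign_sum f e | inr j => col j F end.
have cI0 i : 0 <= cI i.
  by case: i => [_|j] /=; rewrite ?exprn_ge0 ?invr_ge0// divr_ge0.
have cI2 : \sum_i cI i = 2.
  rewrite big_sumType /= sumr_const card_ffun card_bool -[_ *+ (2 ^ _)]mulr_natl natrX -exprMn.
  by rewrite mulfV// expr1n -mulr_suml mulfV ?gt_eqF.
have thI0 i : 0 < 1 + thI i * norm2 (fI i) ^+ 2.
  rewrite norm2_sqr; case: i => [i|j] /=.
    by rewrite ltr_wpDr// mulr_ge0 ?dotvv_ge0// ltW.
  rewrite -/(b j); have [->|bj] := eqVneq (b j) 0; first by rewrite mulr0 addr0.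
  by rewrite mulNr divfK// subr_gt0 ltr_pdivrMr// mul1r (le_lt_trans y1)// ltr1n.
have c20 : 0 < \sum_i cI i by rewrite cI2.
have [mE PE] := gaussian_exponential_event Om_std de0 cI0 c20 thI0.
move: mE PE; rewrite cI2.
set Z := fun w => _; set E := [set w | _] => mE PE.
exists E; split => // w; rewrite /E /= /Z big_sumType /=.
set S1 := (X in X + _); set S2 := (X in _ + X) => SG.
have S10 : 0 <= S1.
  apply: sumr_ge0 => i _; apply: mulr_ge0; first exact: (cI0 (inl i)).
  by apply: mulr_ge0; [exact: exprn_ge0 | exact: expR_ge0].
have S20 : 0 <= S2.
  apply: sumr_ge0 => i _; apply: mulr_ge0; first exact: (cI0 (inr i)).
  by apply: mulr_ge0; [exact: exprn_ge0 | exact: expR_ge0].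
have S1G : S1 <= 2 / delta by apply: le_trans SG; rewrite lerDl.
have S2G : S2 <= 2 / delta by apply: le_trans SG; rewrite lerDr.
have G0 : 0 < 2 / delta by rewrite divr_gt0.
pose t j := norm2 ((Om w)^T *m col j F) ^+ 2.
have tA : \sum_j t j <= k * (8 / y * ln (2 / delta) + s%:R / (1 - y / 4)).
  apply: trace_bound => //.
  - move=> j /dotvv_eq0; rewrite /t => ->.
    by rewrite mulmx0 norm20 expr0n.
  - by rewrite y0 y1.
  - by apply: le_trans S2G; rewrite /S2 le_eqVlt; apply/orP; left; apply/eqP;
      apply: eq_bigr => j _; rewrite norm2_sqr.
have {}tA : \sum_j t j <= p ^+ 2 * (s%:R * (1 + y / 2)).
  by rewrite p2; apply: (le_trans tA); apply: ler_wpM2l => //; exact: trace_bound_simplified.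
move=> v OmFv; rewrite leNgt; apply/negP => bad.
have Fv0 : 0 < dotv (F *m v) (F *m v).
  rewrite -(@pmulr_rgt0 _ 12)//; apply: le_lt_trans bad.
  by rewrite mulr_ge0// dotvv_ge0.
(* This rescales the offending direction to |F v'|^2 = 11/4 K; the violated inequality then gives
   |v'|^2 <= 3 K. *)
pose c := Num.sqrt (11 / 4 * K / dotv (F *m v) (F *m v)).
have c2 : c ^+ 2 = 11 / 4 * K / dotv (F *m v) (F *m v).
  by rewrite sqr_sqrtr// divr_ge0 ?mulr_ge0// ltW.
pose v' := c *: v.
have FvK : dotv (F *m v') (F *m v') = 11 / 4 * K.
  by rewrite /v' -scalemxAr dotvZl dotvZr mulrA -expr2 c2 divfK// gt_eqF.
have v3 : dotv v' v' <= 3 * K.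
  rewrite /v' dotvZl dotvZr mulrA -expr2 c2 mulrAC ler_pdivrMr//.
  rewrite (_ : _ * _ * dotv v v = K / 4 * (11 * dotv v v)); last by field.
  rewrite (_ : 3 * K * _ = K / 4 * (12 * dotv (F *m v) (F *m v))); last by field.
  by rewrite ler_wpM2l ?divr_ge0// ltW.
have OmFv' : (Om w)^T *m (F *m v') = 0 by rewrite /v' -!scalemxAr OmFv scaler0.
have N0 : 0 < N%:R :> R by rewrite ltr0n.
have N1e : 3 * K + 1 <= e * N%:R by rewrite [e * _]mulrC -ler_pdivrMr.
have NV : N%:R^-1 <= e.
  by rewrite -div1r ler_pdivrMr//; apply: le_trans N1e; rewrite lerDr mulr_ge0// ltW.
have vN : dotv v' v' / N%:R <= e.
  by rewrite ler_pdivrMr//; apply: le_trans N1e; rewrite (le_trans v3)// lerDl.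
have NS : (0 < N)%N by [].
apply: (@sketch_null_direction_absurd R J d s (Om w) f
  (fun x => (Num.sqrt N%:R)^-1 * v' x.1 0) p q (2 / delta) e) => //.
- by rewrite e0.
- by move=> x; exact: le_trans (column_copy_le Fle x) NV.
- by move=> x; exact: le_trans (sqr_copy_le v' x) vN.
- by rewrite p2 sum_dotv_column_copies.
- by move=> u; exact: sum_sqr_dotv_column_copies.
- by rewrite sum_sqr_copies.
- by rewrite sum_column_copies.
- by rewrite sum_column_copies.
- by rewrite sum_norm2_column_copies.
- by rewrite mulr_sumr.
Qed.

(** * Positive semidefinite matrices and the effective dimension *)

Section posdef.
Context (R : realType).

Lemma mulmx_inj_unitmx (d : nat) (M : 'M[R]_d) :
  (forall v : 'cV[R]_d, M *m v = 0 -> v = 0) -> M \in unitmx.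
Proof.
move=> Minj; rewrite -unitmx_tr -row_free_unit -kermx_eq0.
apply/eqP/row_matrixP => i; rewrite row0.
set u := row i _.
have : u *m M^T = 0.
  by apply: sub_kermxP; exact: row_sub.
move/(congr1 trmx); rewrite trmx_mul trmxK trmx0 => /Minj.
by move/(congr1 trmx); rewrite trmxK trmx0.
Qed.

Lemma psd_eq0 (d : nat) (M : 'M[R]_d) v : psd M -> dotv v (M *m v) = 0 -> M *m v = 0.
Proof.
move=> Mpsd v0; apply: dotvv_eq0; apply/eqP; rewrite -sqrf_eq0 eq_le sqr_ge0 andbT.
by have := psd_CS (M *m v) v Mpsd; rewrite v0 mulr0.
Qed.

Lemma psdD (d : nat) (M N : 'M[R]_d) : psd M -> psd N -> psd (M + N).
Proof.
move=> [Ms M0] [Ns N0]; split=> [|v]; first by rewrite linearD /= Ms Ns.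
by rewrite mulmxDl dotvDr addr_ge0.
Qed.

Lemma psd_gram (n d : nat) (A : 'M[R]_(n, d)) : psd (A^T *m A).
Proof.
split=> [|v]; first by rewrite trmx_mul trmxK.
by rewrite -mulmxA dotv_mulmx trmxK dotvv_ge0.
Qed.

(** Cholesky elimination, by induction on the number of nonzero diagonal entries. Subtracting the
    rank-one pivot preserves semidefiniteness by Cauchy-Schwarz, clears one diagonal entry and
    cannot revive a zero one. A psd matrix with zero diagonal is zero. *)
Lemma psd_factor (d : nat) (M : 'M[R]_d) : psd M ->
  exists m (F : 'M[R]_(d, m)), M = F *m F^T.
Proof.
move: {2}#|_|.+1 (ltnSn #|[pred i | M i i != 0]|) => n.
elim: n M => // n IH M Mn Mpsd.
have [Ms M0] := Mpsd.
have diagE (N : 'M[R]_d) i : dotv (delta_mx i 0) (N *m delta_mx i 0) = N i i.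
  rewrite -colE dotvE (bigD1 i)//= !mxE !eqxx mul1r big1 ?addr0// => j ji.
  by rewrite !mxE (negbTE ji) mul0r.
have [[i Mi]|noi] := pselect (exists i, M i i != 0); last first.
  exists 0%N, 0; rewrite mul0mx; apply/matrixP => i j.
  have /psd_eq0 : dotv (delta_mx j 0) (M *m delta_mx j 0) = 0.
    rewrite diagE; apply/eqP; apply: contra_notT noi => h; by exists j.
  by rewrite -colE => /(_ Mpsd) /matrixP /(_ i 0); rewrite !mxE.
have Mi0 : 0 < M i i by rewrite lt_def Mi -diagE M0.
pose e : 'cV[R]_d := delta_mx i 0.
pose f := (Num.sqrt (M i i))^-1 *: (M *m e).
have fE u : dotv f u = (Num.sqrt (M i i))^-1 * dotv e (M *m u).
  by rewrite dotvZl dotvC dotv_mulmx Ms dotvC dotv_mulmx Ms.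
have sq2 : (Num.sqrt (M i i))^-1 ^+ 2 = (M i i)^-1 by rewrite exprVn sqr_sqrtr// ltW.
have quad u v : dotv u ((M - f *m f^T) *m v) =
    dotv u (M *m v) - dotv f u * dotv f v.
  rewrite mulmxBl dotvBr -mulmxA; congr (_ - _).
  rewrite [f^T *m v](_ : _ = (dotv f v)%:M); last first.
    by apply/matrixP => a c; rewrite !ord1 !mxE eqxx mulr1n /dotv mxE.
  by rewrite mul_mx_scalar dotvZr mulrC (dotvC u).
have M1psd : psd (M - f *m f^T).
  split=> [|u]; first by rewrite linearB /= trmx_mul trmxK Ms.
  rewrite quad subr_ge0 !fE mulrACA -!expr2 sq2.
  have := psd_CS e u Mpsd; rewrite diagE => h.
  by rewrite ler_pdivrMl// (le_trans h).
have [||m [F FE]] := IH (M - f *m f^T) => //; last first.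
  exists (1 + m)%N, (row_mx f F); rewrite tr_row_mx mul_row_col -FE.
  by rewrite addrC subrK.
rewrite -ltnS; apply: leq_trans Mn; rewrite ltnS; apply: proper_card.
have N1 j : (M - f *m f^T) j j = M j j - dotv f (delta_mx j 0) ^+ 2.
  by rewrite -!diagE quad -expr2.
apply/properP; split.
  apply/fintype.subsetP => j; rewrite !inE; apply: contraNneq => Mj.
  rewrite eq_le -{2}diagE M1psd.2 andbT N1 Mj sub0r oppr_le0 sqr_ge0//.
exists i; rewrite !inE// negbK N1 fE diagE exprMn sq2.
by rewrite expr2 mulrA mulVf// mul1r subrr.
Qed.

Section regularized.
Variables (d : nat) (H : 'M[R]_d) (rho : R).
Hypotheses (Hpsd : psd H) (rho0 : 0 < rho).

Let Hr := H + rho%:M.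

Lemma regularized_quad (v : 'cV[R]_d) :
  dotv v (Hr *m v) = dotv v (H *m v) + rho * dotv v v.
Proof. by rewrite mulmxDl mul_scalar_mx dotvDr dotvZr. Qed.

Lemma regularized_psd : psd Hr.
Proof.
split=> [|v]; first by rewrite linearD /= tr_scalar_mx Hpsd.1.
by rewrite regularized_quad addr_ge0 ?Hpsd.2// mulr_ge0 ?dotvv_ge0// ltW.
Qed.

Lemma regularized_unit : Hr \in unitmx.
Proof.
apply: mulmx_inj_unitmx => v v0; apply: dotvv_eq0.
have := regularized_quad v; rewrite v0 dotv0r => /eqP.
rewrite eq_sym paddr_eq0 ?Hpsd.2 ?mulr_ge0 ?dotvv_ge0 ?ltW// => /andP[_].
by rewrite mulf_eq0 gt_eqF//= => /eqP.
Qed.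

(** The substitution u = (H + rho I) z gives D u = H z and u - D u = rho z, so positivity of D and
    of I - D is read off from H. The last clause is the trace of F F^T taken cyclically. *)
Lemma deff_factor : exists m (F : 'M[R]_(d, m)),
  [/\ H *m invmx Hr = F *m F^T,
      forall u : 'cV[R]_d, dotv (F^T *m u) (F^T *m u) <= dotv u u &
      \sum_j dotv (col j F) (col j F) = deff H rho].
Proof.
have U := regularized_unit; set D := H *m invmx Hr.
have comm : H *m Hr = Hr *m H.
  by rewrite mulmxDl mulmxDr mul_scalar_mx mul_mx_scalar.
have DE : D = invmx Hr *m H.
  by rewrite /D -[H in LHS](mulKmx U) -comm mulmxA mulmxK.
have Hrsym : Hr^T = Hr by case: regularized_psd.
have Dsym : D^T = D by rewrite {1}/D trmx_mul trmx_inv Hrsym Hpsd.1 -DE.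
have Dz (u : 'cV[R]_d) : exists z : 'cV[R]_d, [/\ u = Hr *m z & D *m u = H *m z].
  by exists (invmx Hr *m u); rewrite mulKVmx// mulmxA.
have Dpsd : psd D.
  split=> // u; have [z [uz ->]] := Dz u; rewrite {1}uz mulmxDl dotvDl mul_scalar_mx dotvZl.
  by rewrite addr_ge0 ?dotvv_ge0// mulr_ge0 ?Hpsd.2// ltW.
have [m [F FE]] := psd_factor Dpsd.
exists m, F; split => //.
  move=> u; rewrite -dotv_mulmx mulmxA -FE -subr_ge0 -dotvBr.
  have [z [uz ->]] := Dz u.
  have -> : u - H *m z = rho *: z by rewrite uz mulmxDl addrAC subrr add0r mul_scalar_mx.
  rewrite dotvZr dotvC uz.
  by apply: mulr_ge0; [exact: ltW | exact: regularized_psd.2].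
rewrite /deff -/Hr -/D FE mxtrace_mulC /mxtrace; apply: eq_bigr => j _.
by rewrite dotvE mxE; apply: eq_bigr => i _; rewrite !mxE.
Qed.
End regularized.
End posdef.

(** * Pseudoinverse and Nystrom residual *)

Section nystrom.
Context (R : realType).

(** As [mp_pinv] is defined by choice, a witness is needed: for a full-rank factorisation M = C D it
    is D^T (D D^T)^-1 (C^T C)^-1 C^T. *)
Lemma mp_pinvP (m n : nat) (M : 'M[R]_(m, n)) : is_mp_pinv M (mp_pinv M).
Proof.
suff [X MX] : exists X, is_mp_pinv M X.
  by have := xgetI (0 : 'M[R]_(n, m)) MX.
have [r [C [D [MCD [B BC] [B' DB]]]]] : exists r (C : 'M[R]_(m, r)) (D : 'M[R]_(r, n)),
    [/\ C *m D = M, exists B, B *m C = 1%:M & exists B', D *m B' = 1%:M].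
  exists (\rank M), (col_base M), (row_base M); split; first exact: mulmx_base.
  - by apply/row_fullP; exact: col_base_full.
  - by apply/row_freeP; exact: row_base_free.
subst M.
have UC : C^T *m C \in unitmx.
  apply: mulmx_inj_unitmx => v v0.
  suff : C *m v = 0 by move/(congr1 (mulmx B)); rewrite mulmxA BC mul1mx mulmx0.
  by apply: dotvv_eq0; rewrite dotv_mulmx mulmxA v0 dotv0l.
have UD : D *m D^T \in unitmx.
  apply: mulmx_inj_unitmx => v v0.
  suff : D^T *m v = 0.
    by move/(congr1 (mulmx B'^T)); rewrite mulmxA -trmx_mul DB trmx1 mul1mx mulmx0.
  by apply: dotvv_eq0; rewrite dotv_mulmx trmxK mulmxA v0 dotv0l.
exists (D^T *m invmx (D *m D^T) *m invmx (C^T *m C) *m C^T).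
have MX : C *m D *m (D^T *m invmx (D *m D^T) *m invmx (C^T *m C) *m C^T) =
    C *m invmx (C^T *m C) *m C^T.
  by rewrite !mulmxA -[C *m D *m D^T]mulmxA mulmxK.
have XM : D^T *m invmx (D *m D^T) *m invmx (C^T *m C) *m C^T *m (C *m D) =
    D^T *m invmx (D *m D^T) *m D.
  by rewrite !mulmxA -[_ *m C^T *m C]mulmxA mulmxKV.
split.
- by rewrite MX !mulmxA -[_ *m C^T *m C]mulmxA mulmxKV.
- by rewrite XM !mulmxA -[_ *m D *m D^T]mulmxA mulmxKV.
- by rewrite MX !trmx_mul trmxK trmx_inv trmx_mul trmxK mulmxA.
- by rewrite XM !trmx_mul trmxK trmx_inv trmx_mul trmxK mulmxA.
Qed.

Variables (d s : nat) (H : 'M[R]_d) (Om : 'M[R]_(d, s)).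
Hypothesis Hpsd : psd H.
Hypothesis Nsym : (nystrom H Om)^T = nystrom H Om.

Let G := Om^T *m H *m Om.
Let E := H - nystrom H Om.

(** A row b annihilating G makes the form of H vanish at [Om b], hence H Om b = 0 by
    semidefiniteness. The rows of I - G G^+ are of this kind, and [Om^T E] is (I - G G^+) Om^T H. *)
Lemma sketch_nystrom_residual : Om^T *m E = 0.
Proof.
have [GXG _ _ _] := mp_pinvP G.
have HOm : forall b : 'cV[R]_s, b^T *m G = 0 -> b^T *m Om^T *m H = 0.
  move=> b bG.
  have : H *m (Om *m b) = 0.
    apply: psd_eq0 => //; rewrite /dotv trmx_mul.
    have -> : b^T *m Om^T *m (H *m (Om *m b)) = b^T *m G *m b by rewrite /G !mulmxA.
    by rewrite bG mul0mx mxE.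
  by move/(congr1 trmx); rewrite trmx0 !trmx_mul Hpsd.1.
rewrite /E mulmxBr /nystrom trmx_mul Hpsd.1 !mulmxA -/G.
apply/row_matrixP => i; rewrite row0.
have -> : row i (Om^T *m H - G *m mp_pinv G *m Om^T *m H) =
   (row i (1%:M - G *m mp_pinv G)) *m Om^T *m H.
  by rewrite -!row_mul mulmxBl mulmxBl mul1mx.
have := HOm (row i (1%:M - G *m mp_pinv G))^T; rewrite trmxK; apply.
by rewrite -row_mul mulmxBl GXG mul1mx subrr row0.
Qed.

(** [E] is a generalised Schur complement: [e] is [a] minus its H-projection on the range of [Om],
    and the two forms agree because [Om^T E = 0]. *)
Lemma nystrom_residual_lift (a : 'cV[R]_d) :
  exists e, E *m a = H *m e /\ dotv e (H *m e) = dotv a (E *m a).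
Proof.
pose z := mp_pinv G *m (Om^T *m H *m a).
exists (a - Om *m z).
have He : E *m a = H *m (a - Om *m z).
  by rewrite /E mulmxBl mulmxBr /nystrom trmx_mul Hpsd.1 /z -/G !mulmxA.
split => //; rewrite -He dotvBl dotvC [X in _ - X]dotvC dotv_mulmx mulmxA.
by rewrite sketch_nystrom_residual mul0mx dotv0l subr0 dotvC.
Qed.
End nystrom.

(** * Conditioning of the preconditioned system *)

Section preconditioner.
Context (R : realType) (d s : nat) (H : 'M[R]_d) (Om : 'M[R]_(d, s)).
Context (U : 'M[R]_(d, s)) (lam : 'rV[R]_s) (rho : R).
Hypotheses (Hpsd : psd H) (rho0 : 0 < rho) (Neig : nystrom_eig H Om U lam).
Hypothesis s0 : (0 < s)%N.

Let Hh := nystrom H Om.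
Let E := H - Hh.
Let Hr := H + rho%:M.
Let l := lam_last lam.

Let UU : U^T *m U = 1%:M. Proof. by case: Neig. Qed.

Let HhE : Hh = U *m diag_mx lam *m U^T. Proof. by case: Neig. Qed.

Let Hhsym : Hh^T = Hh.
Proof. by rewrite HhE !trmx_mul trmxK tr_diag_mx mulmxA. Qed.

Let Esym : E^T = E. Proof. by rewrite linearB /= Hpsd.1 Hhsym. Qed.

Lemma nystrom_residual_psd : psd E.
Proof.
split=> // v; have [e [_ <-]] := nystrom_residual_lift Om Hpsd v; exact: Hpsd.2.
Qed.

Let Hh_le (x : 'cV[R]_d) : dotv x (Hh *m x) <= dotv x (H *m x).
Proof.
rewrite -subr_ge0 -dotvBr -mulmxBl; exact: nystrom_residual_psd.2.
Qed.

Let HhEdiag (x : 'cV[R]_d) :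
  dotv x (Hh *m x) = \sum_i lam 0 i * (U^T *m x) i 0 ^+ 2.
Proof.
rewrite HhE -mulmxA dotv_mulmx trmx_mul tr_diag_mx -mulmxA dotvE.
apply: eq_bigr => i _; rewrite mul_diag_mx mxE expr2 mulrA; congr (_ * _).
Qed.

(** The eigenvalue is the form of the Nystrom matrix at a column of [U], which equals the form of
    [H] at [Om z]. *)
Let lam_ge0 i : 0 <= lam 0 i.
Proof.
pose u := col i U.
have Uu : U^T *m u = delta_mx i 0 by rewrite /u colE mulmxA UU mul1mx.
have -> : lam 0 i = dotv u (Hh *m u).
  rewrite HhEdiag Uu (bigD1 i)//= big1 => [|j ji]; first by rewrite mxE !eqxx expr1n mulr1 addr0.
  by rewrite mxE (negbTE ji) expr0n mulr0.
pose G := Om^T *m H *m Om.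
have [GXG _ _ _] := mp_pinvP G.
pose z := mp_pinv G *m (Om^T *m H *m u).
have Hz : Hh *m u = H *m (Om *m z).
  by rewrite /Hh /nystrom trmx_mul Hpsd.1 /z -/G !mulmxA.
have OmH : Om^T *m (H *m u) = Om^T *m (Hh *m u).
  apply/eqP; rewrite -subr_eq0 -mulmxBr -mulmxBl mulmxA.
  by rewrite sketch_nystrom_residual// mul0mx.
have -> : dotv u (Hh *m u) = dotv (Om *m z) (H *m (Om *m z)); last exact: Hpsd.2.
rewrite -Hz dotvC -dotvC {1}Hz dotv_mulmx Hpsd.1 dotvC dotvC dotv_mulmx.
by rewrite OmH -dotv_mulmx dotvC.
Qed.

Let lam_last_le i : l <= lam 0 i.
Proof.
have [_ _ mono] := Neig.
have sE : (s.-1 < s)%N by rewrite prednK.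
have -> : l = lam 0 (Ordinal sE).
  rewrite /l /lam_last (nth_map (Ordinal sE)) ?size_enum_ord//.
  by congr (lam 0 _); apply/val_inj; rewrite /= nth_enum_ord.
by apply: mono; rewrite /= -ltnS prednK.
Qed.

Let l_ge0 : 0 <= l.
Proof.
have sE : (s.-1 < s)%N by rewrite prednK.
have -> : l = lam 0 (Ordinal sE).
  rewrite /l /lam_last (nth_map (Ordinal sE)) ?size_enum_ord//.
  by congr (lam 0 _); apply/val_inj; rewrite /= nth_enum_ord.
exact: lam_ge0.
Qed.

Let lU_le (x : 'cV[R]_d) : l * dotv (U^T *m x) (U^T *m x) <= dotv x (Hh *m x).
Proof.
rewrite HhEdiag dotvE mulr_sumr; apply: ler_sum => i _.
by rewrite -expr2 ler_wpM2r ?sqr_ge0.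
Qed.

Let perp (x y : 'cV[R]_d) :
  dotv (x - U *m (U^T *m x)) (y - U *m (U^T *m y)) = dotv x y - dotv (U^T *m x) (U^T *m y).
Proof.
have a1 u v : dotv u (U *m v) = dotv (U^T *m u) v by exact: dotv_mulmx.
have a2 : dotv (U *m (U^T *m x)) y = dotv (U^T *m x) (U^T *m y).
  by rewrite dotvC a1 dotvC.
rewrite !dotvBl !dotvBr !a1 a2 mulmxA UU mul1mx; ring.
Qed.

Let perp_ge0 x : dotv (U^T *m x) (U^T *m x) <= dotv x x.
Proof. by rewrite -subr_ge0 -perp dotvv_ge0. Qed.

(** H dominates l U U^T, so the inverse is at most 1 / (l + rho) on the range of U and 1 / rho on
    its complement. The proof writes the left side as 2 <a, z> - <z, Hr z> and completes a square in
    each component. *)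
Let inv_le (a : 'cV[R]_d) : dotv a (invmx Hr *m a) <=
  (dotv a a - dotv (U^T *m a) (U^T *m a)) / rho + dotv (U^T *m a) (U^T *m a) / (l + rho).
Proof.
have Hu := regularized_unit Hpsd rho0.
set z := invmx Hr *m a.
have az : a = Hr *m z by rewrite /z mulKVmx.
have azz : dotv a z = dotv z (H *m z) + rho * dotv z z.
  by rewrite dotvC {1}az regularized_quad.
have h1 : l * dotv (U^T *m z) (U^T *m z) <= dotv z (H *m z) := le_trans (lU_le z) (Hh_le z).
have lr0 : 0 < l + rho by rewrite ltr_wpDl.
pose a' := a - U *m (U^T *m a); pose z' := z - U *m (U^T *m z).
have e1 : dotv a z = dotv a' z' + dotv (U^T *m a) (U^T *m z) by rewrite perp subrK.
have e2 : dotv z z = dotv z' z' + dotv (U^T *m z) (U^T *m z) by rewrite perp subrK.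
have e3 : dotv a a - dotv (U^T *m a) (U^T *m a) = dotv a' a' by rewrite perp.
rewrite e3; clear e3; clearbody a' z'.
move: h1 e1 e2; move: (U^T *m a) (U^T *m z) => c b h1 e1 e2.
have g1 : 2 * dotv a' z' - rho * dotv z' z' <= dotv a' a' / rho.
  rewrite ler_pdivlMr// -subr_ge0.
  have -> : dotv a' a' - (2 * dotv a' z' - rho * dotv z' z') * rho =
     dotv (a' - rho *: z') (a' - rho *: z').
    by rewrite !dotvBl !dotvBr !dotvZl !dotvZr (dotvC z' a'); ring.
  exact: dotvv_ge0.
have g2 : 2 * dotv c b - (l + rho) * dotv b b <= dotv c c / (l + rho).
  rewrite ler_pdivlMr// -subr_ge0.
  have -> : dotv c c - (2 * dotv c b - (l + rho) * dotv b b) * (l + rho) =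
     dotv (c - (l + rho) *: b) (c - (l + rho) *: b).
    by rewrite !dotvBl !dotvBr !dotvZl !dotvZr (dotvC b c); ring.
  exact: dotvv_ge0.
by rewrite e2 in azz; lra.
Qed.

(** The trace is written as a sum of 1 - rho <e_i, Hr^-1 e_i>, each bounded by [inv_le]; the traces
    of the projections add up to s. *)
Lemma deff_ge : s%:R * (l / (l + rho)) <= deff H rho.
Proof.
have Hu := regularized_unit Hpsd rho0.
have lr0 : 0 < l + rho by rewrite ltr_wpDl.
have diagE (N : 'M[R]_d) i : dotv (delta_mx i 0) (N *m delta_mx i 0) = N i i.
  rewrite -colE dotvE (bigD1 i)//= !mxE !eqxx mul1r big1 ?addr0// => j ji.
  by rewrite !mxE (negbTE ji) mul0r.
have -> : deff H rho = \sum_i (1 - rho * dotv (delta_mx i 0) (invmx Hr *m delta_mx i 0)).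
  rewrite /deff -/Hr.
  have -> : H = Hr - rho%:M by rewrite addrK.
  rewrite mulmxBl mulmxV// mul_scalar_mx /mxtrace; apply: eq_bigr => i _.
  by rewrite diagE !mxE eqxx.
have trU : \sum_i dotv (U^T *m delta_mx i 0) (U^T *m delta_mx i 0) = s%:R.
  rewrite -[RHS](mxtrace1 R) -UU mxtrace_mulC /mxtrace; apply: eq_bigr => i _.
  by rewrite -dotv_mulmx mulmxA diagE.
rewrite -trU mulr_suml; apply: ler_sum => i _.
have := inv_le (delta_mx i 0).
have -> : dotv (delta_mx i 0) (delta_mx i 0 : 'cV[R]_d) = 1.
  by rewrite -[X in dotv _ X]mul1mx diagE mxE eqxx.
set z := dotv _ (invmx _ *m _); set u := dotv _ _ => h.
have : rho * z <= rho * ((1 - u) / rho + u / (l + rho)) by apply: ler_wpM2l => //; exact: ltW.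
have -> : rho * ((1 - u) / rho + u / (l + rho)) = 1 - u * (l / (l + rho)).
  by field; rewrite !gt_eqF.
by lra.
Qed.

Hypothesis deff8 : 8 * deff H rho <= s%:R.

Let l7 : 7 * l <= rho.
Proof.
have lr0 : 0 < l + rho by rewrite ltr_wpDl.
have sp : 0 < s%:R :> R by rewrite ltr0n.
have : 8 * (s%:R * (l / (l + rho))) <= s%:R * 1.
  by rewrite mulr1; apply: le_trans deff8; rewrite ler_wpM2l// deff_ge.
rewrite mulrCA ler_pM2l// mulrA ler_pdivrMr//; lra.
Qed.

Hypothesis residual_le : forall a : 'cV[R]_d, dotv a (E *m a) <= 11 * rho * dotv a a.

Let Pc := nys_precond rho U lam.

(** In matrix form, (l + rho) P = H<Om> + rho I + l (I - U U^T), which is directly comparable with H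
    + rho I. *)
Let PcE (x : 'cV[R]_d) : (l + rho) * dotv x (Pc *m x) =
  dotv x (Hh *m x) + rho * dotv x x + l * (dotv x x - dotv (U^T *m x) (U^T *m x)).
Proof.
have lr0 : 0 < l + rho by rewrite ltr_wpDl.
rewrite /Pc /nys_precond mulmxDl mulmxBl mul1mx dotvDr dotvBr -scalemxAl dotvZr.
rewrite mulmxDr mulmxDl -HhE mul_mx_scalar mulmxDl dotvDr -scalemxAl -scalemxAl dotvZr.
rewrite -[U *m U^T *m x]mulmxA [dotv x (U *m _)]dotv_mulmx.
by rewrite -/l; field; rewrite gt_eqF.
Qed.

Lemma nys_precond_psd : psd Pc.
Proof.
have lr0 : 0 < l + rho by rewrite ltr_wpDl.
split=> [|x].
  rewrite /Pc /nys_precond linearD /= linearZ /= linearB /= trmx1 !trmx_mul trmxK.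
  by rewrite linearD /= tr_diag_mx tr_scalar_mx mulmxA.
rewrite -(pmulr_rge0 _ lr0) PcE !addr_ge0 ?mulr_ge0 ?subr_ge0 ?perp_ge0 ?dotvv_ge0//;
  last exact: ltW.
by apply: le_trans (lU_le x); rewrite mulr_ge0 ?dotvv_ge0.
Qed.

Lemma nys_precond_unit : Pc \in unitmx.
Proof.
have lr0 : 0 < l + rho by rewrite ltr_wpDl.
apply: mulmx_inj_unitmx => x x0; apply: dotvv_eq0.
have := PcE x; rewrite x0 dotv0r mulr0 => h.
have h1 : 0 <= dotv x (Hh *m x).
  by apply: le_trans (lU_le x); rewrite mulr_ge0 ?dotvv_ge0.
have h2 : 0 <= l * (dotv x x - dotv (U^T *m x) (U^T *m x)).
  by rewrite mulr_ge0// subr_ge0.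
have h3 := dotvv_ge0 x; apply/eqP; rewrite eq_le h3 andbT.
by rewrite -(pmulr_rle0 _ rho0); lra.
Qed.

Lemma nys_precond_bounds : exists2 al, 0 < al & forall x : 'cV[R]_d,
  al * dotv x (Pc *m x) <= dotv x (Hr *m x) <= 16 * al * dotv x (Pc *m x).
Proof.
have lr0 : 0 < l + rho by rewrite ltr_wpDl.
(* Since l <= rho / 7, the form in [PcE] is at most H<Om> + 8/7 rho I, whence the factor 7/8. Above,
   H + rho I <= H<Om> + 12 rho I fits below 14 = 16 * 7/8 times it. *)
exists (7 / 8 * (l + rho)); first by rewrite mulr_gt0.
move=> x; rewrite regularized_quad; have PE := PcE x; set pq := dotv x (Pc *m x) in PE *.
have -> : 7 / 8 * (l + rho) * pq = 7 / 8 * ((l + rho) * pq) by ring.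
have -> : 16 * (7 / 8 * (l + rho)) * pq = 14 * ((l + rho) * pq) by field.
rewrite PE.
have xx0 := dotvv_ge0 x.
have U0 := dotvv_ge0 (U^T *m x).
have h1 := residual_le x; have h2 := Hh_le x.
have h3 : 0 <= l * (dotv x x - dotv (U^T *m x) (U^T *m x)).
  by rewrite mulr_ge0// subr_ge0.
have h4 : l * (dotv x x - dotv (U^T *m x) (U^T *m x)) <= rho / 7 * dotv x x.
  apply: (@le_trans _ _ (l * dotv x x)); first by rewrite ler_wpM2l// lerBlDr lerDl.
  by rewrite ler_wpM2r//; have := l7; lra.
have h5 : 0 <= rho * dotv x x by rewrite mulr_ge0// ltW.
have h6 : 0 <= dotv x (Hh *m x).
  by apply: le_trans (lU_le x); rewrite mulr_ge0 ?dotvv_ge0.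
rewrite /E mulmxBl dotvBr in h1.
by apply/andP; split; lra.
Qed.

End preconditioner.

(** With E a = H e, the vector v = F^T (H + rho I) e satisfies F v = E a and |v|^2 = |E a|^2 + rho
    <a, E a>. The ratio 11/12 becomes |E a|^2 <= 11 rho <a, E a>, and Cauchy-Schwarz concludes. *)
Lemma residual_le_of_sketch (R : realType) (d s m : nat) (H : 'M[R]_d)
    (Om : 'M[R]_(d, s)) (F : 'M[R]_(d, m)) (rho : R) :
  psd H -> 0 < rho -> psd (H - nystrom H Om) ->
  H *m invmx (H + rho%:M) = F *m F^T ->
  (forall v : 'cV[R]_m, Om^T *m (F *m v) = 0 ->
     12 * dotv (F *m v) (F *m v) <= 11 * dotv v v) ->
  forall a : 'cV[R]_d, dotv a ((H - nystrom H Om) *m a) <= 11 * rho * dotv a a.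
Proof.
move=> Hpsd rho0 Epsd FE good a; set E := H - _ in Epsd *.
have Hu := regularized_unit Hpsd rho0; set Hr := H + _ in Hu FE.
have [e [Ea eE]] := nystrom_residual_lift Om Hpsd a; rewrite -/E in Ea eE.
pose v := F^T *m (Hr *m e).
have Fv : F *m v = E *m a.
  by rewrite /v mulmxA -FE mulmxA mulmxKV// Ea.
have vv : dotv v v = dotv (E *m a) (E *m a) + rho * dotv a (E *m a).
  rewrite {1}/v -dotv_mulmx Fv {1}/Hr mulmxDl dotvDl mul_scalar_mx dotvZl -Ea.
  by congr (_ + rho * _); rewrite -eE Ea.
have h := good v; rewrite Fv vv in h.
have {}h : dotv (E *m a) (E *m a) <= 11 * rho * dotv a (E *m a).
  have := h; rewrite mulmxA sketch_nystrom_residual// mul0mx => /(_ erefl); lra.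
have := Epsd.2 a; rewrite le_eqVlt => /predU1P[<-|aE0].
  by rewrite mulr_ge0 ?mulr_ge0 ?dotvv_ge0// ltW.
have := dotv_CS a (E *m a) => CS.
have : dotv a (E *m a) ^+ 2 <= dotv a a * (11 * rho * dotv a (E *m a)).
  by apply: (le_trans CS); rewrite ler_wpM2l// dotvv_ge0.
by rewrite expr2 mulrA ler_pM2r// mulrC.
Qed.

(** * Chebyshev bound for preconditioned conjugate gradients *)

Section pcg.
Context (R : realType) (d : nat) (M P : 'M[R]_d) (al : R) (xs : 'cV[R]_d).
Hypotheses (Mpsd : psd M) (Mdef : forall v : 'cV[R]_d, dotv v (M *m v) = 0 -> v = 0).
Hypotheses (Ppsd : psd P) (Punit : P \in unitmx) (al0 : 0 < al).
Hypothesis PM : forall x : 'cV[R]_d,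
  al * dotv x (P *m x) <= dotv x (M *m x) <= 16 * al * dotv x (P *m x).

Let c := M *m xs.
Let Pi := invmx P.
Let S := Pi *m M.
Let ip (x y : 'cV[R]_d) := dotv x (M *m y).

Let ipC x y : ip x y = ip y x.
Proof. by rewrite /ip dotv_mulmx Mpsd.1 dotvC. Qed.
Let ipDl x y z : ip (x + y) z = ip x z + ip y z. Proof. exact: dotvDl. Qed.
Let ipBl x y z : ip (x - y) z = ip x z - ip y z. Proof. exact: dotvBl. Qed.
Let ipZl a x z : ip (a *: x) z = a * ip x z. Proof. exact: dotvZl. Qed.
Let ipDr x y z : ip z (x + y) = ip z x + ip z y. Proof. by rewrite !(ipC z) ipDl. Qed.
Let ipBr x y z : ip z (x - y) = ip z x - ip z y. Proof. by rewrite !(ipC z) ipBl. Qed.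
Let ipZr a x z : ip z (a *: x) = a * ip z x. Proof. by rewrite !(ipC z) ipZl. Qed.
Let ip0r z : ip z 0 = 0. Proof. by rewrite /ip mulmx0 dotv0r. Qed.
Let ip_ge0 x : 0 <= ip x x. Proof. exact: Mpsd.2. Qed.

Let Pisym : Pi^T = Pi. Proof. by rewrite trmx_inv Ppsd.1. Qed.

Let ipS x y : ip (S *m x) y = ip x (S *m y).
Proof.
by rewrite /ip /S -!mulmxA [RHS]dotv_mulmx Mpsd.1 [RHS]dotv_mulmx Pisym.
Qed.

(** The comparison of P and M is transferred to [S], self-adjoint for [ip], by Cauchy-Schwarz in P
    for the lower bound and in M for the upper one. *)
Let ipS_bounds x : al * ip x x <= ip x (S *m x) <= 16 * al * ip x x.
Proof.
pose y := S *m x.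
have Py : P *m y = M *m x by rewrite /y /S mulmxA mulKVmx.
have q1 : ip x y = dotv y (P *m y) by rewrite ipC /ip Py.
have m1 : ip x x = dotv x (P *m y) by rewrite Py.
have CS1 := psd_CS x y Ppsd; have CS2 := psd_CS y x Mpsd.
rewrite -m1 -q1 in CS1; rewrite -/(ip y x) ipC -/(ip y y) -/(ip x x) in CS2.
have /andP[a1 a2] := PM x; have /andP[b1 b2] := PM y.
rewrite -/(ip x x) in a1 a2; rewrite -/(ip y y) -q1 in b1 b2.
have q0 : 0 <= ip x y by rewrite q1 Ppsd.2.
have m0 := ip_ge0 x.
apply/andP; split.
  move: m0; rewrite le_eqVlt => /predU1P[<-|m0]; first by rewrite mulr0.
  rewrite -(ler_pM2r m0); apply: (@le_trans _ _ (al * (dotv x (P *m x) * ip x y))).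
    by rewrite -mulrA ler_pM2l// -expr2.
  by rewrite mulrA [leRHS]mulrC ler_wpM2r.
move: q0; rewrite le_eqVlt => /predU1P[<-|q0]; first by rewrite !mulr_ge0// ltW.
rewrite -(ler_pM2r q0) -expr2 (le_trans CS2)// mulrAC.
by rewrite [leRHS]mulrC [leLHS]mulrC ler_wpM2l.
Qed.

(* The affine image of [S] that carries the spectral interval [[al, 16 al]]
   to [[-1, 1]] and [0] to [17 / 15]. *)
Let b := 2 / (15 * al).
Let cheb (x : 'cV[R]_d) := (17 / 15) *: x - b *: (S *m x).

Let cheb_adj x y : ip (cheb x) y = ip x (cheb y).
Proof. by rewrite /cheb ipBl ipBr !ipZl !ipZr ipS. Qed.

(** The gap factors as <u - cheb u, u + cheb u> = b^2 <g, h> with g = (S - al) u and h = (16 al - S)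
    u. Identity [e1] writes 15 al <g, h> as a sum of two forms that [ipS_bounds] makes
    nonnegative. *)
Let cheb_contract u : ip (cheb u) (cheb u) <= ip u u.
Proof.
pose g := S *m u - al *: u; pose h := (16 * al) *: u - S *m u.
have gh : (16 * al) *: g - S *m g = S *m h - al *: h.
  rewrite /g /h !mulmxBr -!scalemxAr; move: (S *m (S *m u)) (S *m u) => s2 s1.
  by apply/matrixP => i j; rewrite !mxE; ring.
have e1 : 15 * al * ip g h = (16 * al * ip g g - ip g (S *m g)) + (ip h (S *m h) - al * ip h h).
  have : ip g ((16 * al) *: g - S *m g) = ip g (S *m h - al *: h) by rewrite gh.
  have : ip h ((16 * al) *: g - S *m g) = ip h (S *m h - al *: h) by rewrite gh.
  move: (g) (h) => g' h'.
  rewrite !ipBr !ipZr (ipC h' g') -(ipS g' h') (ipC (S *m g') h'); lra.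
have gh0 : 0 <= ip g h.
  have /andP[_ g2] := ipS_bounds g; have /andP[h1 _] := ipS_bounds h.
  have a15 : 0 < 15 * al by rewrite mulr_gt0.
  rewrite -(pmulr_rge0 _ a15) e1; lra.
have bal : b * al = 2 / 15 by rewrite /b; field; rewrite gt_eqF.
have u1 : u - cheb u = b *: g.
  rewrite /cheb /g scalerBr scalerA bal; move: (S *m u) => s1.
  by apply/matrixP => i j; rewrite !mxE; field.
have u2 : u + cheb u = b *: h.
  rewrite /cheb /h scalerBr scalerA mulrCA bal; move: (S *m u) => s1.
  by apply/matrixP => i j; rewrite !mxE; field.
have : ip (u - cheb u) (u + cheb u) = b ^+ 2 * ip g h.
  by rewrite u1 u2 ipZl ipZr mulrA -expr2.
have -> : forall y, ip (u - y) (u + y) = ip u u - ip y y.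
  by move=> y; rewrite ipBl !ipDr (ipC y u); ring.
move=> e2; rewrite -subr_ge0 e2 mulr_ge0// sqr_ge0//.
Qed.

Let cheb_step (tu : 'cV[R]_d * 'cV[R]_d) :=
  (cheb tu.1 - (tu.2 - cheb (cheb tu.2)), cheb tu.2 + tu.1).

(* [(tu n).1] is [T_n(cheb) xs] and [(tu n).2] is [U_(n-1)(cheb) xs], for the
   Chebyshev polynomials of the first and second kind. *)
Let tu n := iter n cheb_step (xs, 0).

(** Operator form of T_n^2 + (1 - x^2) U_(n-1)^2 = 1: self-adjointness of [cheb] makes the quantity
    invariant along the recursion. *)
Let pell p : ip (cheb_step p).1 (cheb_step p).1 + ip (cheb_step p).2 (cheb_step p).2
    - ip (cheb (cheb_step p).2) (cheb (cheb_step p).2) =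
  ip p.1 p.1 + ip p.2 p.2 - ip (cheb p.2) (cheb p.2).
Proof.
case: p => t u /=.
have -> : cheb (cheb u + t) = cheb (cheb u) + cheb t.
  by rewrite /cheb mulmxDr !scalerDr opprD addrACA.
have e1 : ip (cheb t) u = ip t (cheb u) by exact: cheb_adj.
have e2 : ip u (cheb (cheb u)) = ip (cheb u) (cheb u) by rewrite cheb_adj.
have gen u1 u2 t1 : ip t1 u = ip t u1 -> ip u u2 = ip u1 u1 ->
   ip (t1 - (u - u2)) (t1 - (u - u2)) + ip (u1 + t) (u1 + t) - ip (u2 + t1) (u2 + t1) =
   ip t t + ip u u - ip u1 u1.
  move=> {}e1 {}e2.
  rewrite !ipBl !ipBr !ipDl !ipDr (ipC u2 t1) (ipC u t1) (ipC u2 u) (ipC u1 t) e1 e2.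
  by ring.
exact: gen.
Qed.

Let tu_norm n : ip (tu n).1 (tu n).1 <= ip xs xs.
Proof.
have h : ip (tu n).1 (tu n).1 + ip (tu n).2 (tu n).2
    - ip (cheb (tu n).2) (cheb (tu n).2) = ip xs xs.
  elim: n => [|n IH]; last by rewrite /tu iterS -/(tu n) pell.
  by rewrite /tu /= /cheb mulmx0 !scaler0 subr0 !ip0r subr0 addr0.
have := cheb_contract (tu n).2; lra.
Qed.

(* [17 / 15 = (zeta + zeta^-1) / 2], so [tau n] and [ups n] are the values of
   [T_n] and [U_(n-1)] at [17 / 15]. *)
Let zeta : R := 5 / 3.
Let tau n := (zeta ^+ n + zeta ^- n) / 2.
Let ups n := 15 / 16 * (zeta ^+ n - zeta ^- n).

Let zetaV n : zeta ^- n.+1 = 3 / 5 * zeta ^- n.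
Proof. by rewrite -!exprVn exprS /zeta invf_div. Qed.

Let tauS n : tau n.+1 = 17 / 15 * tau n + 64 / 225 * ups n.
Proof.
rewrite /tau /ups zetaV exprS; move: (zeta ^+ n) (zeta ^- n) => A B.
by rewrite /zeta; field.
Qed.

Let upsS n : ups n.+1 = 17 / 15 * ups n + tau n.
Proof.
rewrite /tau /ups zetaV exprS; move: (zeta ^+ n) (zeta ^- n) => A B.
by rewrite /zeta; field.
Qed.

Let st n := iter n (pcg_step M Pi) (0, c, Pi *m c, Pi *m c).
Let X n := (st n).1.1.1.
Let r n := (st n).1.1.2.
Let z n := (st n).1.2.
Let p n := (st n).2.
Let alpha n := dotv (r n) (z n) / dotv (p n) (M *m p n).
Let beta n := dotv (r n.+1) (z n.+1) / dotv (r n) (z n).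

Let XS n : X n.+1 = X n + alpha n *: p n.
Proof. by rewrite /X /alpha /r /z /p /st iterS -/(st n); case: (st n) => [[[? ?] ?] ?]. Qed.
Let rS n : r n.+1 = r n - alpha n *: (M *m p n).
Proof. by rewrite /alpha /r /z /p /st iterS -/(st n); case: (st n) => [[[? ?] ?] ?]. Qed.
Let zS n : z n = Pi *m r n.
Proof. by case: n => // n; rewrite /r /z /st iterS -/(st n); case: (st n) => [[[? ?] ?] ?]. Qed.
Let pS n : p n.+1 = z n.+1 + beta n *: p n.
Proof. by rewrite /beta /r /z /p /st iterS -/(st n); case: (st n) => [[[? ?] ?] ?]. Qed.

Let rE n : r n = M *m (xs - X n).
Proof.
elim: n => [|n IH]; first by rewrite /r /X /= subr0.
by rewrite rS XS IH opprD addrA [in RHS]mulmxBr -scalemxAr.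
Qed.

Let rz_gt0 n : r n != 0 -> 0 < dotv (r n) (z n).
Proof.
move=> rn.
have Pz : P *m z n = r n by rewrite zS mulKVmx.
have e : dotv (r n) (z n) = dotv (z n) (P *m z n) by rewrite dotvC Pz.
rewrite lt_def e Ppsd.2 andbT; apply: contraNneq rn => z0.
by rewrite -Pz (psd_eq0 Ppsd z0).
Qed.

(** The clauses feed one another, hence the joint induction; [alpha k != 0] allows [M p k] to be
    recovered from two consecutive residuals. *)
Let invariants n : (forall i, (i < n)%N -> r i != 0) ->
  [/\ forall k i, (i < k <= n)%N -> dotv (r k) (p i) = 0,
      forall k i, (i < k <= n)%N -> ip (p i) (p k) = 0,
      forall k, (k <= n)%N -> dotv (r k) (p k) = dotv (r k) (z k) &
      forall k, (k < n)%N -> alpha k != 0].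
Proof.
elim: n => [_|n IH rn].
  split=> [k i /andP[]|k i /andP[]|k|//].
  - by case: k.
  - by case: k.
  - by case: k.
have [i|I1 I2 I3 I4] := IH; first by move=> ni; apply: rn; rewrite ltnW.
have rz := rz_gt0 (rn n (ltnSn n)).
have pMp : 0 < dotv (p n) (M *m p n).
  rewrite lt_def Mpsd.2 andbT; apply: contraTneq rz => /Mdef pn0.
  by rewrite -(I3 n)// pn0 dotv0r ltxx.
have an : alpha n != 0 by rewrite mulf_neq0 ?invr_neq0 ?gt_eqF.
have aE : alpha n * dotv (p n) (M *m p n) = dotv (r n) (z n).
  by rewrite /alpha divfK// gt_eqF.
have J1 i : (i <= n)%N -> dotv (r n.+1) (p i) = 0.
  rewrite rS dotvBl dotvZl (dotvC (M *m _)) -/(ip (p i) (p n)) leq_eqVlt.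
  move=> /predU1P[->|ni]; first by rewrite I3// /ip aE subrr.
  by rewrite I1 ?ni ?leqnn// I2 ?ni ?leqnn// mulr0 subr0.
have J3 : dotv (r n.+1) (p n.+1) = dotv (r n.+1) (z n.+1).
  by rewrite pS dotvDr dotvZr J1// mulr0 addr0.
have Jz j : (j <= n)%N -> dotv (r n.+1) (z j) = 0.
  case: j => [|j] jn; first exact: (J1 0%N).
  have -> : z j.+1 = p j.+1 - beta j *: p j by rewrite pS addrK.
  by rewrite dotvBr dotvZr !J1 ?mulr0 ?subr0// ltnW.
have zr j : (j <= n)%N -> dotv (z n.+1) (r j) = 0.
  move=> jn; have -> : dotv (z n.+1) (r j) = dotv (r n.+1) (z j); last exact: Jz.
  by rewrite [z n.+1]zS [z j]zS dotv_mulmx Pisym dotvC.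
have Mp i : alpha i != 0 -> M *m p i = (alpha i)^-1 *: (r i - r i.+1).
  by move=> ai; rewrite rS opprB addrC subrK scalerA mulVf// scale1r.
have J2 i : (i <= n)%N -> ip (p i) (p n.+1) = 0.
  rewrite pS ipDr ipZr leq_eqVlt => /predU1P[->|ni].
    rewrite ipC /ip Mp// dotvZr dotvBr zr// sub0r -Mp//.
    rewrite (dotvC (z _)) /beta -aE; field.
    by rewrite an gt_eqF.
  rewrite I2 ?ni ?leqnn// mulr0 addr0 ipC /ip Mp ?I4// dotvZr dotvBr !zr ?subr0 ?mulr0//.
  exact: ltnW.
split.
- move=> k i /andP[ik]; rewrite leq_eqVlt => /predU1P[kn|kn].
    by move: ik; rewrite kn ltnS => /J1.
  by apply: I1; rewrite ik -ltnS.
- move=> k i /andP[ik]; rewrite leq_eqVlt => /predU1P[kn|kn].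
    by move: ik; rewrite kn ltnS => /J2.
  by apply: I2; rewrite ik -ltnS.
- by move=> k; rewrite leq_eqVlt => /predU1P[->//|kn]; apply: I3; rewrite -ltnS.
- by move=> k; rewrite ltnS leq_eqVlt => /predU1P[->//|]; exact: I4.
Qed.

(* [y] lies in the span of the first [k] search directions, expressed by
   double orthogonality. *)
Let inV k y := forall e, (forall i, (i < k)%N -> ip e (p i) = 0) -> ip e y = 0.

Let inV0 k : inV k 0. Proof. by move=> e _; rewrite ip0r. Qed.
Let inVD k y y' : inV k y -> inV k y' -> inV k (y + y').
Proof. by move=> h h' e he; rewrite ipDr h// h'// addr0. Qed.
Let inVZ k a y : inV k y -> inV k (a *: y).
Proof. by move=> h e he; rewrite ipZr h// mulr0. Qed.
Let inVB k y y' : inV k y -> inV k y' -> inV k (y - y').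
Proof. by move=> h h' e he; rewrite ipBr h// h'// subr0. Qed.
Let inV_le k k' y : (k <= k')%N -> inV k y -> inV k' y.
Proof. by move=> kk h e he; apply: h => i ik; apply: he; exact: leq_trans kk. Qed.
Let inVp k i : (i < k)%N -> inV k (p i).
Proof. by move=> ik e; apply. Qed.
Let inVz k i : (i < k)%N -> inV k (z i).
Proof.
case: i => [|i] ik; first exact: (inVp (i := 0%N)).
have -> : z i.+1 = p i.+1 - beta i *: p i by rewrite pS addrK.
by apply: inVB; [exact: inVp | apply: inVZ; apply: inVp; exact: ltnW].
Qed.

Let inVX k : inV k (X k).
Proof.
elim: k => [|k IH]; first exact: inV0.
by rewrite XS; apply: inVD; [exact: inV_le IH | apply: inVZ; exact: inVp].
Qed.

Let inVS k y : (forall i, (i < k)%N -> alpha i != 0) -> inV k y -> inV k.+1 (S *m y).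
Proof.
move=> ak h e he; rewrite -ipS; apply: h => i ik; rewrite ipS.
have -> : S *m p i = (alpha i)^-1 *: (z i - z i.+1).
  rewrite !zS -mulmxBr scalemxAr rS opprB addrC subrK scalerA mulVf ?ak// scale1r.
  by rewrite /S mulmxA.
by apply: inVZ he; apply: inVB; apply: inVz; rewrite ltnS// ltnW.
Qed.

Let inVcheb k a y : (forall i, (i < k)%N -> alpha i != 0) ->
  inV k (a *: xs - y) -> inV k.+1 ((17 / 15 * a) *: xs - cheb y).
Proof.
move=> ak h.
have -> : (17 / 15 * a) *: xs - cheb y =
   (17 / 15) *: (a *: xs - y) + b *: (a *: (S *m xs) - S *m (a *: xs - y)).
  rewrite /cheb mulmxBr -scalemxAr; move: (S *m xs) (S *m y) => s1 s2.
  by apply/matrixP => i j; rewrite !mxE; ring.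
apply: inVD; first by apply: inVZ; exact: inV_le h.
apply: inVZ; apply: inVB; last exact: inVS.
apply: inVZ; have -> : S *m xs = p 0%N by rewrite /p /st /= /c mulmxA.
exact: inVp.
Qed.

(** At S = 0, [cheb] is 17/15, so T_n(17/15) - T_n(cheb) is divisible by S and its value at [xs]
    uses only S xs, S^2 xs and so on, which lie in the search space. The second-kind polynomial has
    one degree less, hence the smaller space. *)
Let inVtu k : (forall i, (i < k)%N -> alpha i != 0) ->
  inV k.+1 (tau k.+1 *: xs - (tu k.+1).1) /\ inV k (ups k.+1 *: xs - (tu k.+1).2).
Proof.
elim: k => [_|k IH ak].
  have t1 : tau 1 = 17 / 15 * 1 by rewrite /tau /zeta; field.
  have u1 : ups 1 = 1 by rewrite /ups /zeta; field.
  rewrite t1 u1 /tu /=.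
  have -> : cheb 0 = 0 by rewrite /cheb mulmx0 !scaler0 subr0.
  have -> : cheb 0 = 0 by rewrite /cheb mulmx0 !scaler0 subr0.
  rewrite subr0 subr0 add0r scale1r subrr; split; last exact: inV0.
  by apply: inVcheb => //; rewrite scale1r subrr; exact: inV0.
have ak' i : (i < k)%N -> alpha i != 0 by move=> ik; apply: ak; exact: ltnW.
have [h1 h2] := IH ak'.
have g1 := inVcheb ak h1.
have g2 := inVcheb ak' h2; have g3 := inVcheb ak g2.
rewrite [tu k.+2]/tu iterS -/(tu k.+1) /= upsS tauS; split; last first.
  have -> : (17 / 15 * ups k.+1 + tau k.+1) *: xs - (cheb (tu k.+1).2 + (tu k.+1).1) =
     ((17 / 15 * ups k.+1) *: xs - cheb (tu k.+1).2) + (tau k.+1 *: xs - (tu k.+1).1).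
    by rewrite scalerDl opprD addrACA.
  exact: inVD.
have -> : (17 / 15 * tau k.+1 + 64 / 225 * ups k.+1) *: xs -
    (cheb (tu k.+1).1 - ((tu k.+1).2 - cheb (cheb (tu k.+1).2))) =
  ((17 / 15 * tau k.+1) *: xs - cheb (tu k.+1).1) +
  (((17 / 15 * (17 / 15 * ups k.+1)) *: xs - cheb (cheb (tu k.+1).2)) -
   (ups k.+1 *: xs - (tu k.+1).2)).
  move: (cheb (cheb (tu k.+1).2)) (cheb (tu k.+1).1) (tu k.+1).2 => s2 s1 t2.
  by apply/matrixP => i j; rewrite !mxE; field.
by apply: inVD => //; apply: inVB => //; apply: inV_le h2; rewrite ltnW.
Qed.

(** The error e is M-orthogonal to the search space, so tau n <e, e> = <e, T_n(cheb) xs>;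
    Cauchy-Schwarz and [tu_norm] bound the M-norm of e by that of [xs] over [tau n]. *)
Lemma pcg_error n :
  ip (xs - pcg M P c n) (xs - pcg M P c n) <= (2 * (3 / 5) ^+ n) ^+ 2 * ip xs xs.
Proof.
rewrite -[pcg M P c n]/(X n).
(* After a zero residual, [alpha] is 0 divided by something, hence 0, and the iterate stays at the
   exact solution. *)
have [[i [ni ri]]|nor] := pselect (exists i, (i <= n)%N /\ r i = 0).
  have rn : r n = 0.
    move: ni; elim: n => [|n IH]; first by rewrite leqn0 => /eqP i0; move: ri; rewrite i0.
    rewrite leq_eqVlt => /predU1P[<-//|]; rewrite ltnS => /IH rn.
    by rewrite rS rn sub0r /alpha rn dotv0l mul0r scale0r oppr0.
  have -> : xs - X n = 0 by apply: Mdef; rewrite -rE rn dotv0r.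
  by rewrite ip0r mulr_ge0// sqr_ge0.
have nor' i : (i < n)%N -> r i != 0.
  by move=> ni; apply: contra_notN nor => /eqP ri; exists i; rewrite ltnW.
have [I1 _ _ I4] := invariants nor'.
set e := xs - X n.
have ep i : (i < n)%N -> ip e (p i) = 0.
  by move=> ni; rewrite ipC /ip -rE dotvC I1// ni leqnn.
have ee : ip e e = ip e xs by rewrite {2}/e ipBr (inVX ep) subr0.
have mem : inV n (tau n *: xs - (tu n).1).
  move: I4; case: (n) => [_|m I4].
    have -> : tau 0 = 1 by rewrite /tau !expr0 invr1; field.
    by rewrite scale1r subrr; exact: inV0.
  by have [] := @inVtu m (fun i im => I4 i (ltnW im)).
have te : tau n * ip e xs = ip e (tu n).1.
  by have := mem e ep; rewrite ipBr ipZr => /eqP; rewrite subr_eq0 => /eqP.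
have zeta0 : 0 < zeta by rewrite /zeta divr_gt0.
have CS : ip e (tu n).1 ^+ 2 <= ip e e * ip xs xs.
  apply: (le_trans (psd_CS e (tu n).1 Mpsd)).
  by rewrite ler_wpM2l ?tu_norm// ip_ge0.
have main : tau n ^+ 2 * ip e e <= ip xs xs.
  have := ip_ge0 e; rewrite le_eqVlt => /predU1P[<-|e0]; first by rewrite mulr0.
  rewrite -(ler_pM2l e0); apply: le_trans CS; rewrite -te -ee.
  by rewrite le_eqVlt; apply/orP; left; apply/eqP; ring.
have tge : 1 <= (2 * (3 / 5) ^+ n) * tau n.
  have -> : 2 * (3 / 5) ^+ n * tau n = (3 / 5) ^+ n * zeta ^+ n + (3 / 5) ^+ n / zeta ^+ n.
    by rewrite /tau; field; rewrite expf_neq0// gt_eqF.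
  rewrite -exprMn (_ : 3 / 5 * zeta = 1); last by rewrite /zeta; field.
  rewrite expr1n lerDl; apply: divr_ge0; apply: exprn_ge0; last exact: ltW.
  by rewrite divr_ge0.
apply: (@le_trans _ _ ((2 * (3 / 5) ^+ n * tau n) ^+ 2 * ip e e)).
  by rewrite ler_peMl ?ip_ge0//; exact: exprn_ege1.
by rewrite exprMn -mulrA; apply: ler_wpM2l => //; exact: sqr_ge0.
Qed.

End pcg.

(** * From the iteration count to the tolerance *)

Lemma pcg_iters_ge (R : realType) (Rb eps rho : R) :
  4 + 2 * ln (Rb / (eps * rho)) <= (pcg_iters Rb eps rho)%:R.
Proof.
rewrite /pcg_iters; set z := 4 + Num.ceil _.
have hz : 4 + 2 * ln (Rb / (eps * rho)) <= z%:~R.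
  by rewrite intrD lerD2l ceil_ge.
(* A negative count is truncated to 0, which still lies above it. *)
apply: (le_trans hz); case: z {hz} => n; last first.
  by rewrite NegzE mulrNz (le_trans _ (ler0n _ _))// oppr_le0.
by rewrite -pmulrn truncnK ?natr_nat.
Qed.

(** Since 3/5 <= e^(-1/2), the count gives (3/5)^T <= e^(-2) eps rho / Rb, and 2 e^(-2) <= 1. *)
Lemma pcg_iters_error (R : realType) (Rb eps rho : R) :
  0 <= Rb -> 0 < eps -> 0 < rho ->
  2 * (3 / 5) ^+ pcg_iters Rb eps rho * (Rb / rho) <= eps.
Proof.
move=> Rb0 eps0 rho0; move: Rb0; rewrite le_eqVlt => /predU1P[<-|Rb0].
  by rewrite mul0r mulr0 ltW.
have L0 : 0 < Rb / (eps * rho) by rewrite divr_gt0// mulr_gt0.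
have := pcg_iters_ge Rb eps rho; set T := pcg_iters _ _ _; set L := Rb / _ in L0 * => hT.
have h1 : (3 / 5) ^+ T <= expR (- 2) / L.
  apply: (@le_trans _ _ (expR (- 2^-1) ^+ T)).
    by apply: lerXn2r; rewrite ?nnegrE ?divr_ge0 ?expR_ge0// expRN_half_ge.
  rewrite -[L]lnK ?posrE// -expRN -expRD -expRM_natr ler_expR; lra.
have e2 : expR (- 2) <= (2^-1 : R).
  by rewrite expRN lef_pV2 ?posrE ?expR_gt0//; have := expR_ge1Dx (2 : R); lra.
have RE : Rb / rho = L * eps by rewrite /L; field; rewrite !gt_eqF.
rewrite RE; apply: (@le_trans _ _ (2 * (expR (- 2) / L) * (L * eps))).
  rewrite ler_wpM2r//; first by rewrite mulr_ge0// ltW.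
  by rewrite ler_wpM2l.
have -> : 2 * (expR (- 2) / L) * (L * eps) = 2 * expR (- 2) * eps.
  by field; rewrite gt_eqF.
by apply: ler_piMl; [exact: ltW | lra].
Qed.

(** Passing from the M-norm to the Euclidean norm costs 1 / sqrt rho, and bounding the M-norm of the
    solution by |c| costs another; this is the ratio Rb / rho in the iteration count. *)
Lemma pcg_norm2_error (R : realType) (d : nat) (H P : 'M[R]_d) (al rho Rb eps : R)
    (c : 'cV[R]_d) :
  psd H -> 0 < rho -> psd P -> P \in unitmx -> 0 < al -> 0 < eps ->
  (forall x : 'cV[R]_d, al * dotv x (P *m x) <= dotv x ((H + rho%:M) *m x)
     <= 16 * al * dotv x (P *m x)) ->
  norm2 c <= Rb ->
  norm2 (pcg (H + rho%:M) P c (pcg_iters Rb eps rho) - invmx (H + rho%:M) *m c) <= eps.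
Proof.
move=> Hpsd rho0 Ppsd Pu al0 eps0 PM cR.
have Mu := regularized_unit Hpsd rho0; have Mpsd := regularized_psd Hpsd rho0.
set M := H + rho%:M in Mu Mpsd PM *.
have quad v : dotv v (M *m v) = dotv v (H *m v) + rho * dotv v v by exact: regularized_quad.
have Mlow v : rho * dotv v v <= dotv v (M *m v) by rewrite quad lerDr Hpsd.2.
have Mdef v : dotv v (M *m v) = 0 -> v = 0.
  move=> v0; apply: dotvv_eq0; apply/eqP; rewrite eq_le dotvv_ge0 andbT.
  by rewrite -(pmulr_rle0 _ rho0) -v0.
pose xs := invmx M *m c.
have Mxs : M *m xs = c by rewrite mulKVmx.
have err := pcg_error xs Mpsd Mdef Ppsd Pu al0 PM (pcg_iters Rb eps rho).
rewrite Mxs in err; set e := xs - _ in err.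
rewrite -norm2N opprB -/e.
have Rb0 : 0 <= Rb by apply: le_trans cR; exact: norm2_ge0.
have xc : dotv xs c <= norm2 c ^+ 2 / rho.
  have h1 : rho * norm2 xs ^+ 2 <= dotv xs c by rewrite norm2_sqr -Mxs Mlow.
  have h2 : dotv xs c <= norm2 xs * norm2 c.
    by apply: le_trans (dotv_le_norm2 _ _); exact: ler_norm.
  have h3 : rho * norm2 xs <= norm2 c.
    have := norm2_ge0 xs; rewrite le_eqVlt => /predU1P[<-|x0].
      by rewrite mulr0 norm2_ge0.
    by rewrite -(ler_pM2r x0) -mulrA -expr2 (le_trans h1)// (le_trans h2)// mulrC.
  rewrite ler_pdivlMr// (le_trans (y := norm2 xs * norm2 c * rho))//.
    by rewrite ler_wpM2r// ltW.
  by rewrite mulrC mulrA expr2 ler_wpM2r// norm2_ge0.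
set q := 2 * (3 / 5) ^+ _ in err *.
have q0 : 0 <= q by rewrite mulr_ge0// exprn_ge0// divr_ge0.
have ee : dotv e e <= (q * (Rb / rho)) ^+ 2.
  rewrite -(ler_pM2l rho0); apply: (le_trans (Mlow e)); apply: (le_trans err).
  have -> : rho * (q * (Rb / rho)) ^+ 2 = q ^+ 2 * (Rb ^+ 2 / rho).
    by field; rewrite gt_eqF.
  apply: ler_wpM2l; first exact: sqr_ge0.
  apply: (le_trans xc); rewrite ler_wpM2r ?invr_ge0 ?(ltW rho0)//.
  by rewrite ler_pXn2r ?nnegrE ?norm2_ge0.
have qR0 : 0 <= q * (Rb / rho).
  by apply: mulr_ge0 => //; apply: divr_ge0 => //; exact: ltW.
apply: le_trans (pcg_iters_error Rb0 eps0 rho0).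
by rewrite norm2_le_cst.
Qed.

(** * Compactness in finite dimension *)

Section finite_dimensional.
Context (R : realType).

Lemma entry_le_norm2 (d : nat) (v : 'cV[R]_d) i : `|v i 0| <= norm2 v.
Proof.
rewrite -(ler_pXn2r (n := 2))// ?nnegrE ?norm2_ge0// real_normK ?num_real//.
rewrite norm2_sqr dotvE (bigD1 i)//= -expr2 lerDl sumr_ge0// => j _.
by rewrite -expr2 sqr_ge0.
Qed.

Lemma norm2_le_sum (d : nat) (v : 'cV[R]_d) : norm2 v <= \sum_i `|v i 0|.
Proof.
have s0 : 0 <= \sum_i `|v i 0| by exact: sumr_ge0.
rewrite norm2_le_cst// dotvE expr2 mulr_suml; apply: ler_sum => i _.
apply: le_trans (ler_norm _) _; rewrite normrM ler_wpM2l//.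
by rewrite (bigD1 i)//= lerDl sumr_ge0.
Qed.

Lemma norm2_nbhs (d : nat) (x : 'cV[R]_d) (V : set 'cV[R]_d) : nbhs x V ->
  exists2 e, 0 < e & forall y, norm2 (y - x) < e -> V y.
Proof.
move=> /nbhs_ballP[e /= e0 eV]; exists e => // y yx; apply: eV; split=> [|i j]; first exact: e0.
rewrite ord1 /ball /=.
have := entry_le_norm2 (y - x) i; rewrite !mxE => h.
by rewrite distrC (le_lt_trans h).
Qed.

Lemma norm2_mulmx_bound (n d : nat) (M : 'M[R]_(n, d)) :
  exists2 C, 0 <= C & forall v, norm2 (M *m v) <= C * norm2 v.
Proof.
exists (\sum_i \sum_j `|M i j|); first by apply: sumr_ge0 => i _; exact: sumr_ge0.
move=> v; apply: (le_trans (norm2_le_sum _)); rewrite mulr_suml; apply: ler_sum => i _.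
rewrite mxE mulr_suml; apply: le_trans (ler_norm_sum _ _ _) _; apply: ler_sum => j _.
by rewrite normrM ler_wpM2l// entry_le_norm2.
Qed.

Lemma bounded_cluster (d : nat) (w : nat -> 'cV[R]_d) (B : R) :
  (forall k, norm2 (w k) <= B) ->
  exists ws, forall e, 0 < e -> forall N, exists2 k, (N <= k)%N & norm2 (w k - ws) < e.
Proof.
move=> wB.
pose K := [set v : 'rV[R]_d | forall i, `[- B, B]%classic (v ord0 i)].
have cK : compact K.
  by apply: (@rV_compact _ _ (fun=> `[- B, B]%classic)) => i; exact: segment_compact.
pose F := (fun k => (w k)^T) @ \oo.
have FK : F K.
  exists 0%N => // k _ i /=; rewrite mxE in_itv /= -ler_norml.
  exact: le_trans (entry_le_norm2 _ _) (wB k).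
have [ws [_ clu]] := cK F _ FK.
exists ws^T => e e0 N.
(* Dividing by d + 1 makes the final comparison strict and covers d = 0. *)
have d0 : 0 < e / d.+1%:R by rewrite divr_gt0// ltr0n.
have FN : F [set (w k)^T | k in [set k | (N <= k)%N]].
  by exists N => // k Nk; exists k.
have [_ [[k /= Nk <-] bk]] := clu _ _ FN (nbhsx_ballx ws _ d0).
exists k => //; apply: (le_lt_trans (norm2_le_sum _)).
apply: (@le_lt_trans _ _ (\sum_(i < d) e / d.+1%:R)).
  apply: ler_sum => i _; rewrite !mxE; have := bk.2 ord0 i; rewrite /ball /= mxE distrC => /ltW //.
rewrite sumr_const card_ord -[_ *+ d]mulr_natr mulrAC ltr_pdivrMr ?ltr0n//.
by rewrite ltr_pM2l// ltr_nat.
Qed.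

End finite_dimensional.

(** * Quasi-Fejer sequences *)

Section quasi_fejer.
Context (R : realType).

Lemma cvgn0P (u : nat -> R) : (forall k, 0 <= u k) ->
  (forall e, 0 < e -> exists N, forall k, (N <= k)%N -> u k < e) <->
  u @ \oo --> (0 : R).
Proof.
move=> u0; split => [h|h e e0].
  apply/cvgrPdist_lt => e e0; have [N hN] := h e e0; exists N => // k /= Nk.
  by rewrite sub0r normrN ger0_norm// hN.
have := h; move=> /cvgrPdist_lt /(_ e e0)[N _ hN]; exists N => k Nk.
by have := hN k Nk; rewrite sub0r normrN ger0_norm.
Qed.

Variables (D eps : nat -> R).
Hypotheses (eps0 : forall k, 0 < eps k) (ceps : cvgn (series eps)).
Hypotheses (D0 : forall k, 0 <= D k) (DS : forall k, D k.+1 <= D k + eps k).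

(** Removing the accumulated tolerances leaves a nonincreasing sequence that is bounded below. *)
Let F k := D k - series eps k.

Let seriesS k : series eps k.+1 = series eps k + eps k.
Proof. by rewrite /series /= big_nat_recr. Qed.

Let FS k : F k.+1 <= F k.
Proof. by rewrite /F seriesS; have := DS k; lra. Qed.

Let series_le k : series eps k <= limn (series eps).
Proof.
apply: nondecreasing_cvgn_le => //; apply/nondecreasing_seqP => n.
by rewrite seriesS lerDl ltW.
Qed.

Lemma quasi_fejer_bounded k : D k <= D 0%N + limn (series eps).
Proof.
have : F k <= F 0%N by elim: k => // k /(le_trans (FS k)).
by rewrite /F [series eps 0]big_geq//; have := series_le k; lra.
Qed.

Let decr_cvg : (fun k => D k - D k.+1 + eps k) @ \oo --> (0 : R).
Proof.
have cF : cvgn F.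
  apply: nonincreasing_is_cvgn; first by apply/nonincreasing_seqP.
  exists (- limn (series eps)) => _ [k _ <-]; rewrite /F.
  by have := D0 k; have := series_le k; lra.
have -> : (fun k => D k - D k.+1 + eps k) = (fun k => F k - F k.+1).
  by apply/funext => k; rewrite /F seriesS; ring.
rewrite -[X in _ --> X](subrr (limn F)); apply: cvgB => //.
by rewrite (cvg_shiftS F).
Qed.

Lemma quasi_fejer_decrease e : 0 < e ->
  exists N, forall k, (N <= k)%N -> D k - D k.+1 + eps k < e.
Proof.
move: e; apply/cvgn0P; last exact: decr_cvg.
by move=> k; have := DS k; lra.
Qed.

(** Once D is small at a late index, it can grow afterwards only by the tail of the series. *)
Lemma quasi_fejer_cvg0 :
  (forall e, 0 < e -> forall N, exists2 k, (N <= k)%N & D k < e) ->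
  forall e, 0 < e -> exists N, forall k, (N <= k)%N -> D k < e.
Proof.
move=> clu e e0.
have e2 : 0 < e / 2 by rewrite divr_gt0.
have [N hN] : exists N, forall k, (N <= k)%N -> limn (series eps) - series eps k < e / 2.
  have /cvgrPdist_lt /(_ _ e2)[N _ hN] := ceps; exists N => k Nk.
  by have := hN k Nk; rewrite ger0_norm// subr_ge0.
have [k0 Nk0 Dk0] := clu _ e2 N.
exists k0 => k kk0.
have : F k <= F k0.
  by rewrite -(subnKC kk0); elim: (k - k0)%N => [|j IH]; rewrite ?addn0// addnS (le_trans (FS _)).
by rewrite /F; have := series_le k; have := hN _ Nk0; lra.
Qed.

Lemma eps_cvg0 e : 0 < e -> exists N, forall k, (N <= k)%N -> eps k < e.
Proof.
move: e; apply/cvgn0P => [k|]; first exact: ltW.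
exact: cvg_series_cvg_0.
Qed.

End quasi_fejer.

(** * Functions with constant Hessian *)

Section quadratic.
Context (R : realType) (d : nat).

Lemma is_derive_line (phi : 'cV[R]_d -> R) (x v : 'cV[R]_d) (t : R) :
  differentiable phi (x + t *: v) ->
  is_derive t 1 (fun s : R => phi (x + s *: v)) ('d phi (x + t *: v) v).
Proof.
move=> dphi.
have dk : is_diff t (cst x + ( *:%R^~ v : R -> 'cV[R]_d)) (0 + *:%R^~ v).
  exact: is_diffD.
have dp : is_diff ((cst x + ( *:%R^~ v : R -> 'cV[R]_d)) t) phi ('d phi (x + t *: v)).
  exact: differentiableP.
have dc := is_diff_comp dk dp.
have df : differentiable (phi \o (cst x + ( *:%R^~ v : R -> 'cV[R]_d))) t by case: dc.
apply: DeriveDef; first exact/derivable1_diffP.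
rewrite (@deriveE _ _ _ (phi \o (cst x + ( *:%R^~ v : R -> 'cV[R]_d))))//.
by rewrite (@diff_val _ _ _ _ _ _ _ dc) /= add0r scale1r.
Qed.

Variables (g : 'cV[R]_d -> R) (Hg : 'M[R]_d).
Hypothesis gH : twice_diff_const_hessian g Hg.

Lemma grad_affine (x v : 'cV[R]_d) : grad g (x + v) = grad g x + Hg *m v.
Proof.
apply/matrixP => i j; rewrite ord1.
pose co := (fun M : 'cV[R]_d => M i 0).
have co_lin : linear co by move=> k a b; rewrite /co !mxE.
pose coL : {linear 'cV[R]_d -> R} := HB.pack co (GRing.isLinear.Build _ _ _ _ _ co_lin).
have co_cont : continuous coL by exact: coord_continuous.
(* Subtracting the expected growth along the line leaves a function with zero derivative. *)
pose psi (t : R) := (grad g (x + t *: v)) i 0 - t * (Hg *m v) i 0.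
have dpsi (t : R) : is_derive t (1 : R) psi (0 : R).
  have [_ dG dGE] := gH (x + t *: v).
  have dco : differentiable (co \o grad g) (x + t *: v).
    by apply: differentiable_comp => //; exact: (@linear_differentiable _ _ _ coL).
  have := is_derive_line dco.
  have -> : 'd (co \o grad g) (x + t *: v) v = (Hg *m v) i 0.
    rewrite diff_comp//; last exact: (@linear_differentiable _ _ _ coL).
    rewrite /= dGE.
    by have := @diff_lin _ _ _ coL (grad g (x + t *: v)) co_cont
      => /(congr1 (fun F => F (Hg *m v))).
  move=> d1.
  have d2 : is_derive t 1 (fun s : R => s * (Hg *m v) i 0) ((Hg *m v) i 0).
    by apply: is_derive_eq; rewrite scaler0 add0r /GRing.scale /= mulr1.
  by rewrite -(subrr ((Hg *m v) i 0)); exact: is_deriveB.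
have e : psi 1 = psi 0 by exact: is_derive_0_is_cst.
have psi1 : psi 1 = (grad g (x + v)) i 0 - (Hg *m v) i 0 by rewrite /psi scale1r mul1r.
have psi0 : psi 0 = (grad g x) i 0 by rewrite /psi scale0r addr0 mul0r subr0.
move: e; rewrite psi1 psi0 => /eqP; rewrite subr_eq => /eqP ->.
by rewrite [RHS]mxE.
Qed.

Lemma quadratic_expansion (x v : 'cV[R]_d) :
  g (x + v) = g x + dotv (grad g x) v + dotv v (Hg *m v) / 2.
Proof.
have dgE y : 'd g y v = dotv (grad g y) v.
  rewrite dotvE [in LHS](_ : v = \sum_i v i 0 *: delta_mx i 0); last first.
    apply/matrixP => i j; rewrite ord1 summxE (bigD1 i)//= big1 => [|l li].
      by rewrite !mxE !eqxx mulr1 addr0.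
    by rewrite !mxE eq_sym (negbTE li) mulr0.
  rewrite raddf_sum; apply: eq_bigr => i _.
  transitivity (v i 0 * 'd g y (delta_mx i 0 : 'cV[R]_d)).
    exact: (linearZ_LR ('d g y) (v i 0) (delta_mx i 0)).
  by rewrite mxE mulrC.
pose psi (t : R) := g (x + t *: v) - t * dotv (grad g x) v - t ^+ 2 * (dotv v (Hg *m v) / 2).
have dpsi (t : R) : is_derive t (1 : R) psi (0 : R).
  have [dg _ _] := gH (x + t *: v).
  have := is_derive_line dg.
  rewrite dgE grad_affine -scalemxAr dotvDl dotvZl (dotvC (Hg *m v)) => d1.
  have d2 : is_derive t 1 (fun s : R => s * dotv (grad g x) v) (dotv (grad g x) v).
    by apply: is_derive_eq; rewrite scaler0 add0r /GRing.scale /= mulr1.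
  have d3 : is_derive t 1 (fun s : R => s ^+ 2 * (dotv v (Hg *m v) / 2)) (t * dotv v (Hg *m v)).
    apply: is_derive_eq; rewrite scaler0 add0r /GRing.scale /=.
    by field.
  apply: (@is_derive_eq _ _ _ _ _ _ _ _ (is_deriveB (is_deriveB d1 d2) d3)).
  by ring.
have e : psi 1 = psi 0 by exact: is_derive_0_is_cst.
have psi1 : psi 1 = g (x + v) - dotv (grad g x) v - dotv v (Hg *m v) / 2.
  by rewrite /psi scale1r mul1r expr1n mul1r.
have psi0 : psi 0 = g x by rewrite /psi scale0r addr0 mul0r expr0n /= mul0r !subr0.
by move: e; rewrite psi1 psi0; lra.
Qed.
End quadratic.

(** * Subgradients of closed convex functions *)

Lemma le_of_le_addM (R : realType) (p q c : R) :
  (forall t, 0 < t <= 1 -> p <= q + t * c) -> p <= q.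
Proof.
move=> h; rewrite leNgt; apply/negP => qp.
have c0 : 0 <= `|c| by [].
pose t := Num.min 1 ((p - q) / (2 * (`|c| + 1))).
have e0 : 0 < (p - q) / (2 * (`|c| + 1)) by rewrite divr_gt0 ?subr_gt0// mulr_gt0// ltr_wpDl.
have t0 : 0 < t <= 1 by rewrite lt_min ltr01 e0 ge_min lexx.
have := h t t0; apply/negP; rewrite -ltNge.
have /andP[tp _] := t0.
have t2 : t * (2 * (`|c| + 1)) <= p - q.
  by rewrite -ler_pdivlMr ?mulr_gt0 ?ltr_wpDl// ge_min lexx orbT.
have : t * c <= t * `|c| by rewrite ler_wpM2l ?ler_norm// ltW.
have : 0 <= t * `|c| by rewrite mulr_ge0// ltW.
by lra.
Qed.

Definition subgradient {R : realType} {d : nat} (h : 'cV[R]_d -> \bar R)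
    (z g : 'cV[R]_d) : Prop :=
  exists2 a : R, h z = a%:E & forall y, ((a + dotv g (y - z))%R%:E <= h y)%E.

Section subgradients.
Context (R : realType) (d : nat) (h : 'cV[R]_d -> \bar R).
Hypothesis hcpc : closed_proper_convex h.

(** Compare z with z + t (y - z), use convexity of [h], divide by t and let t tend to 0. The
    quadratic upper model of [phi] covers both the smooth objective and the proximal term of the
    z-update. *)
Lemma minimizer_subgradient (phi : 'cV[R]_d -> R) (z G : 'cV[R]_d) (C : R) :
  (forall v, phi (z + v) <= phi z + dotv G v + C * dotv v v) ->
  (forall y, ((phi z)%:E + h z <= (phi y)%:E + h y)%E) ->
  subgradient h z (- G).
Proof.
case: hcpc => _ [hNy [x0 hx0]] hconv phiE zmin.
have : h z \is a fin_num.
  rewrite fin_numE hNy /=; apply/negP => /eqP hz.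
  by have := zmin x0; rewrite hz; move: hx0; case: (h x0) => // b _; rewrite addey.
case hz : (h z) => [a| |] // _; exists a => // y.
have := hNy y; case hy : (h y) => [b| |] // _; last by rewrite leey.
rewrite lee_fin dotvNl; set v := y - z.
suff : a - b <= dotv G v by lra.
apply: (@le_of_le_addM _ _ _ (C * dotv v v)) => t /andP[t0 t1].
have t01 : 0 <= t <= 1 by rewrite t1 ltW.
have yE : z + t *: v = t *: y + (1 - t) *: z.
  by rewrite /v; apply/matrixP => i j; rewrite !mxE; ring.
have := hconv y z t t01; rewrite hy hz -!EFinM -EFinD -yE => hc.
have := zmin (z + t *: v); rewrite hz; move: hc.
have := hNy (z + t *: v); case: (h _) => [c| |] // _.
rewrite lee_fin -!EFinD lee_fin => hc zm.
have := phiE (t *: v); rewrite !dotvZl !dotvZr => pv.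
rewrite -(ler_pM2l t0).
have -> : t * (dotv G v + t * (C * dotv v v)) = t * dotv G v + C * (t * (t * dotv v v)) by ring.
by lra.
Qed.

Lemma subgradient_monotone z g z' g' : subgradient h z g -> subgradient h z' g' ->
  0 <= dotv (g - g') (z - z').
Proof.
move=> [a ha hg] [a' ha' hg']; have := hg z'; have := hg' z; rewrite ha ha' !lee_fin.
rewrite dotvBl !dotvBr; lra.
Qed.

(** The graph of the subdifferential is closed: lower semicontinuity handles [h (z k)], and the
    other errors are bilinear in small differences. *)
Lemma subgradient_cluster (z g : nat -> 'cV[R]_d) (zs gs : 'cV[R]_d) :
  (forall k, subgradient h (z k) (g k)) ->
  (forall e, 0 < e -> exists k, norm2 (z k - zs) < e /\ norm2 (g k - gs) < e) ->
  subgradient h zs gs.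
Proof.
case: hcpc => hlsc [hNy [x0 hx0]] _ zg clu.
have key (y : 'cV[R]_d) (b : R) : h y = b%:E -> (h zs <= (b - dotv gs (y - zs))%:E)%E.
  move=> hy; rewrite leNgt; apply/negP => lt.
  pose be := b - dotv gs (y - zs).
  have [a ba ah] : exists2 a, be < a & (a%:E < h zs)%E.
    move: lt; rewrite -/be; case: (h zs) => [c| |] //.
      rewrite lte_fin => bc; exists ((be + c) / 2); rewrite ?lte_fin; lra.
    by move=> _; exists (be + 1); rewrite ?ltry//; lra.
  have [V nV hV] := hlsc _ _ ah.
  have [e e0 eV] := norm2_nbhs nV.
  (* [B] collects the factors of [e'] in [n1], [n2] and [n3], so that these errors together stay
     below half the gap [a - be]. *)
  pose B := norm2 (y - zs) + norm2 gs + 1.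
  have B0 : 0 < B by rewrite /B; have := norm2_ge0 (y - zs); have := norm2_ge0 gs; lra.
  pose e' := Num.min e (Num.min 1 ((a - be) / (2 * B))).
  have q0 : 0 < (a - be) / (2 * B) by rewrite divr_gt0 ?subr_gt0// mulr_gt0.
  have e'0 : 0 < e' by rewrite !lt_min e0 ltr01 q0.
  have [k [zk gk]] := clu _ e'0.
  have e'e : e' <= e by rewrite ge_min lexx.
  have e'1 : e' <= 1 by rewrite !ge_min lexx ?orbT.
  have e'B : e' * (2 * B) <= a - be by rewrite -ler_pdivlMr ?mulr_gt0// !ge_min lexx ?orbT.
  have := hV _ (eV _ (lt_le_trans zk e'e)); have [c hz hg] := zg k.
  rewrite hz lte_fin => ac.
  have := hg y; rewrite hy lee_fin => cb.
  have e1 : dotv gs (y - zs) - dotv (g k) (y - z k) =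
      dotv (- (g k - gs)) (y - zs) + dotv (g k - gs) (z k - zs) + dotv gs (z k - zs).
    by rewrite !(dotvNl, dotvBl, dotvBr); ring.
  have n1 : dotv (- (g k - gs)) (y - zs) <= e' * norm2 (y - zs).
    apply: le_trans (ler_norm _) _; apply: le_trans (dotv_le_norm2 _ _) _.
    by rewrite norm2N ler_wpM2r ?norm2_ge0// ltW.
  have n2 : dotv (g k - gs) (z k - zs) <= e' * 1.
    apply: le_trans (ler_norm _) _; apply: le_trans (dotv_le_norm2 _ _) _.
    by apply: ler_pM; rewrite ?norm2_ge0 ?ltW// (lt_le_trans zk).
  have n3 : dotv gs (z k - zs) <= e' * norm2 gs.
    apply: le_trans (ler_norm _) _; apply: le_trans (dotv_le_norm2 _ _) _.
    by rewrite mulrC ler_wpM2r ?norm2_ge0// ltW.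
  have : e' * (2 * B) = 2 * (e' * norm2 (y - zs)) + 2 * (e' * norm2 gs) + 2 * (e' * 1).
    by rewrite /B; ring.
  have : 0 < e' * B by rewrite mulr_gt0.
  rewrite /be in ba e'B; lra.
have := hNy zs; case hzs : (h zs) => [a| |] // _.
  exists a => // y; have := hNy y; case hy : (h y) => [b| |] // _; last by rewrite leey.
  by have := key y b hy; rewrite hzs !lee_fin; lra.
by move: hx0; case hx : (h x0) => [b| |] // _; have := key _ _ hx; rewrite hzs.
Qed.

End subgradients.

(** * Convergence of inexact ADMM *)

Lemma dotv_col_mx (R : realType) (m n : nat) (a c : 'cV[R]_m) (b e : 'cV[R]_n) :
  dotv (col_mx a b) (col_mx c e) = dotv a c + dotv b e.
Proof. by rewrite /dotv tr_col_mx mul_row_col mxE. Qed.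

Section admm.
Context (R : realType) (d : nat) (H : 'M[R]_d) (q0 : 'cV[R]_d) (rho : R).
Context (f : 'cV[R]_d -> R) (h : 'cV[R]_d -> \bar R).
Context (x z u : nat -> 'cV[R]_d) (eps : nat -> R).
Hypotheses (Hpsd : psd H) (rho0 : 0 < rho) (hcpc : closed_proper_convex h).
Hypothesis fE : forall x v,
  f (x + v) = f x + dotv (H *m x + q0) v + dotv v (H *m v) / 2.
Hypothesis primal : exists xs, forall x', ((f xs)%:E + h xs <= (f x')%:E + h x')%E.
Hypotheses (eps0 : forall k, 0 < eps k) (ceps : cvgn (series eps)).

(** The exact x-update: the zero of the gradient of f(x) + rho/2 |x - z k + u k|^2. *)
Let xe k := invmx (H + rho%:M) *m (rho *: (z k - u k) - q0).

Hypothesis xstep : forall k, norm2 (x k.+1 - xe k) <= eps k.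
Hypothesis zstep : forall k y,
  ((rho / 2 * norm2 (x k.+1 - z k.+1 + u k) ^+ 2)%:E + h (z k.+1)
   <= (rho / 2 * norm2 (x k.+1 - y + u k) ^+ 2)%:E + h y)%E.
Hypothesis ustep : forall k, u k.+1 = u k + x k.+1 - z k.+1.

Let kkt (zs us : 'cV[R]_d) :=
  subgradient h zs (rho *: us) /\ H *m zs + q0 = - (rho *: us).

Let kkt_exists : exists zs us, kkt zs us.
Proof.
have [xs xsmin] := primal.
have [C C0 HC] := norm2_mulmx_bound H.
exists xs, (- (rho^-1 *: (H *m xs + q0))).
have E : rho *: - (rho^-1 *: (H *m xs + q0)) = - (H *m xs + q0).
  by rewrite scalerN scalerA mulfV ?scale1r// gt_eqF.
split; last by rewrite E opprK.
rewrite E; apply: (minimizer_subgradient hcpc (phi := f) (C := C / 2)) => // v.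
rewrite fE lerD2l mulrAC ler_wpM2r//.
apply: le_trans (ler_norm _) _; apply: le_trans (dotv_le_norm2 _ _) _.
by rewrite -norm2_sqr expr2 [leRHS]mulrCA ler_wpM2l ?norm2_ge0.
Qed.

Let zsub k : subgradient h (z k.+1) (rho *: u k.+1).
Proof.
rewrite -[rho *: u k.+1]opprK.
apply: (minimizer_subgradient hcpc (phi := fun y => rho / 2 * norm2 (x k.+1 - y + u k) ^+ 2)
  (C := rho / 2)); last exact: zstep.
move=> v.
have -> : x k.+1 - (z k.+1 + v) + u k = u k.+1 - v.
  by rewrite ustep; apply/matrixP => i j; rewrite !mxE; ring.
have -> : x k.+1 - z k.+1 + u k = u k.+1.
  by rewrite ustep; apply/matrixP => i j; rewrite !mxE; ring.
rewrite !norm2_sqr !dotvBl !dotvBr dotvNl dotvZl (dotvC v (u k.+1)).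
by rewrite le_eqVlt; apply/orP; left; apply/eqP; field.
Qed.

Let xeE k : H *m xe k + q0 = rho *: (z k - u k - xe k).
Proof.
have Hu := regularized_unit Hpsd rho0.
have : (H + rho%:M) *m xe k = rho *: (z k - u k) - q0 by rewrite mulKVmx.
rewrite mulmxDl mul_scalar_mx => /eqP; rewrite eq_sym subr_eq => /eqP e1.
by rewrite scalerBr e1; apply/matrixP => i j; rewrite !mxE; ring.
Qed.

(** The initial [z 0] and [u 0] are arbitrary and need not satisfy the subgradient relation, so the
    descent analysis starts at index 1. *)
Let eps' k := eps k.+1.

Let ceps' : cvgn (series eps').
Proof.
have -> : series eps' = (fun n => series eps n.+1 - eps 0%N).
  by apply/funext => n; rewrite /series /= big_nat_recl// addrAC subrr add0r.
apply: is_cvgB; last exact: is_cvg_cst.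
by apply/cvg_ex; exists (limn (series eps)); rewrite (cvg_shiftS (series eps)).
Qed.

Section fejer.
Variables (zs us : 'cV[R]_d).
Hypothesis zsus : kkt zs us.

Let D k := norm2 (z k.+1 + u k.+1 - (zs + us)).
Let a k := z k.+1 - zs.
Let b k := u k.+1 - us.
Let c k := xe k.+1 - zs.

Let ab k : 0 <= dotv (a k) (b k).
Proof.
have := subgradient_monotone (zsub k) zsus.1; rewrite -scalerBr dotvZl dotvC.
by rewrite pmulr_rge0.
Qed.

Let abc k : 0 <= dotv (a k - b k - c k) (c k).
Proof.
have : H *m c k = rho *: (a k - b k - c k).
  rewrite /c mulmxBr.
  have -> : H *m xe k.+1 = rho *: (z k.+1 - u k.+1 - xe k.+1) - q0 by rewrite -xeE addrK.
  have -> : H *m zs = - (rho *: us) - q0 by rewrite -zsus.2 addrK.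
  by rewrite /a /b; apply/matrixP => i j; rewrite !mxE; ring.
have := Hpsd.2 (c k) => + e1; rewrite e1 dotvZr dotvC.
by rewrite pmulr_rge0.
Qed.

Let Dsqr k : D k ^+ 2 = dotv (a k + b k) (a k + b k).
Proof.
by rewrite norm2_sqr; congr dotv; rewrite /a /b; apply/matrixP => i j; rewrite !mxE; ring.
Qed.

(** The gap is 2 <a, b> + 2 <a - b - c, c>, nonnegative by monotonicity of the subdifferential of h
    and of the gradient of f. *)
Let descent k : dotv (b k + c k) (b k + c k) + dotv (c k - a k) (c k - a k) <= D k ^+ 2.
Proof.
rewrite Dsqr; have := ab k; have := abc k; move: (a k) (b k) (c k) => a' b' c'.
rewrite !(dotvDl, dotvDr, dotvBl, dotvBr, dotvNl, dotvNr).
by rewrite (dotvC b' a') (dotvC c' b') (dotvC c' a'); lra.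
Qed.

Let bc_le k : norm2 (b k + c k) <= D k.
Proof.
rewrite norm2_le_cst ?norm2_ge0//; have := descent k.
by have := dotvv_ge0 (c k - a k); lra.
Qed.

(** After a step, z + u equals the new x plus the old u; an exact x-update would give [b k + c k],
    and its error adds at most [eps' k]. *)
Let D_bc k : D k.+1 <= norm2 (b k + c k) + eps' k.
Proof.
have -> : D k.+1 = norm2 ((b k + c k) + (x k.+2 - xe k.+1)).
  congr norm2; rewrite /b /c ustep; apply/matrixP => i j; rewrite !mxE; ring.
by apply: le_trans (norm2D _ _) _; rewrite lerD2l; exact: xstep.
Qed.

Lemma admm_fejer k : D k.+1 <= D k + eps' k.
Proof. by have := D_bc k; have := bc_le k; lra. Qed.

Lemma admm_za k : norm2 (z k.+1 - zs) <= D k.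
Proof.
rewrite norm2_le_cst ?norm2_ge0// Dsqr -/(a k).
have := ab k; have := dotvv_ge0 (b k); move: (a k) (b k) => a' b'.
by rewrite !dotvDl !dotvDr (dotvC b' a'); lra.
Qed.

Lemma admm_ub k : norm2 (u k.+1 - us) <= D k.
Proof.
rewrite norm2_le_cst ?norm2_ge0// Dsqr -/(b k).
have := ab k; have := dotvv_ge0 (a k); move: (a k) (b k) => a' b'.
by rewrite !dotvDl !dotvDr (dotvC b' a'); lra.
Qed.

Lemma admm_bounded : exists B, forall k, D k <= B.
Proof.
exists (D 0 + limn (series eps')) => k.
exact: (@quasi_fejer_bounded R D eps' (fun k => eps0 _) ceps' admm_fejer).
Qed.

(** By [descent], |c - a|^2 <= (D - |b + c|) (D + |b + c|): the first factor is at most the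
    vanishing decrease of D, the second is bounded. *)
Lemma admm_gap e : 0 < e ->
  exists N, forall k, (N <= k)%N -> norm2 (xe k.+1 - z k.+1) < e.
Proof.
move=> e0; have [B DB] := admm_bounded.
have B0 : 0 <= B by apply: le_trans (DB 0%N); exact: norm2_ge0.
have q : 0 < e ^+ 2 / (2 * B + 1) by rewrite divr_gt0 ?exprn_gt0//; lra.
have [N hN] := @quasi_fejer_decrease R D eps' (fun k => eps0 _) ceps' (fun k => norm2_ge0 _)
  admm_fejer _ q.
exists N => k Nk; have := hN k Nk; rewrite ltr_pdivlMr; last by lra.
have -> : xe k.+1 - z k.+1 = c k - a k.
  by rewrite /a /c; apply/matrixP => i j; rewrite !mxE; ring.
move=> lt; rewrite -(ltr_pXn2r (n := 2))// ?nnegrE ?norm2_ge0 ?(ltW e0)// norm2_sqr.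
have := descent k; have := D_bc k; have := bc_le k; have := DB k.
have := norm2_ge0 (b k + c k); rewrite -(norm2_sqr (b k + c k)).
move: (norm2 (b k + c k)) (dotv _ _) => nb gap nb0 DkB nbD Dnb de.
have h1 : D k ^+ 2 - nb ^+ 2 = (D k - nb) * (D k + nb) by ring.
have h2 : (D k - nb) * (D k + nb) <= (D k - D k.+1 + eps' k) * (2 * B + 1).
  by apply: ler_pM; lra.
by lra.
Qed.

End fejer.

Lemma admm_converges : exists zs us,
  [/\ subgradient h zs (rho *: us), H *m zs + q0 = - (rho *: us),
      (fun k => norm2 (x k - zs)) @ \oo --> (0 : R) &
      (fun k => norm2 (rho *: u k - rho *: us)) @ \oo --> (0 : R)].
Proof.
have [z0 [u0 kkt0]] := kkt_exists.
have [B DB] := admm_bounded kkt0.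
(* Stacking both sequences yields a common cluster point from one compactness argument. *)
pose w k := col_mx (z k.+1) (u k.+1).
have wB k : norm2 (w k) <= norm2 z0 + norm2 u0 + B + B.
  have w1 : norm2 (w k) <= norm2 (z k.+1) + norm2 (u k.+1).
    rewrite norm2_le_cst ?addr_ge0 ?norm2_ge0// dotv_col_mx -!norm2_sqr.
    by have := norm2_ge0 (z k.+1); have := norm2_ge0 (u k.+1); nra.
  have w2 : norm2 (z k.+1) <= norm2 (z k.+1 - z0) + norm2 z0.
    by rewrite -[X in norm2 X <= _](subrK z0) norm2D.
  have w3 : norm2 (u k.+1) <= norm2 (u k.+1 - u0) + norm2 u0.
    by rewrite -[X in norm2 X <= _](subrK u0) norm2D.
  have := admm_za kkt0 k; have := admm_ub kkt0 k; have := DB k; lra.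
have [ws clu] := bounded_cluster wB.
pose zs := usubmx ws; pose us := dsubmx ws.
have clu' e : 0 < e -> forall N, exists2 k, (N <= k)%N &
    norm2 (z k.+1 - zs) < e /\ norm2 (u k.+1 - us) < e.
  move=> e0 N; have [k Nk wk] := clu e e0 N; exists k => //.
  have wE : w k - ws = col_mx (z k.+1 - zs) (u k.+1 - us).
    by rewrite -[ws in LHS]vsubmxK opp_col_mx add_col_mx.
  have ww : dotv (w k - ws) (w k - ws) =
      dotv (z k.+1 - zs) (z k.+1 - zs) + dotv (u k.+1 - us) (u k.+1 - us).
    by rewrite wE dotv_col_mx.
  by split; apply: le_lt_trans wk; rewrite norm2_le_cst ?norm2_ge0// norm2_sqr ww;
    rewrite ?lerDl ?lerDr dotvv_ge0.
have kkts : kkt zs us.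
  split.
    apply: (subgradient_cluster hcpc
      (z := fun k => z k.+1) (g := fun k => rho *: u k.+1)) => [k|e e0].
      exact: zsub.
    have e1 : 0 < Num.min e (e / rho) by rewrite lt_min e0 divr_gt0.
    have [k _ [zk uk]] := clu' _ e1 0%N; exists k; split.
      by rewrite (lt_le_trans zk)// ge_min lexx.
    rewrite -scalerBr norm2Z gtr0_norm// mulrC -ltr_pdivlMr//.
    by rewrite (lt_le_trans uk)// ge_min lexx orbT.
  apply/eqP; rewrite -subr_eq0 opprK; apply/eqP; apply: norm2_eq0.
  apply/eqP; rewrite eq_le norm2_ge0 andbT.
  have [C C0 HC] := norm2_mulmx_bound H.
  apply: (@le_of_le_addM _ _ _ (2 * C + 2 * rho)) => e /andP[e0 _]; rewrite add0r.
  have [N hN] := admm_gap kkt0 e0.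
  have [k Nk [zk uk]] := clu' _ e0 N.
  have -> : H *m zs + q0 + rho *: us =
    (H *m (zs - z k.+1) + H *m (z k.+1 - xe k.+1)) +
    (rho *: (us - u k.+1) + rho *: (z k.+1 - xe k.+1)).
    rewrite !mulmxBr.
    have -> : H *m xe k.+1 = rho *: (z k.+1 - u k.+1 - xe k.+1) - q0 by rewrite -xeE addrK.
    by apply/matrixP => i j; rewrite !mxE; ring.
  have g := hN _ Nk; rewrite -norm2N opprB in g.
  rewrite -norm2N opprB in zk; rewrite -norm2N opprB in uk.
  have b1 := le_trans (HC (zs - z k.+1)) (ler_wpM2l C0 (ltW zk)).
  have b2 := le_trans (HC (z k.+1 - xe k.+1)) (ler_wpM2l C0 (ltW g)).
  have b3 : norm2 (rho *: (us - u k.+1)) <= rho * e.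
    by rewrite norm2Z gtr0_norm// ler_pM2l// ltW.
  have b4 : norm2 (rho *: (z k.+1 - xe k.+1)) <= rho * e.
    by rewrite norm2Z gtr0_norm// ler_pM2l// ltW.
  apply: le_trans (norm2D _ _) _.
  apply: le_trans (lerD (norm2D _ _) (norm2D _ _)) _; lra.
(* The Fejer estimate is now taken relative to the cluster point itself, so smallness along a
   subsequence persists. *)
have D0 : forall e, 0 < e -> exists N, forall k, (N <= k)%N ->
    norm2 (z k.+1 + u k.+1 - (zs + us)) < e.
  apply: (@quasi_fejer_cvg0 R _ eps' (fun k => eps0 _) ceps' (admm_fejer kkts)) => e e0 N.
  have e2 : 0 < e / 2 by rewrite divr_gt0.
  have [k Nk [zk uk]] := clu' _ e2 N; exists k => //.
  have -> : z k.+1 + u k.+1 - (zs + us) = (z k.+1 - zs) + (u k.+1 - us).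
    by apply/matrixP => i j; rewrite !mxE; ring.
  by apply: le_lt_trans (norm2D _ _) _; lra.
exists zs, us; split; [exact: kkts.1 | exact: kkts.2 | |].
  apply/cvgn0P => [k|e e0]; first exact: norm2_ge0.
  have e3 : 0 < e / 3 by rewrite divr_gt0.
  have [N1 h1] := D0 _ e3.
  have [N2 h2] := admm_gap kkts e3.
  have [N3 h3] := eps_cvg0 eps0 ceps e3.
  exists (N1 + N2 + N3).+2 => -[|[|k]] // Nk.
  have k12 : (N1 + N2 + N3 <= k)%N by [].
  have k1 : (N1 <= k)%N by apply: leq_trans k12; rewrite -addnA leq_addr.
  have k2 : (N2 <= k)%N by apply: leq_trans k12; rewrite addnAC leq_addl.
  have k3 : (N3 <= k.+1)%N by rewrite ltnW// ltnS (leq_trans _ k12)// leq_addl.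
  have -> : x k.+2 - zs = (x k.+2 - xe k.+1) + ((xe k.+1 - z k.+1) + (z k.+1 - zs)).
    by apply/matrixP => i j; rewrite !mxE; ring.
  apply: le_lt_trans (norm2D _ _) _.
  have := norm2D (xe k.+1 - z k.+1) (z k.+1 - zs).
  have := xstep k.+1; have := h3 _ k3; have := h2 _ k2.
  have := admm_za kkts k; have := h1 _ k1; lra.
apply/cvgn0P => [k|e e0]; first exact: norm2_ge0.
have er : 0 < e / rho by rewrite divr_gt0.
have [N h1] := D0 _ er.
exists N.+1 => -[|k] // Nk.
rewrite -scalerBr norm2Z gtr0_norm// mulrC -ltr_pdivlMr//.
by apply: le_lt_trans (admm_ub kkts k) _; exact: h1.
Qed.
End admm.

(** * Optimality conditions, primal and dual *)

Section kkt.
Context (R : realType) (n d : nat) (A : 'M[R]_(n, d)) (b : 'cV[R]_n).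
Context (g : 'cV[R]_d -> R) (Hg : 'M[R]_d) (h : 'cV[R]_d -> \bar R).
Hypotheses (gH : twice_diff_const_hessian g Hg) (Hgpsd : psd Hg).

Let H := A^T *m A + Hg.
Let q0 := grad g 0 - A^T *m b.
Let f := fsmooth A b g.

Lemma hessian_psd : psd H.
Proof. exact: psdD (psd_gram A) Hgpsd. Qed.

Lemma fsmooth_expansion (x v : 'cV[R]_d) :
  f (x + v) = f x + dotv (H *m x + q0) v + dotv v (H *m v) / 2.
Proof.
have gx : grad g x = grad g 0 + Hg *m x by rewrite -(grad_affine gH) add0r.
have e : A *m (x + v) - b = (A *m x - b) + A *m v by rewrite mulmxDr addrAC.
rewrite /f /fsmooth (quadratic_expansion gH) gx e !norm2_sqr.
have -> : dotv (H *m x + q0) v =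
    dotv (A *m x - b) (A *m v) + dotv (grad g 0 + Hg *m x) v.
  rewrite [dotv _ (A *m v)]dotv_mulmx -dotvDl; congr (dotv _ v).
  by rewrite /H /q0 mulmxDl mulmxBr mulmxA; apply/matrixP => i j; rewrite !mxE; ring.
have -> : dotv v (H *m v) = dotv (A *m v) (A *m v) + dotv v (Hg *m v).
  by rewrite mulmxDl dotvDr -mulmxA [dotv v (A^T *m _)]dotv_mulmx trmxK.
move: (A *m x - b) (A *m v) (g x) => p q gx0.
by rewrite !dotvDl !dotvDr (dotvC q p); field.
Qed.

(** The Hessian is constant, so all terms in x cancel: the linearised x-update coincides with the
    exact one. *)
Lemma admm_rhsE (rho : R) (x z u : 'cV[R]_d) :
  admm_rhs A b g Hg rho x z u = rho *: (z - u) - q0.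
Proof.
have gx : grad g x = grad g 0 + Hg *m x by rewrite -(grad_affine gH) add0r.
rewrite /admm_rhs gx /q0 mulmxBr mulmxA.
by apply/matrixP => i j; rewrite !mxE; ring.
Qed.

Variables (zs ys : 'cV[R]_d).
Hypotheses (sub : subgradient h zs ys) (stat : H *m zs + q0 = - ys).

Let f_ge x : f zs - dotv ys (x - zs) <= f x.
Proof.
have := fsmooth_expansion zs (x - zs); rewrite subrKC stat dotvNl => ->.
by have := hessian_psd.2 (x - zs); lra.
Qed.

Lemma kkt_primal_solution : primal_solution A b g h zs.
Proof.
have [a ha hsub] := sub.
move=> x; rewrite /primal_obj ha -/(f zs) -/(f x).
apply: le_trans (_ : ((f x)%:E + (a + dotv ys (x - zs))%:E <= _)%E); last by rewrite leeD2l.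
by rewrite -!EFinD lee_fin; have := f_ge x; lra.
Qed.

(** At [ys] both conjugates are bounded by their values at the point [zs], with total - f zs - h zs.
    For any y', testing both suprema at [zs] gives at least the same total, as the two inner
    products cancel. *)
Lemma kkt_dual_solution : dual_solution A b g h ys.
Proof.
have [a ha hsub] := sub.
move=> y'; rewrite /dual_obj leeN2.
apply: (@le_trans _ _ ((- dotv ys zs - f zs)%:E + (dotv ys zs - a)%:E)%E).
  apply: leeD; apply: ge_ereal_sup => _ [x _ <-].
    by rewrite -EFinB lee_fin dotvNl; have := f_ge x; rewrite dotvBr -/(f x); lra.
  apply: (@le_trans _ _ ((dotv ys x)%:E - (a + dotv ys (x - zs))%:E)%E).
    by rewrite leeB.
  by rewrite -EFinB lee_fin dotvBr; lra.
apply: (@le_trans _ _ ((dotv (- y') zs - f zs)%:E + (dotv y' zs - a)%:E)%E).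
  by rewrite -!EFinD lee_fin dotvNl; lra.
apply: leeD; apply: ereal_sup_ubound; exists zs => //.
by rewrite ha.
Qed.

End kkt.

Theorem theorem4p3
  (R : realType) (n d s : nat)
  (A : 'M[R]_(n, d)) (b : 'cV[R]_n)
  (g : 'cV[R]_d -> R) (Hg : 'M[R]_d) (h : 'cV[R]_d -> \bar R)
  (x0 z0 u0 : 'cV[R]_d) (rho : R) (eps : nat -> R) (delta : R) (Rb : R)
  (dT : measure_display) (T : measurableType dT) (P : probability T R)
  (Om : T -> 'M[R]_(d, s)) (U : T -> 'M[R]_(d, s)) (lam : T -> 'rV[R]_s)
  (xt zt ut : T -> nat -> 'cV[R]_d) :
  (* g convex, twice differentiable, constant psd Hessian Hg *)
  convex_function [set: 'cV[R]_d] g ->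
  twice_diff_const_hessian g Hg ->
  psd Hg ->
  (* h closed proper convex *)
  closed_proper_convex h ->
  (* the problem has a solution *)
  (exists xs, primal_solution A b g h xs) ->
  (* parameters *)
  0 < rho ->
  (forall k, 0 < eps k) -> cvgn (series eps) ->
  0 < delta < 1 ->
  (* sketch size *)
  let H := A^T *m A + Hg in
  8 * (Num.sqrt (deff H rho) + Num.sqrt (8 * ln (16 / delta))) ^+ 2 <= s%:R ->
  (* Gaussian test matrix and Nystrom preconditioner *)
  std_gaussian_matrix P Om ->
  (forall w, nystrom_eig H (Om w) (U w) (lam w)) ->
  let Pc w := nys_precond rho (U w) (lam w) in
  let r w k := admm_rhs A b g Hg rho (xt w k) (zt w k) (ut w k) in
  (* NysADMM iterations *)
  (forall w, [/\ xt w 0 = x0, zt w 0 = z0 & ut w 0 = u0]) ->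
  (forall w k, xt w k.+1 =
     pcg (H + rho%:M) (Pc w) (r w k) (pcg_iters Rb (eps k) rho)) ->
  (forall w k z,
     ((rho / 2 * norm2 (xt w k.+1 - zt w k.+1 + ut w k) ^+ 2)%:E
        + h (zt w k.+1)
      <= (rho / 2 * norm2 (xt w k.+1 - z + ut w k) ^+ 2)%:E + h z)%E) ->
  (forall w k, ut w k.+1 = ut w k + xt w k.+1 - zt w k.+1) ->
  (* bounded right-hand sides *)
  (forall w k, norm2 (r w k) <= Rb) ->
  exists E : set T,
    [/\ measurable E, ((1 - delta)%:E <= P E)%E &
      forall w, E w ->
        [/\ forall k, norm2 (xt w k.+1 - invmx (H + rho%:M) *m r w k) <= eps k,
            exists xs, primal_solution A b g h xs /\
              (fun k => norm2 (xt w k - xs)) @ \oo --> (0 : R)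
          & exists ys, dual_solution A b g h ys /\
              (fun k => norm2 (rho *: ut w k - ys)) @ \oo --> (0 : R)]].
Proof.
move=> _ gH Hgpsd hcpc primal rho0 eps0 ceps de01 H hs Om_std Neig Pc r _ xstep zstep ustep rR.
have Hpsd : psd H := hessian_psd A Hgpsd.
have [m [F [FE Fle Fdeff]]] := deff_factor Hpsd rho0.
have deff0 : 0 <= deff H rho by rewrite -Fdeff sumr_ge0// => j _; exact: dotvv_ge0.
have /andP[de0 de1] := de01.
have q0 : 0 < Num.sqrt (8 * ln (16 / delta)).
  rewrite sqrtr_gt0 mulr_gt0// ln_gt0// ltr_pdivlMr//; lra.
have s0 : (0 < s)%N.
  rewrite -(ltr_nat R) (lt_le_trans _ hs)// mulr_gt0// exprn_gt0//.
  by rewrite ltr_wpDl.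
have deff8 : 8 * deff H rho <= s%:R.
  apply: le_trans hs; rewrite ler_pM2l// -[leLHS]sqr_sqrtr//.
  rewrite ler_pXn2r ?nnegrE ?addr_ge0// lerDl; exact: ltW.
have hsF := hs; rewrite -Fdeff in hsF.
have [E [mE PE good]] := sketch_event Om_std de01 Fle hsF.
exists E; split => // w Ew.
have Epsd := nystrom_residual_psd Hpsd (Neig w).
have res := residual_le_of_sketch Hpsd rho0 Epsd FE (good w Ew).
have [al al0 PM] := nys_precond_bounds Hpsd rho0 (Neig w) s0 deff8 res.
have Ppsd := nys_precond_psd Hpsd rho0 (Neig w) s0.
have Pu := nys_precond_unit Hpsd rho0 (Neig w) s0.
have x1 k : norm2 (xt w k.+1 - invmx (H + rho%:M) *m r w k) <= eps k.
  by rewrite xstep; apply: (pcg_norm2_error Hpsd rho0 Ppsd Pu al0 (eps0 k) PM).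
(* The [eq_ind] term transports [x1] along [admm_rhsE], putting the right-hand side in its x-free
   form. *)
have [zs [us [sub stat xcvg ucvg]]] := @admm_converges R d H (grad g 0 - A^T *m b) rho
  (fsmooth A b g) h (xt w) (zt w) (ut w) eps Hpsd rho0 hcpc (fsmooth_expansion A b gH)
  primal eps0 ceps
  (fun k => (eq_ind _ (fun c => norm2 (xt w k.+1 - invmx (H + rho%:M) *m c) <= eps k)
     (x1 k) _ (admm_rhsE A b gH rho (xt w k) (zt w k) (ut w k))))
  (zstep w) (ustep w).
split => //.
- exists zs; split => //.
  exact: (kkt_primal_solution gH Hgpsd sub stat).
- exists (rho *: us); split => //.
  exact: (kkt_dual_solution gH Hgpsd sub stat).
Qed.
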